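(* Let $K\subset\widehat{\mathbb{C}}$ be compact, let $P\subset\widehat{\mathbb{C}}$ contain exactly one point from each connected component of $\widehat{\mathbb{C}}\setminus K$, and suppose $f$ is a (complex-valued) holomorphic function in a neighborhood $U$ of $K$. Then there exist constants $A,B\in(1,\infty)$ and a sequence of rational mappings $(R_n)_{n\ge 1}$, with $R_n$ of degree $\leq n$ and $R_n^{-1}(\infty)\subset P$ for all $n$, such that $$\sup_{z\in K}|f(z)-R_n(z)|\leq\frac{A}{B^n}\quad\text{for all } n.$$
   Context: $\widehat{\mathbb{C}}$ is the Riemann sphere. The degree of a rational map is its topological degree as a map $\widehat{\mathbb{C}}\to\widehat{\mathbb{C}}$; (finite) constants are allowed as rational maps of degree $0$. *)

(* Defs.v *)
From HB Require Import structures.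
From mathcomp Require Import all_boot all_order all_algebra.
From mathcomp Require Import complex.
From mathcomp Require Import all_classical all_reals all_analysis.

Set Implicit Arguments.
Unset Strict Implicit.
Unset Printing Implicit Defensive.

Import Order.TTheory GRing.Theory Num.Theory.
Import numFieldNormedType.Exports.

Local Open Scope classical_set_scope.
Local Open Scope ring_scope.

(* The complex numbers over R with the topology of the modulus; the regular
   module [R[i]^o] is the alias that carries the normed structure. *)
Notation cplx R := ((complex R)^o).

(* [Some z] is the finite point z and [None] is the point at infinity. *)
Notation sphere R := (one_point_compactification (cplx R)).

(* The chart w |-> 1 / w centred at infinity. *)
Definition chart_infty (R : realType) (w : cplx R) : sphere R :=
  if w == 0 then None else Some (w^-1 : cplx R).

Definition complex_differentiable_at (R : realType) (f : sphere R -> cplx R)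
    (x : sphere R) : Prop :=
  match x with
  | Some z => derivable (fun w : cplx R => f (Some w)) z 1
  | None => derivable (fun w : cplx R => f (@chart_infty R w)) 0 1
  end.

(* Meant for open [U]; the values of [f] outside [U] are then irrelevant. *)
Definition holomorphic_on (R : realType) (U : set (sphere R))
    (f : sphere R -> cplx R) : Prop :=
  forall x, U x -> complex_differentiable_at f x.

(* The self-map of the sphere induced by p / q, for coprime p and q with
   q != 0; its value at infinity is the limit of p / q there. *)
Definition fraction_map (R : realType) (p q : {poly R[i]}) (x : sphere R) :
    sphere R :=
  match x with
  | Some z =>
      if q.[z] == 0 then None else Some (p.[z] / q.[z] : cplx R)
  | None =>
      if (size q < size p)%N then None
      else Some (p`_(size q).-1 / lead_coef q : cplx R)
  end.

(* Finite constants are included (q = 1); the constant infinity is not. *)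
Definition rational_map (R : realType) (g : sphere R -> sphere R) : Prop :=
  exists p q : {poly R[i]},
    [/\ q != 0, coprimep p q & g = @fraction_map R p q].

(* The topological degree of a rational map g. Such a map preserves
   orientation wherever it is a local homeomorphism, so every preimage of a
   regular value counts +1 and the degree is the number of preimages of a
   regular value. All but finitely many points are regular values. A constant
   has degree 0, because almost all of its fibres are empty. *)
Definition topological_degree (R : realType) (g : sphere R -> sphere R)
    (d : nat) : Prop :=
  exists E : set (sphere R), finite_set E /\
    forall w, ~ E w -> (g @^-1` [set w] #= `I_d)%card.

(* |c - w| for a complex number c and a point w of the sphere, equal to +oo
   when w is the point at infinity. *)
Definition sphere_dist (R : realType) (c : cplx R) (w : sphere R) : \bar R :=
  match w with
  | Some v => (ComplexField.Normc.normc (c - v : R[i]))%:E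
  | None => +oo%E
  end.

(* Points of [P] that belong to no component of [A] are allowed. *)
Definition one_point_per_component (T : topologicalType) (A P : set T) : Prop :=
  forall x, A x -> exists! p, P p /\ connected_component A x p.

(* Main.v *)
Require Import Defs.
From mathcomp Require Import all_boot all_order all_algebra.
From mathcomp Require Import complex.
From mathcomp Require Import all_classical all_reals all_analysis.
From mathcomp Require Import ring lra zify.
Import Order.TTheory GRing.Theory Num.Theory.
Import numFieldNormedType.Exports.
Local Open Scope classical_set_scope.
Local Open Scope ring_scope.

Set Implicit Arguments.
Unset Strict Implicit.
Unset Printing Implicit Defensive.

(* A chart sends a point p0 of P outside K to infinity, so that K becomes a compact
   subset of the plane. Applying Goursat's theorem to the difference quotients
   (f - f z) / (t - z) on the squares of a fine grid that come close to K gives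
   Cauchy's formula for f on K over a chain of edges at positive distance from K;
   replacing the integrals by Riemann sums, uniformly on K, it remains to
   approximate the kernels 1 / (t - z) at a geometric rate, uniformly in t.
   If h is a rational function with poles in P and |h t| > sup_K |h|, then
   (1 - (h z / h t) ^ n) / (t - z) has no pole at t and does this with denominator
   a power of that of h. The set of the t that have such an h contains P \ K and is
   open and closed in the complement of K, hence it is the whole complement.
   When K is the whole sphere, f is constant by Liouville's theorem. *)

(** * The complex modulus *)

(** What shapes the proof is the degree bound. The number of nodes of the Riemann sums grows with n,
    so the kernels 1 / (t - z) must all be approximated over one denominator that depends on n only;
    the sums then just add numerators, and the degree stays linear in n however many nodes there
    are. Such a denominator is the n-th power of a product of finitely many D, one for each piece of
    a finite cover of the relevant part of a square. Passing from degree c n to degree n costs a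
    root of the rate. Poles at p0 are free because p0 is in P: in the coordinate they appear as an
    excess of deg Q over deg D, so only these two degrees have to be bounded. The value 2 pi i of
    the winding integral is never computed. Cauchy's formula is kept in the form f z * W = integral
    over the chain, where W is the integral of the kernel over the boundary of the whole grid; it
    suffices that W does not depend on z and is nonzero. *)

Section ComplexNorm.
Variable R : realType.
Local Notation C := R[i].
Local Notation nm := (@ComplexField.Normc.normc R).
Implicit Types x y z : C.

Lemma nm_ge0 z : 0 <= nm z.
Proof. by case: z => a b /=; rewrite sqrtr_ge0. Qed.

Lemma nm_normC z : `|z| = (nm z)%:C%C.
Proof. by case: z. Qed.

Lemma nm0 : nm 0 = 0.
Proof. exact: ComplexField.Normc.normc0. Qed.

Lemma nm1 : nm 1 = 1.
Proof. exact: ComplexField.Normc.normc1. Qed.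

Lemma nmM x y : nm (x * y) = nm x * nm y.
Proof. exact: ComplexField.Normc.normcM. Qed.

Lemma nmV x : nm x^-1 = (nm x)^-1.
Proof. exact: ComplexField.Normc.normcV. Qed.

Lemma nmN x : nm (- x) = nm x.
Proof. exact: normcN. Qed.

Lemma nm_sub x y : nm (x - y) = nm (y - x).
Proof. by rewrite -nmN opprB. Qed.

Lemma nmD x y : nm (x + y) <= nm x + nm y.
Proof. exact: le_normcD. Qed.

Lemma nmB x y : nm (x - y) <= nm x + nm y.
Proof. by rewrite -[nm y]nmN; exact: nmD. Qed.

Lemma nm_dist y x z : nm (x - z) <= nm (x - y) + nm (y - z).
Proof. by have := nmD (x - y) (y - z); rewrite addrA subrK. Qed.

Lemma nm_lower x y : nm x - nm y <= nm (x - y).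
Proof. by have := nmD (x - y) y; rewrite subrK; lra. Qed.

Lemma nm_eq0 x : (nm x == 0) = (x == 0).
Proof.
by apply/eqP/eqP => [|->]; [exact: ComplexField.Normc.eq0_normc | exact: nm0].
Qed.

Lemma nm_gt0 x : (0 < nm x) = (x != 0).
Proof. by rewrite lt_def nm_ge0 andbT nm_eq0. Qed.

Lemma nmX x n : nm (x ^+ n) = nm x ^+ n.
Proof.
by elim: n => [|n IH]; rewrite ?expr0 ?nm1 // !exprS nmM IH.
Qed.

Lemma nm_real (a : R) : nm a%:C%C = `|a|.
Proof. by rewrite /= expr0n /= addr0 sqrtr_sqr. Qed.

Lemma nm_Re z : `|complex.Re z| <= nm z.
Proof.
case: z => a b /=; rewrite -sqrtr_sqr ler_sqrt ?addr_ge0 ?sqr_ge0 //.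
by rewrite lerDl sqr_ge0.
Qed.

Lemma nm_Im z : `|complex.Im z| <= nm z.
Proof.
case: z => a b /=; rewrite -sqrtr_sqr ler_sqrt ?addr_ge0 ?sqr_ge0 //.
by rewrite lerDr sqr_ge0.
Qed.

Lemma nm_ReIm z : nm z <= `|complex.Re z| + `|complex.Im z|.
Proof.
case: z => a b /=.
rewrite -(ler_pXn2r (n := 2)) ?nnegrE ?sqrtr_ge0 ?addr_ge0 //.
rewrite sqr_sqrtr ?addr_ge0 ?sqr_ge0 // sqrrD !real_normK ?num_real //.
have : 0 <= `|a| * `|b| by rewrite mulr_ge0.
by rewrite mulr2n; lra.
Qed.

Lemma ImD x y : complex.Im (x + y) = complex.Im x + complex.Im y.
Proof. by case: x y => [? ?] []. Qed.

Lemma ReB x y : complex.Re (x - y) = complex.Re x - complex.Re y.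
Proof. by case: x y => [? ?] []. Qed.

Lemma ImB x y : complex.Im (x - y) = complex.Im x - complex.Im y.
Proof. by case: x y => [? ?] []. Qed.

Lemma half_complex (a b : R) : (a +i* b)%C / 2 = ((a / 2) +i* (b / 2))%C.
Proof.
have n2 : (2 : C) != 0 by rewrite pnatr_eq0.
apply: (mulIf n2); rewrite mulfVK //.
have -> : (2 : C) = (1 +i* 0)%C + (1 +i* 0)%C by rewrite mulr2n.
by apply/eqP; rewrite eq_complex /=; apply/andP; split; apply/eqP; lra.
Qed.

Lemma midpointE (a b c d : R) :
  ((a +i* b)%C + (c +i* d)%C) / 2 = (((a + c) / 2) +i* ((b + d) / 2))%C.
Proof. by rewrite -half_complex. Qed.

Lemma nm_half x : nm (x / 2) = nm x / 2.
Proof.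
have -> : (2 : C) = (2 : R)%:C%C by rewrite !mulr2n rmorphD rmorph1.
by rewrite nmM nmV nm_real ger0_norm.
Qed.

End ComplexNorm.

Section Cousin.
Variable R : realType.

Lemma half_pow_lt (c d : R) : 0 < d -> exists n : nat, c / 2 ^+ n < d.
Proof.
move=> d0; exists (Num.bound `|c / d|); set m := Num.bound _.
have := archi_boundP (normr_ge0 (c / d)); rewrite -/m => cm.
have m2 : (m%:R : R) <= 2 ^+ m by rewrite -natrX ler_nat ltnW // ltn_expl.
rewrite ltr_pdivrMr ?exprn_gt0 //.
have := ler_norm (c / d); rewrite ler_pdivrMr // => h.
rewrite (le_lt_trans h) // mulrC ltr_pM2l //.
exact: lt_le_trans m2.
Qed.

End Cousin.

#[local] Arguments ComplexField.Normc.normc : simpl never.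

(** * Integration along axis-parallel segments *)

Section Subdivision.
Variable R : realType.
Local Notation C := R[i].
Local Notation nm := (@ComplexField.Normc.normc R).

Lemma nested_intervals (a b : nat -> R) :
  (forall n, a n <= a n.+1) -> (forall n, b n.+1 <= b n) ->
  (forall n, a n <= b n) -> exists x, forall n, a n <= x <= b n.
Proof.
move=> ha hb hab.
have Ha : {homo a : m n / (m <= n)%N >-> m <= n}.
  exact: homo_leq (@lexx _ _) (@le_trans _ _) ha.
have Hb : {homo b : m n / (m <= n)%N >-> n <= m}.
  by apply: (homo_leq (r := fun x y => y <= x)) => // x y z h1 /le_trans; apply.
have hub n : ubound (range a) (b n).
  move=> _ [m _ <-]; have [mn|/ltnW nm] := leqP m n.
    exact: le_trans (Ha _ _ mn) (hab n).
  exact: le_trans (hab m) (Hb _ _ nm).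
exists (sup (range a)) => n; apply/andP; split.
  by apply: ub_le_sup; [exists (b 0%N); exact: hub | exists n].
by apply: ge_sup; [exists (a 0%N), 0%N | exact: hub].
Qed.

(* Induction by quadrisection: it plays the part of every compactness argument
   on a closed rectangle, degenerate rectangles (segments) included. *)
Lemma cousin (Pr : R -> R -> R -> R -> Prop) (X0 X1 Y0 Y1 : R) :
  X0 <= X1 -> Y0 <= Y1 ->
  (forall x0 x1 y0 y1, x0 <= x1 -> y0 <= y1 ->
    let xm := (x0 + x1) / 2 in let ym := (y0 + y1) / 2 in
    Pr x0 xm y0 ym -> Pr xm x1 y0 ym -> Pr x0 xm ym y1 -> Pr xm x1 ym y1 ->
    Pr x0 x1 y0 y1) ->
  (forall x y, X0 <= x <= X1 -> Y0 <= y <= Y1 ->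
    exists2 d, 0 < d & forall x0 x1 y0 y1,
      x0 <= x <= x1 -> y0 <= y <= y1 ->
      X0 <= x0 -> x1 <= X1 -> Y0 <= y0 -> y1 <= Y1 ->
      x1 - x0 < d -> y1 - y0 < d -> Pr x0 x1 y0 y1) ->
  Pr X0 X1 Y0 Y1.
Proof.
move=> hX hY split local; apply: contrapT => bad0.
pose half (b : bool) (I : R * R) :=
  if b then (I.1, (I.1 + I.2) / 2) else ((I.1 + I.2) / 2, I.2).
pose child (b : bool * bool) (q : (R * R) * (R * R)) :=
  (half b.1 q.1, half b.2 q.2).
pose P q := Pr q.1.1 q.1.2 q.2.1 q.2.2.
pose next q := child (xget (true, true) [set b | ~ P (child b q)]) q.
pose s n := iter n next ((X0, X1), (Y0, Y1)).
have sub b I : I.1 <= I.2 ->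
  [/\ I.1 <= (half b I).1, (half b I).2 <= I.2, (half b I).1 <= (half b I).2 &
      (half b I).2 - (half b I).1 = (I.2 - I.1) / 2].
  by case: b => /= h; split; lra.
have inv n : [/\ (s n).1.1 <= (s n).1.2, (s n).2.1 <= (s n).2.2 & ~ P (s n)].
  elim: n => [|n [h1 h2 h3]]; first by split.
  rewrite /s iterS -/(s n) /next; set b := xget _ _.
  have [] := sub b.1 _ h1; have [] := sub b.2 _ h2 => _ _ h4 _ _ _ h5 _.
  split=> //; rewrite /b; case: xgetP => [c -> //|H].
  move=> _; apply: h3; apply: split => //; rewrite -/(P (_, _, (_, _))).
  - by apply: contrapT; exact: (H (true, true)).
  - by apply: contrapT; exact: (H (false, true)).
  - by apply: contrapT; exact: (H (true, false)).
  - by apply: contrapT; exact: (H (false, false)).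
have step n : [/\ (s n).1.1 <= (s n.+1).1.1, (s n.+1).1.2 <= (s n).1.2,
    (s n).2.1 <= (s n.+1).2.1 & (s n.+1).2.2 <= (s n).2.2].
  have [h1 h2 _] := inv n; rewrite {2 4 5 8}/s iterS -/(s n) /next.
  set b := xget _ _.
  by have [? ? _ _] := sub b.1 _ h1; have [? ? _ _] := sub b.2 _ h2; split.
have len n : (s n).1.2 - (s n).1.1 = (X1 - X0) / 2 ^+ n /\
             (s n).2.2 - (s n).2.1 = (Y1 - Y0) / 2 ^+ n.
  elim: n => [|n [l1 l2]]; first by rewrite expr0 !divr1.
  have [h1 h2 _] := inv n; rewrite /s iterS -/(s n) /next.
  set b := xget _ _.
  have [_ _ _ e1] := sub b.1 _ h1; have [_ _ _ e2] := sub b.2 _ h2.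
  by rewrite e1 e2 l1 l2 exprSr invfM !mulrA.
have [||| x hx] := nested_intervals (a := fun n => (s n).1.1) (b := fun n => (s n).1.2).
- by move=> n; have [] := step n.
- by move=> n; have [] := step n.
- by move=> n; have [] := inv n.
have [||| y hy] := nested_intervals (a := fun n => (s n).2.1) (b := fun n => (s n).2.2).
- by move=> n; have [] := step n.
- by move=> n; have [] := step n.
- by move=> n; have [] := inv n.
have [d d0 hd] := local x y (hx 0%N) (hy 0%N).
(* The sum of the two sides, so that one [n] brings both below [d]. *)
have [n hn] := half_pow_lt (X1 - X0 + (Y1 - Y0)) d0.
have [_ _] := inv n; apply.
have [l1 l2] := len n.
have p0 : 0 < (2 ^+ n : R)^-1 by rewrite invr_gt0 exprn_gt0.
have in0 m : [/\ X0 <= (s m).1.1, (s m).1.2 <= X1, Y0 <= (s m).2.1 & (s m).2.2 <= Y1].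
  elim: m => [|m [? ? ? ?]]; first by rewrite /s /= !lexx.
  by have [? ? ? ?] := step m; split; lra.
have [? ? ? ?] := in0 n.
have q1 : 0 <= (X1 - X0) / 2 ^+ n by rewrite mulr_ge0 ?subr_ge0 // ltW.
have q2 : 0 <= (Y1 - Y0) / 2 ^+ n by rewrite mulr_ge0 ?subr_ge0 // ltW.
apply: hd => //; rewrite ?l1 ?l2; apply: le_lt_trans hn; rewrite mulrDl; lra.
Qed.

End Subdivision.

(** * Dyadic Riemann sums and line integrals *)

Section Integral.
Variable R : realType.
Local Notation C := R[i].
Local Notation nm := (@ComplexField.Normc.normc R).

Definition rect (x0 x1 y0 y1 : R) (z : C) : Prop :=
  x0 <= complex.Re z <= x1 /\ y0 <= complex.Im z <= y1.

(** Dyadic sums add nothing but midpoints to the endpoints, so this property keeps all their nodes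
    inside [X]. *)
Definition midconvex (X : C -> Prop) : Prop :=
  forall a b, X a -> X b -> X ((a + b) / 2).

Lemma rect_midconvex x0 x1 y0 y1 : midconvex (rect x0 x1 y0 y1).
Proof.
move=> [a1 a2] [b1 b2] [/= h1 h2] [/= h3 h4]; rewrite midpointE.
by split => /=; lra.
Qed.

(* Dyadic left Riemann sums: their additivity at the midpoint is exact, and it is
   the only additivity that Goursat's argument and the grid below need. *)
Fixpoint rsum (g : C -> C) (n : nat) (a b : C) : C :=
  if n is m.+1 then rsum g m a ((a + b) / 2) + rsum g m ((a + b) / 2) b
  else (b - a) * g a.

Lemma nm_midl (a b : C) : nm ((a + b) / 2 - a) = nm (b - a) / 2.
Proof.
have n2 : (2 : C) != 0 by rewrite pnatr_eq0.
by rewrite -nm_half; congr nm; field.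
Qed.

Lemma nm_midr (a b : C) : nm (b - (a + b) / 2) = nm (b - a) / 2.
Proof.
have n2 : (2 : C) != 0 by rewrite pnatr_eq0.
by rewrite -nm_half; congr nm; field.
Qed.

Lemma rsum_lin (k : C) (g h : C -> C) n a b :
  rsum (fun x => k * g x + h x) n a b = k * rsum g n a b + rsum h n a b.
Proof. by elim: n a b => [|n IH] a b /=; [ring | rewrite !IH; ring]. Qed.

Lemma rsum_cst (c : C) n a b : rsum (fun=> c) n a b = (b - a) * c.
Proof. by elim: n a b => [|n IH] a b //=; rewrite !IH; ring. Qed.

Lemma rsum_le (X : C -> Prop) (g h : C -> C) (e : R) n a b :
  midconvex X -> X a -> X b -> (forall x, X x -> nm (g x - h x) <= e) ->
  nm (rsum g n a b - rsum h n a b) <= e * nm (b - a).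
Proof.
move=> mX + + H; elim: n a b => [|n IH] a b Xa Xb /=.
  by rewrite -mulrBr nmM mulrC ler_wpM2r ?nm_ge0 ?H.
have Xm := mX _ _ Xa Xb.
have := IH _ _ Xa Xm; have := IH _ _ Xm Xb; rewrite nm_midl nm_midr.
set u := rsum g n a _; set v := rsum g n _ b.
set u' := rsum h n a _; set v' := rsum h n _ b => h1 h2.
have -> : u + v - (u' + v') = (u - u') + (v - v') by ring.
by apply: le_trans (nmD _ _) _; lra.
Qed.

(** Here [g] plays the part of the derivative of [F], with a quadratic remainder. A halving replaces
    one error K |b - a|^2 by two errors a quarter as large, so the total error halves at each
    level. *)
Lemma rsum_primitive (X : C -> Prop) (F g : C -> C) (K : R) n a b :
  midconvex X -> X a -> X b ->
  (forall x y, X x -> X y ->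
     nm (F y - F x - g x * (y - x)) <= K * nm (y - x) ^+ 2) ->
  nm (rsum g n a b - (F b - F a)) <= K * nm (b - a) ^+ 2 / 2 ^+ n.
Proof.
move=> mX + + H; elim: n a b => [|n IH] a b Xa Xb /=.
  rewrite expr0 divr1 nm_sub; have := H _ _ Xa Xb; congr (nm _ <= _); ring.
have Xm := mX _ _ Xa Xb.
have := IH _ _ Xa Xm; have := IH _ _ Xm Xb; rewrite nm_midl nm_midr.
set m := (a + b) / 2; set u := rsum g n a _; set v := rsum g n _ b => h1 h2.
have -> : u + v - (F b - F a) = (u - (F m - F a)) + (v - (F b - F m)) by ring.
apply: le_trans (nmD _ _) _; apply: le_trans (lerD h2 h1) _.
have p0 : (2 ^+ n : R) != 0 by rewrite expf_neq0 // pnatr_eq0.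
by rewrite [2 ^+ n.+1]exprS le_eqVlt; apply/orP; left; apply/eqP; field.
Qed.

Definition is_cint (g : C -> C) (a b I : C) : Prop :=
  forall e, 0 < e -> exists N, forall n, (N <= n)%N -> nm (rsum g n a b - I) <= e.

(** The value 0 is a default where the dyadic sums do not converge, so the rules below carry
    [has_cint] hypotheses. *)
Definition cint (g : C -> C) (a b : C) : C := xget 0 [set I | is_cint g a b I].

Lemma small_eq0 (z : C) : (forall e, 0 < e -> nm z <= e) -> z = 0.
Proof.
move=> H; apply/eqP; rewrite -nm_eq0 eq_le nm_ge0 andbT.
by apply/ler_addgt0Pr => e e0; rewrite add0r H.
Qed.

Lemma is_cint_unique g a b I J : is_cint g a b I -> is_cint g a b J -> I = J.
Proof.
move=> hI hJ; apply/subr0_eq/small_eq0 => e e0.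
have e2 : 0 < e / 2 by lra.
have [N HN] := hI _ e2; have [M HM] := hJ _ e2.
have h1 := HN _ (leq_maxl N M); have h2 := HM _ (leq_maxr N M).
have := nm_dist (rsum g (maxn N M) a b) I J.
by rewrite (nm_sub I (rsum _ _ _ _)); lra.
Qed.

Lemma cintE g a b I : is_cint g a b I -> cint g a b = I.
Proof.
by move=> hI; rewrite /cint; case: xgetP => [J -> hJ|/(_ I)//];
  exact: is_cint_unique hJ hI.
Qed.

Definition has_cint g a b : Prop := exists I, is_cint g a b I.

Lemma cintP g a b : has_cint g a b -> is_cint g a b (cint g a b).
Proof. by move=> [I hI]; rewrite (cintE hI). Qed.

Lemma is_cint_lin k g h a b I J : is_cint g a b I -> is_cint h a b J ->
  is_cint (fun x => k * g x + h x) a b (k * I + J).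
Proof.
move=> hI hJ e e0.
have k0 : 0 < nm k + 1 by rewrite ltr_wpDl ?nm_ge0.
have e2 : 0 < e / 2 by lra.
have [N HN] := hI _ (divr_gt0 e2 k0); have [M HM] := hJ _ e2.
exists (maxn N M) => n; rewrite geq_max => /andP[/HN h1 /HM h2].
rewrite rsum_lin.
set u := rsum g _ _ _; set v := rsum h _ _ _.
have -> : k * u + v - (k * I + J) = k * (u - I) + (v - J) by ring.
apply: le_trans (nmD _ _) _; rewrite nmM.
have : nm k * nm (u - I) <= e / 2.
  rewrite -[leRHS](divfK (lt0r_neq0 k0)) mulrC.
  by apply: ler_pM; rewrite ?nm_ge0 // lerDl.
by move: h2; rewrite -/v; lra.
Qed.

Lemma cint_lin k g h a b : has_cint g a b -> has_cint h a b ->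
  cint (fun x => k * g x + h x) a b = k * cint g a b + cint h a b.
Proof. by move=> /cintP hg /cintP hh; apply/cintE/is_cint_lin. Qed.

Lemma cint_mid g a b (m := (a + b) / 2) : has_cint g a m -> has_cint g m b ->
  is_cint g a b (cint g a m + cint g m b).
Proof.
move=> /cintP h1 /cintP h2 e e0; have e2 : 0 < e / 2 by lra.
have [N HN] := h1 _ e2; have [M HM] := h2 _ e2.
exists (maxn N M).+1 => -[//|n]; rewrite ltnS geq_max => /andP[/HN k1 /HM k2] /=.
rewrite -/m; set u := rsum g n a m; set v := rsum g n m b.
set I := cint g a m; set J := cint g m b.
have -> : u + v - (I + J) = (u - I) + (v - J) by ring.
by apply: le_trans (nmD _ _) _; move: k1 k2; rewrite -/u -/v -/I -/J; lra.
Qed.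

Lemma is_cint_le (X : C -> Prop) (g h : C -> C) (e : R) a b I J :
  midconvex X -> X a -> X b -> (forall x, X x -> nm (g x - h x) <= e) ->
  is_cint g a b I -> is_cint h a b J -> nm (I - J) <= e * nm (b - a).
Proof.
move=> mX Xa Xb H hI hJ; apply/ler_addgt0Pr => d d0.
have d2 : 0 < d / 2 by lra.
have [N HN] := hI _ d2; have [M HM] := hJ _ d2.
have h1 := HN _ (leq_maxl N M); have h2 := HM _ (leq_maxr N M).
have h3 := rsum_le (maxn N M) mX Xa Xb H.
have := nm_dist (rsum g (maxn N M) a b) I J.
have := nm_dist (rsum h (maxn N M) a b) (rsum g (maxn N M) a b) J.
by rewrite (nm_sub I (rsum _ _ _ _)); lra.
Qed.

Lemma is_cint_cst c a b : is_cint (fun=> c) a b ((b - a) * c).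
Proof. by move=> e e0; exists 0%N => n _; rewrite rsum_cst subrr nm0 ltW. Qed.

Lemma cint_bound (X : C -> Prop) (g : C -> C) (e : R) a b :
  midconvex X -> X a -> X b -> (forall x, X x -> nm (g x) <= e) ->
  has_cint g a b -> nm (cint g a b) <= e * nm (b - a).
Proof.
move=> mX Xa Xb H /cintP hI.
have := is_cint_le (h := fun=> 0) (e := e) mX Xa Xb _ hI (@is_cint_cst 0 a b).
by rewrite mulr0 subr0; apply => x Xx; rewrite subr0 H.
Qed.

Lemma is_cint_primitive (X : C -> Prop) (F g : C -> C) (K : R) a b :
  midconvex X -> X a -> X b ->
  (forall x y, X x -> X y ->
     nm (F y - F x - g x * (y - x)) <= K * nm (y - x) ^+ 2) ->
  is_cint g a b (F b - F a).
Proof.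
move=> mX Xa Xb H e e0.
have c0 : 0 <= K * nm (b - a) ^+ 2 := le_trans (nm_ge0 _) (H _ _ Xa Xb).
have [N HN] := half_pow_lt (K * nm (b - a) ^+ 2) e0.
exists N => n Nn; apply: le_trans (rsum_primitive n mX Xa Xb H) _.
apply/ltW/le_lt_trans/HN; apply: ler_wpM2l => //.
by rewrite lef_pV2 ?posrE ?exprn_gt0 // ler_weXn2l // ler1n.
Qed.

Definition cts (X : C -> Prop) (g : C -> C) : Prop :=
  forall x, X x -> forall e, 0 < e ->
    exists2 d, 0 < d & forall y, X y -> nm (y - x) < d -> nm (g y - g x) <= e.

(** A modulus of continuity common to the whole family: the integrands f w / (w - u) depend on a
    parameter u in K, and one dyadic level has to serve every u. *)
Definition equicts (I : Type) (X : C -> Prop) (G : I -> C -> C) : Prop :=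
  forall x, X x -> forall e, 0 < e ->
    exists2 d, 0 < d & forall i y, X y -> nm (y - x) < d ->
      nm (G i y - G i x) <= e.

Lemma rect_dist x0 x1 y0 y1 z w : rect x0 x1 y0 y1 z -> rect x0 x1 y0 y1 w ->
  nm (z - w) <= (x1 - x0) + (y1 - y0).
Proof.
move: z w => [z1 z2] [w1 w2] [/= h1 h2] [/= h3 h4].
apply: le_trans (nm_ReIm _) _ => /=; apply: lerD; rewrite ler_norml; lra.
Qed.

(** The segment is a diagonal of the rectangle, so only the two quadrants that contain half of it
    matter in the quadrisection. On a small rectangle both sums are compared with the sum of a
    constant, which is the same at all levels. *)
Lemma rsum_cauchy (I : Type) (G : I -> C -> C) (X0 X1 Y0 Y1 : R) :
  X0 <= X1 -> Y0 <= Y1 -> equicts (rect X0 X1 Y0 Y1) G ->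
  forall e, 0 < e -> exists N, forall n m, (N <= n)%N -> (N <= m)%N ->
    forall i, nm (rsum (G i) n (X0 +i* Y0)%C (X1 +i* Y1)%C
                  - rsum (G i) m (X0 +i* Y0)%C (X1 +i* Y1)%C)
       <= e * nm ((X1 +i* Y1)%C - (X0 +i* Y0)%C).
Proof.
move=> hX hY cG e e0; pattern X0, X1, Y0, Y1; apply: cousin => //.
  move=> x0 x1 y0 y1 hx hy /= [N HN] _ _ [M HM].
  exists (maxn N M).+1 => -[//|n] [//|m]; rewrite !ltnS !geq_max.
  move=> /andP[n1 n2] /andP[m1 m2] i /=.
  set a := (x0 +i* y0)%C; set b := (x1 +i* y1)%C.
  have := HN _ _ n1 m1 i; have := HM _ _ n2 m2 i.
  rewrite -midpointE -/a -/b nm_midl nm_midr.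
  set u := rsum _ n a _; set v := rsum _ m a _.
  set u' := rsum _ n _ b; set v' := rsum _ m _ b => h1 h2.
  have -> : u + u' - (v + v') = (u - v) + (u' - v') by ring.
  by apply: le_trans (nmD _ _) _; lra.
move=> x y hx hy.
have e4 : 0 < e / 2 by lra.
have [d d0 hd] := cG (x +i* y)%C (conj hx hy) _ e4.
exists (d / 2); first lra.
move=> x0 x1 y0 y1 hx' hy' h1 h2 h3 h4 hdx hdy; exists 0%N => n m _ _ i.
have near z : rect x0 x1 y0 y1 z -> nm (G i z - G i (x +i* y)%C) <= e / 2.
  move=> hz; apply: hd; first by case: hz => ? ?; split; lra.
  by apply: le_lt_trans (rect_dist hz (conj hx' hy' : rect _ _ _ _ (x +i* y)%C)) _; lra.
have ra : rect x0 x1 y0 y1 (x0 +i* y0)%C by split => /=; lra.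
have rb : rect x0 x1 y0 y1 (x1 +i* y1)%C by split => /=; lra.
have mc := @rect_midconvex x0 x1 y0 y1.
have k1 := rsum_le n mc ra rb near; have k2 := rsum_le m mc ra rb near.
move: k1 k2; rewrite !rsum_cst.
set u := rsum _ n _ _; set v := rsum _ m _ _; set c := _ * _.
by have := nm_dist c u v; rewrite (nm_sub c); lra.
Qed.

Lemma complex_complete (s : nat -> C) :
  (forall e, 0 < e -> exists N, forall n m, (N <= n)%N -> (N <= m)%N ->
     nm (s n - s m) <= e) ->
  exists l, forall e, 0 < e -> exists N, forall n, (N <= n)%N -> nm (s n - l) <= e.
Proof.
move=> H.
have real (u : nat -> R) : (forall n m, `|u n - u m| <= nm (s n - s m)) ->
    exists l, forall e, 0 < e -> exists N, forall n, (N <= n)%N -> `|u n - l| <= e.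
  move=> hu; have cu : cvgn u.
    apply: cauchy_cvg; apply/cauchy_exP => e /= e0.
    have e2 : 0 < e / 2 by lra.
    have [N HN] := H _ e2; exists (u N).
    exists N => // n /= Nn; rewrite /ball /=.
    by apply: le_lt_trans (hu _ _) _; apply: le_lt_trans (HN _ _ _ Nn) _ => //; lra.
  exists (limn u) => e e0.
  have /cvgrPdist_le /(_ e e0) [N _ HN] : u @ \oo --> limn u by [].
  by exists N => n Nn; rewrite distrC; exact: HN.
have [|lr hr] := real (fun n => complex.Re (s n)).
  by move=> n m; rewrite -ReB nm_Re.
have [|li hi] := real (fun n => complex.Im (s n)).
  by move=> n m; rewrite -ImB nm_Im.
exists (lr +i* li)%C => e e0; have e2 : 0 < e / 2 by lra.
have [N HN] := hr _ e2; have [M HM] := hi _ e2.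
exists (maxn N M) => n; rewrite geq_max => /andP[/HN h1 /HM h2].
by apply: le_trans (nm_ReIm _) _; rewrite ReB ImB /=; lra.
Qed.

Lemma cts_has_cint (g : C -> C) (X0 X1 Y0 Y1 : R) :
  X0 <= X1 -> Y0 <= Y1 -> cts (rect X0 X1 Y0 Y1) g ->
  has_cint g (X0 +i* Y0)%C (X1 +i* Y1)%C.
Proof.
move=> hX hY cg; apply: complex_complete => e e0.
set a := (X0 +i* Y0)%C; set b := (X1 +i* Y1)%C.
have k0 : 0 < nm (b - a) + 1 by rewrite ltr_wpDl ?nm_ge0.
have [|N HN] := @rsum_cauchy unit (fun=> g) _ _ _ _ hX hY _ _ (divr_gt0 e0 k0).
  by move=> x Xx d d0; have [r r0 hr] := cg x Xx d d0; exists r.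
exists N => n m Nn Nm; apply: le_trans (HN _ _ Nn Nm tt) _; rewrite -/a -/b.
rewrite mulrAC -mulrA ler_piMr ?ltW // ltr_pdivrMr // mul1r; lra.
Qed.

(** The Cauchy estimate provides one level for the whole family; sending the other level to
    infinity, separately for each [i], keeps the bound. *)
Lemma rsum_cvg_unif (I : Type) (G : I -> C -> C) (X0 X1 Y0 Y1 : R)
    (a := (X0 +i* Y0)%C) (b := (X1 +i* Y1)%C) :
  X0 <= X1 -> Y0 <= Y1 -> equicts (rect X0 X1 Y0 Y1) G ->
  forall e, 0 < e -> exists n, forall i, nm (rsum (G i) n a b - cint (G i) a b) <= e.
Proof.
move=> hX hY cG e e0.
have k0 : 0 < nm (b - a) + 1 by rewrite ltr_wpDl ?nm_ge0.
have e2 : 0 < e / 2 by lra.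
have [N HN] := rsum_cauchy hX hY cG (divr_gt0 e2 k0).
exists N => i.
have /cintP /(_ _ e2) [M HM] : has_cint (G i) a b.
  apply: cts_has_cint => // x Xx d d0; have [r r0 hr] := cG x Xx d d0.
  by exists r => // y; exact: hr.
have h1 := HM _ (leq_maxr N M).
have := HN _ _ (leqnn N) (leq_maxl N M) i; rewrite -/a -/b => h2.
have h3 : e / 2 / (nm (b - a) + 1) * nm (b - a) <= e / 2.
  rewrite mulrAC -mulrA ler_piMr ?ltW // ltr_pdivrMr // mul1r; lra.
by have := nm_dist (rsum (G i) (maxn N M) a b) (rsum (G i) N a b) (cint (G i) a b); lra.
Qed.

(** With [k] the direction of the segment, the hypothesis bounds the imaginary part of g dw from
    below at every node, hence in the limit. It is used with [k] equal to 1 or i, for the sides of a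
    square. *)
Lemma cint_Im_ge (g : C -> C) (X : C -> Prop) (k : C) (c : R) a b :
  midconvex X -> X a -> X b -> has_cint g a b ->
  (forall x, X x -> c <= complex.Im (k * g x)) ->
  forall t : R, 0 <= t -> b - a = t%:C%C * k -> t * c <= complex.Im (cint g a b).
Proof.
move=> mX Xa Xb ig H t t0 hab.
have key n : t * c <= complex.Im (rsum g n a b).
  elim: n a b t t0 hab Xa Xb {ig} => [|n IH] a b t t0 hab Xa Xb /=.
    have -> : (b - a) * g a =
        ((t * complex.Re (k * g a)) +i* (t * complex.Im (k * g a)))%C.
      by rewrite hab -mulrA; case: (k * g a) => p q; rewrite /real_complex_def; simpc.
    by rewrite /= ler_wpM2l // H.
  have n2 : (2 : C) != 0 by rewrite pnatr_eq0.
  have Xm := mX _ _ Xa Xb.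
  have e2 : (t / 2)%:C%C = t%:C%C / 2 :> C by rewrite half_complex mul0r.
  have := IH a _ (t / 2) _ _ Xa Xm; have := IH _ b (t / 2) _ _ Xm Xb.
  rewrite ImD => h1 h2.
  have : t / 2 * c <= complex.Im (rsum g n a ((a + b) / 2)).
    by apply: h2; [lra | rewrite e2 mulrAC -hab; field].
  have : t / 2 * c <= complex.Im (rsum g n ((a + b) / 2) b).
    by apply: h1; [lra | rewrite e2 mulrAC -hab; field].
  lra.
apply/ler_addgt0Pr => e e0; have [N HN] := cintP ig e0.
have := HN N (leqnn N); have := key N; have := nm_Im (rsum g N a b - cint g a b).
rewrite ImB ler_norml; lra.
Qed.

End Integral.

(** * Goursat's theorem *)

Section Goursat.
Variable R : realType.
Local Notation C := R[i].
Local Notation nm := (@ComplexField.Normc.normc R).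

Implicit Types (f g h : C -> C) (x y : R) (z : C).

Definition dif (f : C -> C) (z : C) : Prop :=
  exists l : C, forall e, 0 < e -> exists2 d, 0 < d & forall w, nm (w - z) < d ->
    nm (f w - f z - l * (w - z)) <= e * nm (w - z).

Definition cont_at (f : C -> C) (z : C) : Prop :=
  forall e, 0 < e -> exists2 d, 0 < d & forall w, nm (w - z) < d ->
    nm (f w - f z) <= e.

Lemma dif_cont f z : dif f z -> cont_at f z.
Proof.
move=> [l H] e e0; have [d d0 hd] := H 1 ltr01.
have l0 : 0 < nm l + 1 by rewrite ltr_wpDl ?nm_ge0.
exists (Num.min d (e / (nm l + 1))); first by rewrite lt_min d0 divr_gt0.
move=> w; rewrite lt_min => /andP[/hd h]; rewrite ltr_pdivlMr // => h2.
have := nmD (f w - f z - l * (w - z)) (l * (w - z)).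
rewrite subrK nmM; lra.
Qed.

Lemma cont_cts (X : C -> Prop) f : (forall z, X z -> cont_at f z) -> cts X f.
Proof. by move=> H z /H cz e /cz [d d0 hd]; exists d => // w _; exact: hd. Qed.

Lemma cts_sub (X Y : C -> Prop) f : (forall z, Y z -> X z) -> cts X f -> cts Y f.
Proof.
move=> YX H z /YX /H cz e /cz [d d0 hd].
by exists d => // w /YX; exact: hd.
Qed.

Definition hI (g : C -> C) (x0 x1 y : R) : C := cint g (x0 +i* y)%C (x1 +i* y)%C.
Definition vI (g : C -> C) (x y0 y1 : R) : C := cint g (x +i* y0)%C (x +i* y1)%C.
Definition bd (g : C -> C) (x0 x1 y0 y1 : R) : C :=
  hI g x0 x1 y0 + vI g x1 y0 y1 - hI g x0 x1 y1 - vI g x0 y0 y1.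

Lemma h_has_cint g x0 x1 y : x0 <= x1 -> cts (rect x0 x1 y y) g ->
  has_cint g (x0 +i* y)%C (x1 +i* y)%C.
Proof. by move=> *; exact: cts_has_cint. Qed.

Lemma v_has_cint g x y0 y1 : y0 <= y1 -> cts (rect x x y0 y1) g ->
  has_cint g (x +i* y0)%C (x +i* y1)%C.
Proof. by move=> *; exact: cts_has_cint. Qed.

Lemma half_double (y : R) : (y + y) / 2 = y.
Proof. lra. Qed.

Lemma hI_mid g x0 x1 y (m := (x0 + x1) / 2) : x0 <= x1 -> cts (rect x0 x1 y y) g ->
  hI g x0 x1 y = hI g x0 m y + hI g m x1 y.
Proof.
move=> hx cg; have := @cint_mid _ g (x0 +i* y)%C (x1 +i* y)%C.
rewrite /= midpointE half_double -/m => H; apply/cintE/H; apply: h_has_cint.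
- by rewrite /m; lra.
- by apply: cts_sub cg => z []; rewrite /m => ? ?; split; lra.
- by rewrite /m; lra.
- by apply: cts_sub cg => z []; rewrite /m => ? ?; split; lra.
Qed.

Lemma vI_mid g x y0 y1 (m := (y0 + y1) / 2) : y0 <= y1 -> cts (rect x x y0 y1) g ->
  vI g x y0 y1 = vI g x y0 m + vI g x m y1.
Proof.
move=> hx cg; have := @cint_mid _ g (x +i* y0)%C (x +i* y1)%C.
rewrite /= midpointE half_double -/m => H; apply/cintE/H; apply: v_has_cint.
- by rewrite /m; lra.
- by apply: cts_sub cg => z []; rewrite /m => ? ?; split; lra.
- by rewrite /m; lra.
- by apply: cts_sub cg => z []; rewrite /m => ? ?; split; lra.
Qed.

Lemma bd_split g x0 x1 y0 y1 (xm := (x0 + x1) / 2) (ym := (y0 + y1) / 2) :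
  x0 <= x1 -> y0 <= y1 -> cts (rect x0 x1 y0 y1) g ->
  bd g x0 x1 y0 y1 =
    bd g x0 xm y0 ym + bd g xm x1 y0 ym + bd g x0 xm ym y1 + bd g xm x1 ym y1.
Proof.
move=> hx hy cg; rewrite /bd.
have hh y : y0 <= y <= y1 -> hI g x0 x1 y = hI g x0 xm y + hI g xm x1 y.
  by move=> h; apply: hI_mid => //; apply: cts_sub cg => z [? ?]; split; lra.
have vv x : x0 <= x <= x1 -> vI g x y0 y1 = vI g x y0 ym + vI g x ym y1.
  by move=> h; apply: vI_mid => //; apply: cts_sub cg => z [? ?]; split; lra.
rewrite !hh ?vv ?lexx ?hx ?hy //; ring.
Qed.

Lemma edges_has_cint g x0 x1 y0 y1 : x0 <= x1 -> y0 <= y1 ->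
  cts (rect x0 x1 y0 y1) g ->
  [/\ has_cint g (x0 +i* y0)%C (x1 +i* y0)%C,
      has_cint g (x1 +i* y0)%C (x1 +i* y1)%C,
      has_cint g (x0 +i* y1)%C (x1 +i* y1)%C &
      has_cint g (x0 +i* y0)%C (x0 +i* y1)%C].
Proof.
by move=> hx hy cg; split; apply: cts_has_cint => //; apply: cts_sub cg;
  move=> z [? ?]; split; lra.
Qed.

Lemma bd_lin k g h x0 x1 y0 y1 : x0 <= x1 -> y0 <= y1 ->
  cts (rect x0 x1 y0 y1) g -> cts (rect x0 x1 y0 y1) h ->
  bd (fun z => k * g z + h z) x0 x1 y0 y1 =
    k * bd g x0 x1 y0 y1 + bd h x0 x1 y0 y1.
Proof.
move=> hx hy cg ch; have [? ? ? ?] := edges_has_cint hx hy cg.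
have [? ? ? ?] := edges_has_cint hx hy ch.
by rewrite /bd /hI /vI !cint_lin //; ring.
Qed.

Lemma nm_hedge (a b y : R) : a <= b -> nm ((b +i* y)%C - (a +i* y)%C) = b - a.
Proof.
move=> ab; rewrite (_ : _ - _ = (b - a)%:C%C).
  by rewrite nm_real ger0_norm // subr_ge0.
by apply/eqP; rewrite eq_complex /= subrr !eqxx.
Qed.

Lemma nm_vedge (a b x : R) : a <= b -> nm ((x +i* b)%C - (x +i* a)%C) = b - a.
Proof.
move=> ab; rewrite (_ : _ - _ = (0 +i* (b - a))%C).
  by rewrite /ComplexField.Normc.normc expr0n add0r sqrtr_sqr ger0_norm // subr_ge0.
by apply/eqP; rewrite eq_complex /= subrr !eqxx.
Qed.

Lemma bd_bound g e x0 x1 y0 y1 : x0 <= x1 -> y0 <= y1 ->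
  cts (rect x0 x1 y0 y1) g -> (forall z, rect x0 x1 y0 y1 z -> nm (g z) <= e) ->
  nm (bd g x0 x1 y0 y1) <= e * (2 * (x1 - x0 + (y1 - y0))).
Proof.
move=> hx hy cg H; have [i1 i2 i3 i4] := edges_has_cint hx hy cg.
have mc := @rect_midconvex R x0 x1 y0 y1.
have corner a b : x0 <= a <= x1 -> y0 <= b <= y1 -> rect x0 x1 y0 y1 (a +i* b)%C.
  by split.
have b1 : nm (hI g x0 x1 y0) <= e * (x1 - x0).
  by rewrite -(nm_hedge y0 hx); apply: (cint_bound mc) => //; apply: corner; lra.
have b2 : nm (vI g x1 y0 y1) <= e * (y1 - y0).
  by rewrite -(nm_vedge x1 hy); apply: (cint_bound mc) => //; apply: corner; lra.
have b3 : nm (hI g x0 x1 y1) <= e * (x1 - x0).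
  by rewrite -(nm_hedge y1 hx); apply: (cint_bound mc) => //; apply: corner; lra.
have b4 : nm (vI g x0 y0 y1) <= e * (y1 - y0).
  by rewrite -(nm_vedge x0 hy); apply: (cint_bound mc) => //; apply: corner; lra.
rewrite /bd; apply: le_trans (nmB _ _) _.
have := nmB (hI g x0 x1 y0 + vI g x1 y0 y1) (hI g x0 x1 y1).
have := nmD (hI g x0 x1 y0) (vI g x1 y0 y1).
lra.
Qed.

(** The primitive c z + l z^2 / 2 has second-order remainder exactly l (y - x)^2 / 2, whence the
    constant |l / 2|. *)
Lemma bd_affine (c l : C) x0 x1 y0 y1 : bd (fun z => c + l * z) x0 x1 y0 y1 = 0.
Proof.
have n2 : (2 : C) != 0 by rewrite pnatr_eq0.
pose F z := c * z + l * z ^+ 2 / 2.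
have I a b : cint (fun z => c + l * z) a b = F b - F a.
  apply: cintE; apply: (@is_cint_primitive _ (fun=> True) _ _ (nm (l / 2))) => //.
  move=> x y _ _; rewrite -nmX -nmM le_eqVlt; apply/orP; left; apply/eqP.
  by congr nm; rewrite /F; field.
by rewrite /bd /hI /vI !I; ring.
Qed.

(* The product of the measures [|t - c|^(-1/2) dt / 2] is additive on rectangles
   and gives a square around the exceptional point at least its side, which is
   what quadrisection needs to absorb that point. *)
Definition phi (c x : R) : R := Num.sqrt (x - c) - Num.sqrt (c - x).

Lemma phi_mono c x y : x <= y -> phi c x <= phi c y.
Proof. by move=> xy; apply: lerB; apply: ler_wsqrtr; lra. Qed.

Lemma phi_ge c x y : x <= c <= y -> Num.sqrt (y - x) <= phi c y - phi c x.
Proof.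
move=> h; rewrite /phi.
have -> : Num.sqrt (c - y) = 0 by apply: ler0_sqrtr; lra.
have -> : Num.sqrt (x - c) = 0 by apply: ler0_sqrtr; lra.
have a0 := sqrtr_ge0 (y - c); have b0 := sqrtr_ge0 (c - x).
have a2 : Num.sqrt (y - c) ^+ 2 = y - c by rewrite sqr_sqrtr //; lra.
have b2 : Num.sqrt (c - x) ^+ 2 = c - x by rewrite sqr_sqrtr //; lra.
rewrite sub0r subr0 opprK; have ab0 := addr_ge0 a0 b0.
rewrite -ler_sqr ?nnegrE ?sqrtr_ge0 //.
rewrite sqr_sqrtr; last lra.
have := mulr_ge0 a0 b0; move: a2 b2; rewrite !expr2; nra.
Qed.

(** The exceptional point [z0], where only continuity is assumed, is meant for the difference
    quotient (f - f z) / (t - z) at t = z. The estimate proved for every [e] is a sum of two terms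
    that are additive under quadrisection, the area and [mu]: the first controls small squares
    around a point of differentiability, the second those around [z0]. *)
Lemma goursat g z0 X0 X1 Y0 Y1 : X0 <= X1 -> X1 - X0 = Y1 - Y0 ->
  (rect X0 X1 Y0 Y1 z0 -> cont_at g z0) ->
  (forall z, rect X0 X1 Y0 Y1 z -> z <> z0 -> dif g z) ->
  bd g X0 X1 Y0 Y1 = 0.
Proof.
move=> hX hXY c0 dg.
have cg : cts (rect X0 X1 Y0 Y1) g.
  apply: cont_cts => z hz; have [zz|/eqP zz] := eqVneq z z0; first by subst; exact: c0.
  by apply: dif_cont; exact: dg.
case: z0 c0 dg => p q c0 dg.
pose mu x0 x1 y0 y1 := (phi p x1 - phi p x0) * (phi q y1 - phi q y0).
have mu0 x0 x1 y0 y1 : x0 <= x1 -> y0 <= y1 -> 0 <= mu x0 x1 y0 y1.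
  by move=> hx hy; rewrite mulr_ge0 // subr_ge0 phi_mono.
(* A square of side a has perimeter 4 a. An affine approximation with error 2 a e gives 8 e a^2;
   around [z0] an oscillation e gives 4 e a, and a is at most [mu] there. *)
suff H e : 0 < e ->
    nm (bd g X0 X1 Y0 Y1) <= e * (8 * (X1 - X0) ^+ 2 + 4 * mu X0 X1 Y0 Y1).
  have K0 : 0 < 8 * (X1 - X0) ^+ 2 + 4 * mu X0 X1 Y0 Y1 + 1.
    have := mu0 X0 X1 Y0 Y1 hX; have := sqr_ge0 (X1 - X0) => h1 h2.
    have := h2 ltac:(lra); lra.
  apply: small_eq0 => e e0; have := H _ (divr_gt0 e0 K0).
  move=> /le_trans; apply; rewrite mulrAC -mulrA ler_piMr ?(ltW e0) //.
  by rewrite ltW // ltr_pdivrMr // mul1r; lra.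
move=> e0.
pose Pr x0 x1 y0 y1 := X0 <= x0 -> x1 <= X1 -> Y0 <= y0 -> y1 <= Y1 ->
  x1 - x0 = y1 - y0 ->
  nm (bd g x0 x1 y0 y1) <= e * (8 * (x1 - x0) ^+ 2 + 4 * mu x0 x1 y0 y1).
suff : Pr X0 X1 Y0 Y1 by apply.
apply: cousin => //; first by lra.
  move=> x0 x1 y0 y1 hx hy; set xm := (x0 + x1) / 2; set ym := (y0 + y1) / 2.
  move=> /= h1 h2 h3 h4 k1 k2 k3 k4 hxy.
  have xmE : xm = (x0 + x1) / 2 by []. have ymE : ym = (y0 + y1) / 2 by [].
  have cg' : cts (rect x0 x1 y0 y1) g.
    by apply: cts_sub cg => z [? ?]; split; lra.
  have := h1 ltac:(lra) ltac:(lra) ltac:(lra) ltac:(lra) ltac:(lra).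
  have := h2 ltac:(lra) ltac:(lra) ltac:(lra) ltac:(lra) ltac:(lra).
  have := h3 ltac:(lra) ltac:(lra) ltac:(lra) ltac:(lra) ltac:(lra).
  have := h4 ltac:(lra) ltac:(lra) ltac:(lra) ltac:(lra) ltac:(lra).
  rewrite (@bd_split _ x0 x1 y0 y1) // -/xm -/ym.
  set b1 := bd g x0 xm y0 ym; set b2 := bd g xm x1 y0 ym.
  set b3 := bd g x0 xm ym y1; set b4 := bd g xm x1 ym y1 => g4 g3 g2 g1.
  have t1 := nmD (b1 + b2 + b3) b4; have t2 := nmD (b1 + b2) b3; have t3 := nmD b1 b2.
  apply: le_trans (_ : _ <= e * (8 * (x1 - xm) ^+ 2 + 4 * mu xm x1 ym y1) +
    e * (8 * (xm - x0) ^+ 2 + 4 * mu x0 xm ym y1) +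
    e * (8 * (x1 - xm) ^+ 2 + 4 * mu xm x1 y0 ym) +
    e * (8 * (xm - x0) ^+ 2 + 4 * mu x0 xm y0 ym)) _; first by lra.
  rewrite -!mulrDr ler_wpM2l ?(ltW e0) //.
  have -> : mu x0 x1 y0 y1 = mu x0 xm y0 ym + mu xm x1 y0 ym + mu x0 xm ym y1 + mu xm x1 ym y1.
    by rewrite /mu; ring.
  rewrite xmE; nra.
move=> x y hx hy; have [xy|/eqP xy] := eqVneq (x +i* y)%C (p +i* q)%C.
  case: xy hx hy => -> -> hx hy.
  have [d d0 hd] := c0 (conj hx hy) _ e0.
  exists (d / 2); first lra.
  move=> x0 x1 y0 y1 hx' hy' k1 k2 k3 k4 l1 l2 _ _ _ _ hxy.
  have x01 : x0 <= x1 by lra. have y01 : y0 <= y1 by lra.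
  have cg' : cts (rect x0 x1 y0 y1) g.
    by apply: cts_sub cg => z [? ?]; split; lra.
  (* The boundary integral of a constant is zero, so the value of [g] at the exceptional point may
     be subtracted, which leaves a small integrand. *)
  have cc : cts (rect x0 x1 y0 y1) (fun z => - g (p +i* q)%C + 0 * z).
    move=> z _ r r0; exists 1 => // w _ _.
    by rewrite !mul0r subrr nm0 ltW.
  have := bd_lin 1 x01 y01 cg' cc; rewrite bd_affine addr0 mul1r => <-.
  apply: le_trans (bd_bound (e := e) x01 y01 _ _) _.
  - move=> z hz r r0; have [s s0 hs] := cg' z hz r r0; exists s => // w hw hzw.
    rewrite !mul1r !mul0r !addr0 opprB addrA addrNK; exact: hs.
  - move=> z hz; rewrite mul1r mul0r addr0; apply: hd.
    apply: le_lt_trans (rect_dist hz (conj hx' hy' : rect _ _ _ _ (p +i* q)%C)) _; lra.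
  - apply: ler_wpM2l; first exact: ltW.
    have a1 := phi_ge hx'; have a2 := phi_ge hy'.
    have s0 : 0 <= x1 - x0 by lra.
    have := ler_pM (sqrtr_ge0 _) (sqrtr_ge0 _) a1 a2.
    rewrite -/(mu x0 x1 y0 y1) -hxy -expr2 sqr_sqrtr // => a3.
    have := sqr_ge0 (x1 - x0); lra.
have hz : rect X0 X1 Y0 Y1 (x +i* y)%C by split.
have [l hl] := dg _ hz xy.
have [d d0 hd] := hl _ e0; exists (d / 2); first lra.
move=> x0 x1 y0 y1 hx' hy' k1 k2 k3 k4 l1 l2 _ _ _ _ hxy.
have x01 : x0 <= x1 by lra. have y01 : y0 <= y1 by lra.
have cg' : cts (rect x0 x1 y0 y1) g.
  by apply: cts_sub cg => z [? ?]; split; lra.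
set z0 := (x +i* y)%C in hz hl hd.
(* [g + a] is the remainder of [g] after its affine approximation at [z0]. *)
pose a z := (l * z0 - g z0) + (- l) * z.
have ca : cts (rect x0 x1 y0 y1) a.
  apply: cont_cts => z _; apply: dif_cont; exists (- l) => r r0.
  exists 1 => // w _; rewrite /a (_ : _ - _ - _ = 0); last by ring.
  by rewrite nm0 mulr_ge0 ?nm_ge0 // ltW.
have := bd_lin 1 x01 y01 cg' ca; rewrite bd_affine addr0 mul1r => <-.
apply: le_trans (bd_bound (e := e * (2 * (x1 - x0))) x01 y01 _ _) _.
- move=> z hz' r r0; have r2 : 0 < r / 2 by lra.
  have [s s0 hs] := cg' z hz' _ r2; have [t t0 ht] := ca z hz' _ r2.
  exists (Num.min s t); first by rewrite lt_min s0 t0.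
  move=> w hw; rewrite lt_min => /andP[/(hs _ hw) h1 /(ht _ hw) h2].
  rewrite !mul1r; have -> : g w + a w - (g z + a z) = (g w - g z) + (a w - a z) by rewrite opprD addrACA.
  by apply: le_trans (nmD _ _) _; lra.
- move=> z hz'; have hzz := rect_dist hz' (conj hx' hy' : rect _ _ _ _ z0).
  have /hd : nm (z - z0) < d by lra.
  have -> : 1 * g z + a z = g z - g z0 - l * (z - z0) by rewrite /a; ring.
  by move=> /le_trans; apply; apply: ler_wpM2l; [exact: ltW | lra].
- rewrite -mulrA; apply: ler_wpM2l; first exact: ltW.
  have := mu0 x0 x1 y0 y1 x01 y01; rewrite -hxy expr2; lra.
Qed.

End Goursat.

(** * The Cauchy kernel and difference quotients *)

Section Grid.
Variable R : realType.
Local Notation C := R[i].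
Local Notation nm := (@ComplexField.Normc.normc R).
Implicit Types (f g h : C -> C) (z : C).

Lemma cint_ext (X : C -> Prop) g h a b : midconvex X -> X a -> X b ->
  (forall x, X x -> g x = h x) -> has_cint h a b -> cint g a b = cint h a b.
Proof.
move=> mX Xa Xb H /cintP hh; apply: cintE => e /hh [M HM].
exists M => n /HM; congr (nm (_ - _) <= _).
by elim: n a b Xa Xb {hh HM} => [|n IH] a b Xa Xb /=; rewrite ?H // !IH //; exact: mX.
Qed.

(** The first-order remainder of 1 / x is exactly (b - a)^2 / (b a^2). This serves both for the
    derivative of the kernel and for the quadratic bound required of a primitive. *)
Lemma inv_taylor (a b : C) : a != 0 -> b != 0 ->
  nm (b^-1 - a^-1 + (b - a) / a ^+ 2) = nm (b - a) ^+ 2 / (nm b * nm a ^+ 2).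
Proof.
move=> a0 b0; rewrite -!nmX -nmM -nmV -nmM; congr nm; field.
by rewrite a0 b0.
Qed.

Lemma cauchy_kernel_dif z w : w != z -> dif (fun t => (t - z)^-1) w.
Proof.
move=> wz; exists (- ((w - z) ^+ 2)^-1) => e e0.
have a0 : w - z != 0 by rewrite subr_eq0.
have n0 : 0 < nm (w - z) by rewrite nm_gt0.
have c0 : 0 < nm (w - z) / 2 by lra.
pose K := (nm (w - z) / 2 * nm (w - z) ^+ 2)^-1.
have K0 : 0 < K by rewrite invr_gt0 mulr_gt0 // exprn_gt0.
exists (Num.min (nm (w - z) / 2) (e / K)); first by rewrite lt_min c0 divr_gt0.
move=> t; rewrite lt_min (ltr_pdivlMr _ _ K0) => /andP[t1 t2].
have t3 : nm (w - z) / 2 <= nm (t - z).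
  by have := nm_dist t w z; rewrite (nm_sub w t); lra.
have b0 : t - z != 0 by rewrite -nm_gt0; lra.
have := inv_taylor a0 b0; rewrite (_ : t - z - (w - z) = t - w); last by ring.
move=> E; rewrite mulNr opprK [_^-1 * _]mulrC E; set X := nm (t - w) in t2 *.
have X0 : 0 <= X := nm_ge0 _.
have KK : (nm (t - z) * nm (w - z) ^+ 2)^-1 <= K.
  rewrite /K lef_pV2 ?posrE ?mulr_gt0 ?exprn_gt0 //; last by rewrite nm_gt0.
  by apply: ler_wpM2r => //; rewrite sqr_ge0.
move: (ler_wpM2l X0 (ltW t2)); have := ler_wpM2l (mulr_ge0 X0 X0) KK.
move=> h1 h2; by apply: le_trans h1 _; rewrite -mulrA [e * X]mulrC.
Qed.

Lemma cauchy_kernel_cont z w : w != z -> cont_at (fun t => (t - z)^-1) w.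
Proof. by move=> wz; exact/dif_cont/cauchy_kernel_dif. Qed.

Lemma cont_cst (k : C) z : cont_at (fun=> k) z.
Proof. by move=> e e0; exists 1 => // w _; rewrite subrr nm0 ltW. Qed.

Lemma cont_atD f g z : cont_at f z -> cont_at g z -> cont_at (fun t => f t + g t) z.
Proof.
move=> cf cg e e0; have e2 : 0 < e / 2 by lra.
have [a a0 ha] := cf _ e2; have [b b0 hb] := cg _ e2.
exists (Num.min a b); first by rewrite lt_min a0 b0.
move=> w; rewrite lt_min => /andP[/ha h1 /hb h2].
rewrite opprD addrACA; apply: le_trans (nmD _ _) _; lra.
Qed.

Lemma cont_atM f g z : cont_at f z -> cont_at g z -> cont_at (fun t => f t * g t) z.
Proof.
move=> cf cg e e0.
have k0 : 0 < nm (f z) + nm (g z) + 1 by rewrite ltr_wpDl ?addr_ge0 ?nm_ge0.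
have d0 : 0 < Num.min 1 (e / (nm (f z) + nm (g z) + 1)) by rewrite lt_min ltr01 divr_gt0.
have [a a0 ha] := cf _ d0; have [b b0 hb] := cg _ d0.
exists (Num.min a b); first by rewrite lt_min a0 b0.
move=> w; rewrite lt_min => /andP[/ha + /hb].
set d := Num.min _ _ in d0 * => h1 h2.
have d1 : d <= 1 by rewrite ge_min lexx.
have d2 : d * (nm (f z) + nm (g z) + 1) <= e.
  by rewrite -ler_pdivlMr // ge_min lexx orbT.
rewrite (_ : f w * g w - _ = (f w - f z) * (g w - g z) + f z * (g w - g z)
  + (f w - f z) * g z); last by ring.
apply: le_trans (nmD _ _) _; apply: le_trans (lerD (nmD _ _) (lexx _)) _.
rewrite !nmM.
have a1 := ler_wpM2l (nm_ge0 (f z)) h2.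
have a2 := ler_wpM2r (nm_ge0 (g z)) h1.
have a3 := ler_pM (nm_ge0 _) (nm_ge0 _) h1 h2.
have a4 := ler_wpM2l (ltW d0) d1.
lra.
Qed.

(** With [l] the derivative of [f] at [z], the quotient is continuous at [z], as the exceptional
    point of [goursat] requires. *)
Definition slope f (l : C) z (t : C) : C :=
  if t == z then l else (f t - f z) * (t - z)^-1.

Lemma difM f g z : dif f z -> dif g z -> dif (fun t => f t * g t) z.
Proof.
move=> [a ha] [b hb]; exists (a * g z + f z * b) => e e0.
have cg : cont_at g z by apply: dif_cont; exists b.
have k0 : 0 < nm (g z) + nm (f z) + nm a + 2.
  by have := nm_ge0 (g z); have := nm_ge0 (f z); have := nm_ge0 a; lra.
have d0 : 0 < Num.min 1 (e / (nm (g z) + nm (f z) + nm a + 2)).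
  by rewrite lt_min ltr01 divr_gt0.
have [r r0 hr] := ha _ d0; have [s s0 hs] := hb _ d0; have [t t0 ht] := cg _ d0.
exists (Num.min r (Num.min s t)); first by rewrite !lt_min r0 s0 t0.
move=> w; rewrite !lt_min => /and3P[/hr + /hs + /ht].
set d := Num.min _ _ in d0 *.
have d1 : d <= 1 by rewrite ge_min lexx.
have d2 : d * (nm (g z) + nm (f z) + nm a + 2) <= e.
  by rewrite -ler_pdivlMr // ge_min lexx orbT.
set u := f w - f z - _; set v := g w - g z - _ => h1 h2 h3.
have -> : f w * g w - f z * g z - (a * g z + f z * b) * (w - z) =
   u * (g w - g z) + u * g z + f z * v + a * (w - z) * (g w - g z).
  by rewrite /u /v; ring.
have n0 := nm_ge0 (w - z).
have q1 := nmD (u * (g w - g z) + u * g z + f z * v) (a * (w - z) * (g w - g z)).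
have q2 := nmD (u * (g w - g z) + u * g z) (f z * v).
have q3 := nmD (u * (g w - g z)) (u * g z).
move: q1 q2 q3; rewrite !nmM => q1 q2 q3.
have b1 := ler_pM (nm_ge0 _) (nm_ge0 _) h1 h3.
have b2 := ler_wpM2r (nm_ge0 (g z)) h1.
have b3 := ler_wpM2l (nm_ge0 (f z)) h2.
have b4 := ler_wpM2l (mulr_ge0 (nm_ge0 a) n0) h3.
have b5 := ler_wpM2r n0 d2.
have b6 : d * nm (w - z) * d <= d * nm (w - z).
  by rewrite ler_piMr // mulr_ge0 // ltW.
have b7 : 0 <= d * nm (w - z) by rewrite mulr_ge0 // ltW.
lra.
Qed.

Lemma slope_dif f l z t : dif f t -> t != z -> dif (slope f l z) t.
Proof.
move=> [b hb] tz.
have df : dif (fun t => f t - f z) t.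
  exists b => e /hb [d d0 hd]; exists d => // w /hd.
  by rewrite (_ : f w - f z - (f t - f z) = f w - f t) //; ring.
have [m hm] := difM df (cauchy_kernel_dif tz).
have tz0 : 0 < nm (t - z) by rewrite nm_gt0 subr_eq0.
exists m => e /hm [d d0 hd]; exists (Num.min d (nm (t - z))).
  by rewrite lt_min d0.
move=> w; rewrite lt_min => /andP[/hd h wt]; rewrite /slope (negbTE tz).
have [wz|//] := eqVneq w z.
by move: wt; rewrite wz nm_sub ltxx.
Qed.

Lemma slope_cont f l z :
  (forall e, 0 < e -> exists2 d, 0 < d & forall w, nm (w - z) < d ->
    nm (f w - f z - l * (w - z)) <= e * nm (w - z)) -> cont_at (slope f l z) z.
Proof.
move=> H e e0; have [d d0 hd] := H _ e0; exists d => // w /hd.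
rewrite /slope eqxx; have [->|wz] := eqVneq w z; first by move=> _; rewrite subrr nm0 ltW.
have wz0 : w - z != 0 by rewrite subr_eq0.
have n0 : 0 < nm (w - z) by rewrite nm_gt0.
rewrite (_ : f w - _ - _ = ((f w - f z) / (w - z) - l) * (w - z)); last by field.
by rewrite nmM ler_pM2r.
Qed.

End Grid.

(** * Cauchy's formula on a grid *)

Section GridCauchy.
Variable R : realType.
Local Notation C := R[i].
Local Notation nm := (@ComplexField.Normc.normc R).
Implicit Types (f g h : C -> C) (z w u : C).

(** Summation by parts, which turns a weighted sum over cells into a sum over edges. *)
Lemma sum_parts (c h : nat -> C) (N : nat) :
  \sum_(k < N) c k * (h k - h k.+1) =
  \sum_(k < N.+1) ((if (k < N)%N then c k else 0) -
                   (if (k : nat) is k'.+1 then c k' else 0)) * h k.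
Proof.
under eq_bigr do rewrite mulrBr; under [RHS]eq_bigr do rewrite mulrBl.
rewrite !sumrB; congr (_ - _).
  rewrite big_ord_recr /= ltnn mul0r addr0; apply: eq_bigr => i _.
  by rewrite ltn_ord.
by rewrite big_ord_recl /= mul0r add0r.
Qed.

Lemma sum_telescope (h : nat -> C) (N : nat) :
  \sum_(k < N) (h k - h k.+1) = h 0%N - h N.
Proof.
elim: N => [|N IH]; first by rewrite big_ord0 subrr.
by rewrite big_ord_recr /= IH addrA subrK.
Qed.

Variables (s dl : R) (N : nat).

(** When dl N = 2 s, the nodes 0 to N cut [-s, s] into N equal intervals, and the grid has N^2
    square cells. *)
Definition node (j : nat) : R := dl * j%:R - s.
Local Notation t := node.

Definition cell g (j k : nat) : C := bd g (t j) (t j.+1) (t k) (t k.+1).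

(* [dh c j k] and [dv c j k] are the coefficients of the horizontal and the
   vertical edge starting at the node (j, k) in the boundary of the 2-chain
   [c]. *)
Definition dh (c : nat -> nat -> C) (j k : nat) : C :=
  (if (k < N)%N then c j k else 0) - (if k is k'.+1 then c j k' else 0).
Definition dv (c : nat -> nat -> C) (j k : nat) : C :=
  (if j is j'.+1 then c j' k else 0) - (if (j < N)%N then c j k else 0).

Definition bdchain (c : nat -> nat -> C) g : C :=
  \sum_(j < N) \sum_(k < N.+1) dh c j k * hI g (t j) (t j.+1) (t k) +
  \sum_(k < N) \sum_(j < N.+1) dv c j k * vI g (t j) (t k) (t k.+1).

(** Collecting the cells by edges makes the edges with coefficient zero drop out; the integrand may
    be singular on those. *)
Lemma bdchainE (c : nat -> nat -> C) g :
  \sum_(j < N) \sum_(k < N) c j k * cell g j k = bdchain c g.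
Proof.
rewrite /bdchain /cell /bd.
under eq_bigr => j _.
  under eq_bigr => k _.
    rewrite (_ : _ * _ = c j k * (hI g (t j) (t j.+1) (t k) - hI g (t j) (t j.+1) (t k.+1))
      + (- c j k) * (vI g (t j) (t k) (t k.+1) - vI g (t j.+1) (t k) (t k.+1))); last by ring.
    over.
  rewrite big_split /= (sum_parts (c j) (fun k => hI g (t j) (t j.+1) (t k))).
  over.
rewrite big_split /=; congr (_ + _); rewrite exchange_big /=; apply: eq_bigr => k _.
rewrite (sum_parts (fun j => - c j k) (fun j => vI g (t j) (t k) (t k.+1))).
apply: eq_bigr => -[[|j] hj] _ /=; congr (_ * _); rewrite /dv /=.
  by case: ifP; rewrite ?subr0 ?sub0r.
by case: ifP; rewrite ?subr0 ?sub0r opprK // addrC.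
Qed.

Definition outer g : C :=
  \sum_(j < N) (hI g (t j) (t j.+1) (t 0) - hI g (t j) (t j.+1) (t N)) +
  \sum_(k < N) (vI g (t N) (t k) (t k.+1) - vI g (t 0) (t k) (t k.+1)).

Lemma sum_cell g : \sum_(j < N) \sum_(k < N) cell g j k = outer g.
Proof.
rewrite /outer /cell /bd.
under eq_bigr => j _.
  under eq_bigr => k _.
    rewrite (_ : _ - _ = (hI g (t j) (t j.+1) (t k) - hI g (t j) (t j.+1) (t k.+1))
      - (vI g (t j) (t k) (t k.+1) - vI g (t j.+1) (t k) (t k.+1))); last by ring.
    over.
  rewrite sumrB /= (sum_telescope (fun k => hI g (t j) (t j.+1) (t k))).
  over.
rewrite sumrB /=; congr (_ + _); rewrite exchange_big -sumrN /=; apply: eq_bigr => k _.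
by rewrite (sum_telescope (fun j => vI g (t j) (t k) (t k.+1))) opprB.
Qed.

Hypotheses (s0 : 0 < s) (d0 : 0 < dl) (dN : dl * N%:R = 2 * s).

Lemma nodeS j : t j.+1 = t j + dl.
Proof. by rewrite /node -natr1; ring. Qed.

Lemma node0 : t 0 = - s.
Proof. by rewrite /node mulr0 add0r. Qed.

Lemma nodeN : t N = s.
Proof. by rewrite /node dN; ring. Qed.

Lemma node_le j k : (j <= k)%N -> t j <= t k.
Proof. by move=> jk; rewrite /node lerB // ler_pM2l // ler_nat. Qed.

Lemma node_in j : (j <= N)%N -> - s <= t j <= s.
Proof. by move=> jN; rewrite -{1}node0 -nodeN !node_le. Qed.

Definition frame z : Prop :=
  [/\ `|complex.Re z| <= s, `|complex.Im z| <= s &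
      `|complex.Re z| = s \/ `|complex.Im z| = s].

Lemma frame_nm z : frame z -> s <= nm z.
Proof. by case=> _ _ [<-|<-]; [exact: nm_Re | exact: nm_Im]. Qed.

Lemma frame_h (j : 'I_N) y w : `|y| = s -> rect (t j) (t j.+1) y y w -> frame w.
Proof.
move=> hy [h1 h2]; have -> : w = (complex.Re w +i* y)%C.
  by case: w h1 h2 => a b /= _ h; congr (_ +i* _)%C; lra.
have := node_in (ltnW (ltn_ord j)); have := node_in (ltn_ord j) => h3 h4.
by split => /=; rewrite ?hy //; [rewrite ler_norml; lra | right].
Qed.

Lemma frame_v (k : 'I_N) x w : `|x| = s -> rect x x (t k) (t k.+1) w -> frame w.
Proof.
move=> hx [h2 h1]; have -> : w = (x +i* complex.Im w)%C.
  by case: w h1 h2 => a b /= _ h; congr (_ +i* _)%C; lra.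
have := node_in (ltnW (ltn_ord k)); have := node_in (ltn_ord k) => h3 h4.
by split => /=; rewrite ?hx //; [rewrite ler_norml; lra | left].
Qed.

Lemma outer_edges g : (forall w, frame w -> cont_at g w) ->
  (forall (j : 'I_N) y, `|y| = s -> has_cint g (t j +i* y)%C (t j.+1 +i* y)%C) /\
  (forall (k : 'I_N) x, `|x| = s -> has_cint g (x +i* t k)%C (x +i* t k.+1)%C).
Proof.
move=> cg; split => [j y hy|k x hx]; apply: cts_has_cint => //; try exact: node_le;
  apply: cont_cts => w hw; apply: cg.
- exact: frame_h hy hw.
- exact: frame_v hx hw.
Qed.

Lemma outer_lin k g h : (forall w, frame w -> cont_at g w) ->
  (forall w, frame w -> cont_at h w) ->
  outer (fun z => k * g z + h z) = k * outer g + outer h.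
Proof.
move=> /outer_edges[g1 g2] /outer_edges[h1 h2].
have n0 : `|t 0| = s by rewrite node0 normrN gtr0_norm.
have nN : `|t N| = s by rewrite nodeN gtr0_norm.
rewrite /outer mulrDr addrACA.
congr (_ + _); rewrite mulr_sumr -big_split /=; apply: eq_bigr => i _.
  by rewrite /hI !cint_lin //; try (by [apply: g1 | apply: h1]); ring.
by rewrite /vI !cint_lin //; try (by [apply: g2 | apply: h2]); ring.
Qed.

(** The factor 8 s is the perimeter of the square [-s, s]^2. *)
Lemma outer_bound e g : (forall w, frame w -> cont_at g w) ->
  (forall w, frame w -> nm (g w) <= e) -> nm (outer g) <= e * (8 * s).
Proof.
move=> /outer_edges[g1 g2] H.
have n0 : `|t 0| = s by rewrite node0 normrN gtr0_norm.
have nN : `|t N| = s by rewrite nodeN gtr0_norm.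
have tl j : t j <= t j.+1 by exact: node_le.
have bh (j : 'I_N) y : `|y| = s -> nm (hI g (t j) (t j.+1) y) <= e * dl.
  move=> hy; have -> : dl = nm ((t j.+1 +i* y)%C - (t j +i* y)%C).
    by rewrite nm_hedge // nodeS; ring.
  apply: (cint_bound (@rect_midconvex R (t j) (t j.+1) y y)); rewrite /rect /= ?lexx ?tl //.
  - by move=> w hw; apply: H; exact: frame_h hy hw.
  - exact: g1.
have bv (k : 'I_N) x : `|x| = s -> nm (vI g x (t k) (t k.+1)) <= e * dl.
  move=> hx; have -> : dl = nm ((x +i* t k.+1)%C - (x +i* t k)%C).
    by rewrite nm_vedge // nodeS; ring.
  apply: (cint_bound (@rect_midconvex R x x (t k) (t k.+1))); rewrite /rect /= ?lexx ?tl //.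
  - by move=> w hw; apply: H; exact: frame_v hx hw.
  - exact: g2.
have sumle (F : 'I_N -> C) : (forall j, nm (F j) <= e * dl + e * dl) ->
    nm (\sum_j F j) <= e * (4 * s).
  move=> hF; apply: le_trans (_ : _ <= \sum_(j < N) (e * dl + e * dl)) _.
    elim/big_ind2: _ => [|x a y b h1 h2|j _]; [by rewrite nm0 | | exact: hF].
    by apply: le_trans (nmD _ _) _; exact: lerD.
  have -> : e * (4 * s) = 2 * e * (dl * N%:R) by rewrite dN; ring.
  by rewrite sumr_const card_ord -[leLHS]mulr_natr mulrA; lra.
rewrite /outer; apply: le_trans (nmD _ _) _.
have -> : e * (8 * s) = e * (4 * s) + e * (4 * s) by ring.
apply: lerD; apply: sumle => j; apply: le_trans (nmB _ _) _; apply: lerD.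
- exact: bh.
- exact: bh.
- exact: bv.
- exact: bv.
Qed.

(** The boundary of the square is closed, so the differences of [F] telescope around it. The
    hypothesis concerns the frame alone, which leaves room for a pole of [F] inside. *)
Lemma outer_primitive (F g : C -> C) (K : R) :
  (forall x y, frame x -> frame y ->
     nm (F y - F x - g x * (y - x)) <= K * nm (y - x) ^+ 2) -> outer g = 0.
Proof.
move=> H.
have n0 : `|t 0| = s by rewrite node0 normrN gtr0_norm.
have nN : `|t N| = s by rewrite nodeN gtr0_norm.
have tl j : t j <= t j.+1 by exact: node_le.
have eh (j : 'I_N) y : `|y| = s ->
    hI g (t j) (t j.+1) y = F (t j.+1 +i* y)%C - F (t j +i* y)%C.
  move=> hy; apply: cintE.
  apply: (is_cint_primitive (@rect_midconvex R (t j) (t j.+1) y y)); rewrite /rect /= ?lexx ?tl //.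
  by move=> x w hx hw; apply: H; [exact: frame_h hy hx | exact: frame_h hy hw].
have ev (k : 'I_N) x : `|x| = s ->
    vI g x (t k) (t k.+1) = F (x +i* t k.+1)%C - F (x +i* t k)%C.
  move=> hx; apply: cintE.
  apply: (is_cint_primitive (@rect_midconvex R x x (t k) (t k.+1))); rewrite /rect /= ?lexx ?tl //.
  by move=> y w hy hw; apply: H; [exact: frame_v hx hy | exact: frame_v hx hw].
pose G j := F (t j +i* t N)%C - F (t j +i* t 0)%C.
pose G' k := F (t 0 +i* t k)%C - F (t N +i* t k)%C.
rewrite /outer (eq_bigr (fun j : 'I_N => G j - G j.+1)); last first.
  by move=> j _; rewrite !eh // /G; ring.
rewrite (sum_telescope G) (eq_bigr (fun k : 'I_N => G' k - G' k.+1)); last first.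
  by move=> k _; rewrite !ev // /G'; ring.
by rewrite (sum_telescope G') /G /G'; ring.
Qed.

Lemma frame_far z w : nm z <= s / 2 -> frame w -> s / 2 <= nm (w - z).
Proof. by move=> hz /frame_nm hw; have := nm_lower w z; lra. Qed.

Lemma frame_neq z w : nm z <= s / 2 -> frame w -> w != z.
Proof.
move=> hz /(frame_far hz) h; rewrite -subr_eq0 -nm_gt0.
by apply: lt_le_trans h; rewrite divr_gt0.
Qed.

(** To first order in z - y the kernels differ by (z - y) / (w - y)^2, whose integral is zero
    because -1 / (w - y) is a primitive along the frame. The remainder is at most (2 / s)^3 |z -
    y|^2 on a contour of length 8 s, whence 64 / s^2. *)
Lemma outer_kernel_close z y : nm z <= s / 2 -> nm y <= s / 2 ->
  nm (outer (fun w => (w - z)^-1) - outer (fun w => (w - y)^-1))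
    <= 64 / s ^+ 2 * nm (z - y) ^+ 2.
Proof.
move=> hz hy.
pose q (v w : C) : C := (w - v)^-1.
pose p (w : C) : C := q y w * q y w.
have ck v w : nm v <= s / 2 -> frame w -> cont_at (q v) w.
  by move=> hv hw; apply: cauchy_kernel_cont; exact: frame_neq hw.
have cp w : frame w -> cont_at p w by move=> hw; apply: cont_atM; exact: ck.
have p0 : outer p = 0.
  apply: (@outer_primitive (fun w => - q y w) p ((s / 2)^-1 ^+ 3)) => a b ha hb.
  have na : a - y != 0 by rewrite subr_eq0; exact: frame_neq ha.
  have nb : b - y != 0 by rewrite subr_eq0; exact: frame_neq hb.
  rewrite (_ : _ - _ - _ = - (q y b - q y a + (b - y - (a - y)) / (a - y) ^+ 2)).
    rewrite nmN inv_taylor // mulrC (_ : b - y - (a - y) = b - a); last by ring.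
    apply: ler_wpM2r; first exact: sqr_ge0.
    have s2 : 0 < s / 2 by rewrite divr_gt0.
    rewrite exprVn lef_pV2 ?posrE ?mulr_gt0 ?exprn_gt0 ?nm_gt0 //.
    rewrite exprS; apply: ler_pM; rewrite ?(ltW s2) ?sqr_ge0 //; first exact: frame_far.
    by rewrite ler_sqr ?nnegrE ?nm_ge0 ?(ltW s2) //; exact: frame_far.
  by rewrite /p /q; field; rewrite na nb.
have E : outer (fun w => (- (z - y)) * p w + ((-1) * q y w + q z w)) =
    outer (q z) - outer (q y).
  rewrite (outer_lin (- (z - y)) cp); last first.
    move=> w hw; apply: cont_atD; last exact: ck.
    by apply: cont_atM; [exact: cont_cst | exact: ck].
  rewrite (outer_lin (-1)); try by move=> w hw; exact: ck.
  by rewrite p0; ring.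
rewrite -/(q z) -/(q y) -E.
have s2 : 0 < s / 2 by rewrite divr_gt0.
apply: le_trans (outer_bound (e := (s / 2)^-1 ^+ 3 * nm (z - y) ^+ 2) _ _) _.
- move=> w hw; apply: cont_atD.
    by apply: cont_atM; [exact: cont_cst | exact: cp].
  apply: cont_atD; last exact: ck.
  by apply: cont_atM; [exact: cont_cst | exact: ck].
- move=> w hw.
  have ny : w - y != 0 by rewrite subr_eq0; exact: frame_neq hw.
  have nz : w - z != 0 by rewrite subr_eq0; exact: frame_neq hw.
  rewrite [X in nm X](_ : _ = q z w - q y w + (w - z - (w - y)) / (w - y) ^+ 2); last first.
    by rewrite /p /q; field; rewrite ny nz.
  rewrite inv_taylor // mulrC (_ : w - z - (w - y) = - (z - y)); last by ring.
  rewrite nmN; apply: ler_wpM2r; first exact: sqr_ge0.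
  rewrite exprVn lef_pV2 ?posrE ?mulr_gt0 ?exprn_gt0 ?nm_gt0 //.
  rewrite exprS; apply: ler_pM; rewrite ?(ltW s2) ?sqr_ge0 //; first exact: frame_far.
  by rewrite ler_sqr ?nnegrE ?nm_ge0 ?(ltW s2) //; exact: frame_far.
- rewrite le_eqVlt; apply/orP; left; apply/eqP; field.
  by rewrite lt0r_neq0.
Qed.

(** A function that varies by O(|z - y|^2) is constant: cutting the segment from 0 to z into M = 2^n
    pieces bounds its variation by a multiple of |z|^2 / M. *)
Lemma outer_kernel_const z : nm z <= s / 2 ->
  outer (fun w => (w - z)^-1) = outer (fun w => (w - 0)^-1).
Proof.
move=> hz; apply/subr0_eq/small_eq0 => e e0.
have s2 : 0 < s ^+ 2 by rewrite exprn_gt0.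
have [n hn] := half_pow_lt (64 / s ^+ 2 * nm z ^+ 2) e0.
have n0 : 0 < (2 ^+ n : R) by rewrite exprn_gt0.
pose M := (2 ^ n)%N; have ME : (M%:R : R) = 2 ^+ n by rewrite /M natrX.
pose P k : C := (k%:R / M%:R)%:C%C * z.
have M0 : 0 < (M%:R : R) by rewrite ME.
have Pin k : (k <= M)%N -> nm (P k) <= s / 2.
  move=> kM; rewrite /P nmM nm_real ger0_norm ?divr_ge0 //.
  apply: le_trans hz; rewrite ler_piMl ?nm_ge0 //.
  by rewrite ler_pdivrMr // mul1r ler_nat.
pose om z := outer (fun w => (w - z)^-1).
have key k : (k <= M)%N ->
    nm (om (P k) - om 0) <= k%:R * (64 / s ^+ 2 * (nm z / M%:R) ^+ 2).
  elim: k => [|k IH] kM.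
    rewrite mul0r /P mul0r (_ : 0%:C%C * z = 0) ?subrr ?nm0 //.
    by rewrite mul0r.
  have := outer_kernel_close (Pin _ kM) (Pin _ (ltnW kM)).
  have -> : P k.+1 - P k = (M%:R^-1)%:C%C * z.
    by rewrite /P -mulrBl -rmorphB -mulrBl -natr1 addrAC subrr add0r mul1r.
  rewrite nmM nm_real ger0_norm ?invr_ge0 ?(ltW M0) // [_ * nm z]mulrC.
  have := IH (ltnW kM); have := nm_dist (om (P k)) (om (P k.+1)) (om 0).
  rewrite -[k.+1%:R]natr1 mulrDl mul1r /om; lra.
have := key M (leqnn _); rewrite /P divff ?lt0r_neq0 // mul1r => /le_trans; apply.
apply/ltW/le_lt_trans/hn; rewrite -ME le_eqVlt; apply/orP; left; apply/eqP; field.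
by rewrite !lt0r_neq0.
Qed.

Lemma cint_opp g a b : has_cint g a b -> cint (fun w => - g w) a b = - cint g a b.
Proof.
move=> hg; have h0 := @is_cint_cst _ 0 a b; rewrite mulr0 in h0.
have := is_cint_lin (-1) (cintP hg) h0; rewrite mulN1r addr0 => h.
by rewrite -(cintE h); congr cint; apply/funext => w; rewrite mulN1r addr0.
Qed.

Lemma ImN z : complex.Im (- z) = - complex.Im z.
Proof. by case: z. Qed.

(** The integral is 2 pi i, but a crude bound shows that it is nonzero. Along each side, positively
    oriented, the imaginary part of dw / w is s / |w|^2 >= 1 / (2 s) per unit of length, and the
    total length is 8 s. *)
Lemma Im_outer_kernel : 4 <= complex.Im (outer (fun w => (w - 0)^-1)).
Proof.
have n0 : `|t 0| = s by rewrite node0 normrN gtr0_norm.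
have nN : `|t N| = s by rewrite nodeN gtr0_norm.
have tl j : t j <= t j.+1 by exact: node_le.
have z0 : nm 0 <= s / 2 by rewrite nm0 divr_ge0 // ltW.
have cq w : frame w -> cont_at (fun w => (w - 0)^-1) w.
  by move=> hw; apply: cauchy_kernel_cont; exact: frame_neq hw.
have [ih iv] := outer_edges cq.
have cq' w : frame w -> cont_at (fun w => - (w - 0)^-1) w.
  move=> /cq h e /h [d d1 hd]; exists d => // v /hd.
  by rewrite -nmN opprB opprK addrC.
have [ih' iv'] := outer_edges cq'.
have s2 : 0 < s ^+ 2 by rewrite exprn_gt0.
have invE (a b : R) : ((a +i* b)%C - 0)^-1 =
    ((a / (a ^+ 2 + b ^+ 2)) +i* - (b / (a ^+ 2 + b ^+ 2)))%C by rewrite subr0.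
have est (a b : R) : `|a| <= s -> `|b| = s -> (2 * s)^-1 <= s / (a ^+ 2 + b ^+ 2).
  move=> ha hb; have b2 : b ^+ 2 = s ^+ 2 by rewrite -hb real_normK ?num_real.
  have a2 : a ^+ 2 <= s ^+ 2.
    by rewrite -[a ^+ 2]real_normK ?num_real // ler_sqr ?nnegrE ?(ltW s0).
  have a3 : 0 <= a ^+ 2 by exact: sqr_ge0.
  have k0 : 0 < a ^+ 2 + b ^+ 2 by rewrite b2 ltr_wpDl.
  rewrite ler_pdivlMr // mulrC ler_pdivrMr ?mulr_gt0 // b2.
  by move: a2; rewrite !expr2; lra.
have dE j y : (t j.+1 +i* y)%C - (t j +i* y)%C = dl%:C%C * 1.
  by rewrite mulr1 nodeS; apply/eqP; rewrite eq_complex /= subrr addrAC subrr add0r !eqxx.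
have dE' j x : (x +i* t j.+1)%C - (x +i* t j)%C = dl%:C%C * 'i%C.
  by rewrite nodeS; apply/eqP; rewrite eq_complex /=; apply/andP; split; apply/eqP; ring.
have dl0 := ltW d0.
have hor g (j : 'I_N) y : `|y| = s -> has_cint g (t j +i* y)%C (t j.+1 +i* y)%C ->
    (forall a, `|a| <= s -> (2 * s)^-1 <= complex.Im (1 * g (a +i* y)%C)) ->
    dl * (2 * s)^-1 <= complex.Im (hI g (t j) (t j.+1) y).
  move=> hy ig H;
  apply: (cint_Im_ge (@rect_midconvex R (t j) (t j.+1) y y) _ _ ig _ dl0 (dE _ _));
    rewrite /rect /= ?lexx ?tl //.
  move=> w hw; have [h1 _ _] := frame_h hy hw; case: w hw h1 => a b [_ hb] h1.
  have -> : b = y by move: hb => /=; lra.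
  exact: H.
have ver g (k : 'I_N) x : `|x| = s -> has_cint g (x +i* t k)%C (x +i* t k.+1)%C ->
    (forall b, `|b| <= s -> (2 * s)^-1 <= complex.Im ('i%C * g (x +i* b)%C)) ->
    dl * (2 * s)^-1 <= complex.Im (vI g x (t k) (t k.+1)).
  move=> hx ig H;
  apply: (cint_Im_ge (@rect_midconvex R x x (t k) (t k.+1)) _ _ ig _ dl0 (dE' _ _));
    rewrite /rect /= ?lexx ?tl //.
  move=> w hw; have [_ h1 _] := frame_v hx hw; case: w hw h1 => a b [ha _] h1.
  have -> : a = x by move: ha => /=; lra.
  exact: H.
have bottom (j : 'I_N) : dl * (2 * s)^-1 <=
    complex.Im (hI (fun w => (w - 0)^-1) (t j) (t j.+1) (t 0)).
  apply: hor => //; first exact: ih.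
  by move=> a ha; rewrite invE mul1r /= -mulNr node0 opprK -node0; exact: est.
(* The top and left sides are run through backwards, so the estimate is applied to the opposite
   integrand. *)
have top (j : 'I_N) : dl * (2 * s)^-1 <=
    - complex.Im (hI (fun w => (w - 0)^-1) (t j) (t j.+1) (t N)).
  rewrite -ImN -cint_opp; last exact: ih.
  apply: hor => //; first exact: ih'.
  by move=> a ha; rewrite invE mul1r /= opprK {1}nodeN; exact: est.
have right (k : 'I_N) : dl * (2 * s)^-1 <=
    complex.Im (vI (fun w => (w - 0)^-1) (t N) (t k) (t k.+1)).
  apply: ver => //; first exact: iv.
  move=> b hb; rewrite invE /= mul0r add0r mul1r {1}nodeN addrC; exact: est.
have left (k : 'I_N) : dl * (2 * s)^-1 <=
    - complex.Im (vI (fun w => (w - 0)^-1) (t 0) (t k) (t k.+1)).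
  rewrite -ImN -cint_opp; last exact: iv.
  apply: ver => //; first exact: iv'.
  move=> b hb; rewrite invE /= mul0r add0r mul1r -mulNr {1}node0 opprK addrC; exact: est.
have sumge (F : 'I_N -> C) : (forall j, dl * (2 * s)^-1 + dl * (2 * s)^-1 <= complex.Im (F j)) ->
    2 <= complex.Im (\sum_j F j).
  move=> hF; rewrite (big_morph _ (@ImD R) (erefl : complex.Im 0 = 0 :> R)).
  apply: le_trans (ler_sum _ (fun j _ => hF j)).
  rewrite sumr_const card_ord -[leRHS]mulr_natr -mulrDl mulrAC mulrDl dN.
  by rewrite ler_pdivlMr ?mulr_gt0 //; lra.
rewrite /outer ImD (_ : 4 = 2 + 2 :> R); last by ring.
by apply: lerD; apply: sumge => j; rewrite ImB; apply: lerD.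
Qed.

Lemma nm_outer_kernel_ge z : nm z <= s / 2 ->
  4 <= nm (outer (fun w => (w - z)^-1)).
Proof.
move=> /outer_kernel_const ->; apply: le_trans Im_outer_kernel _.
exact: le_trans (ler_norm _) (nm_Im _).
Qed.

Variables (K : C -> Prop) (f : C -> C) (eta : R).

(** A cell is kept when it comes within [eta] of K, not only when it meets K: a discarded cell, and
    each of its edges, is then at distance at least [eta] from K. *)
Definition selected (j k : nat) : Prop :=
  exists2 u, K u & exists2 w, rect (t j) (t j.+1) (t k) (t k.+1) w & nm (u - w) < eta.

Definition chi (j k : nat) : C := if `[< selected j k >] then 1 else 0.

Hypotheses (eta0 : 0 < eta) (eta_s : eta <= s / 2)
  (K_s : forall u, K u -> nm u <= s / 2)
  (f_dif : forall j k, selected j k ->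
     forall w, rect (t j) (t j.+1) (t k) (t k.+1) w -> dif f w).

Lemma frame_K u w : K u -> s <= nm w -> eta <= nm (u - w).
Proof. by move=> /K_s hu hw; rewrite nm_sub; have := nm_lower w u; have := eta_s; lra. Qed.

(** A nonzero coefficient means that exactly one of the adjacent cells is selected. That cell makes
    [f] differentiable on the edge; the discarded one, or the frame if there is none, keeps the edge
    away from K. *)
Lemma dh_edge (j k : nat) : (j < N)%N -> (k < N.+1)%N -> dh chi j k != 0 ->
  forall w, rect (t j) (t j.+1) (t k) (t k) w ->
    (forall u, K u -> eta <= nm (u - w)) /\ dif f w.
Proof.
move=> jN kN hd w hw.
have upper : rect (t j) (t j.+1) (t k) (t k.+1) w.
  by case: hw => h1 h2; split=> //; have := @node_le k k.+1 (leqnSn _); lra.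
have far l (sl : ~ selected j l) : rect (t j) (t j.+1) (t l) (t l.+1) w ->
    forall u, K u -> eta <= nm (u - w).
  by move=> hl u Ku; rewrite leNgt; apply/negP => h; apply: sl; exists u => //; exists w.
have fr : `|t k| = s -> forall u, K u -> eta <= nm (u - w).
  by move=> hk u Ku; apply/(frame_K Ku)/frame_nm/(@frame_h (Ordinal jN) _ _ hk hw).
(* On the lowest row, as for [k.+1 = N] below, the edge has one adjacent cell only, and the distance
   to K comes from the frame. *)
case: k => [|k] in kN hd hw upper fr *.
  move: hd; rewrite /dh subr0 /chi; case: ifP => // N0; last by rewrite eqxx.
  case: asboolP => [sj _|]; last by rewrite eqxx.
  split; first by apply: fr; rewrite node0 normrN gtr0_norm.
  exact: f_dif sj _ upper.
have lower : rect (t j) (t j.+1) (t k) (t k.+1) w.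
  by case: hw => h1 h2; split=> //; have := @node_le k k.+1 (leqnSn _); lra.
move: hd; rewrite /dh /chi; case: ifP => [k1N|/negbT].
  case: asboolP => [s1|n1]; case: asboolP => [s2|n2]; rewrite ?subrr ?eqxx // => _.
    by split; [exact: far n2 lower | exact: f_dif s1 _ upper].
  by split; [exact: far n1 upper | exact: f_dif s2 _ lower].
rewrite -leqNgt => Nk; have e : k.+1 = N by apply/eqP; rewrite eqn_leq Nk -ltnS kN.
case: asboolP => [s2 _|]; last by rewrite subrr eqxx.
split; last exact: f_dif s2 _ lower.
by apply: fr; rewrite e nodeN gtr0_norm.
Qed.

Lemma dv_edge (j k : nat) : (j < N.+1)%N -> (k < N)%N -> dv chi j k != 0 ->
  forall w, rect (t j) (t j) (t k) (t k.+1) w ->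
    (forall u, K u -> eta <= nm (u - w)) /\ dif f w.
Proof.
move=> jN kN hd w hw.
have upper : rect (t j) (t j.+1) (t k) (t k.+1) w.
  by case: hw => h1 h2; split=> //; have := @node_le j j.+1 (leqnSn _); lra.
have far l (sl : ~ selected l k) : rect (t l) (t l.+1) (t k) (t k.+1) w ->
    forall u, K u -> eta <= nm (u - w).
  by move=> hl u Ku; rewrite leNgt; apply/negP => h; apply: sl; exists u => //; exists w.
have fr : `|t j| = s -> forall u, K u -> eta <= nm (u - w).
  by move=> hj u Ku; apply/(frame_K Ku)/frame_nm/(@frame_v (Ordinal kN) _ _ hj hw).
case: j => [|j] in jN hd hw upper fr *.
  move: hd; rewrite /dv /chi; case: (ltnP 0 N) => // N0; last by rewrite subrr eqxx.
  case: asboolP => [sj _|]; last by rewrite subrr eqxx.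
  split; first by apply: fr; rewrite node0 normrN gtr0_norm.
  exact: f_dif sj _ upper.
have lower : rect (t j) (t j.+1) (t k) (t k.+1) w.
  by case: hw => h1 h2; split=> //; have := @node_le j j.+1 (leqnSn _); lra.
move: hd; rewrite /dv /chi; case: (ltnP j.+1 N) => [k1N|Nk].
  case: asboolP => [s1|n1]; case: asboolP => [s2|n2]; rewrite ?subrr ?eqxx // => _.
    by split; [exact: far n2 upper | exact: f_dif s1 _ lower].
  by split; [exact: far n1 lower | exact: f_dif s2 _ upper].
have e : j.+1 = N by apply/eqP; rewrite eqn_leq Nk -ltnS jN.
case: asboolP => [s2 _|]; last by rewrite subrr eqxx.
split; last exact: f_dif s2 _ lower.
by apply: fr; rewrite e nodeN gtr0_norm.
Qed.

(** The quotient is split on edges and not on cells, because the two parts may be singular at [z],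
    while the edges of the chain stay away from K. *)
Lemma edge_slope z (l : C) x0 x1 y0 y1 : x0 <= x1 -> y0 <= y1 -> K z ->
  (forall w, rect x0 x1 y0 y1 w ->
    (forall u, K u -> eta <= nm (u - w)) /\ dif f w) ->
  let I g := cint g (x0 +i* y0)%C (x1 +i* y1)%C in
  I (slope f l z) = I (fun w => f w * (w - z)^-1) - f z * I (fun w => (w - z)^-1).
Proof.
move=> hx hy Kz H I.
have neq w : rect x0 x1 y0 y1 w -> w != z.
  by move=> /H[/(_ _ Kz) h _]; rewrite -subr_eq0 -nm_gt0 nm_sub (lt_le_trans eta0).
have i1 : has_cint (fun w => (w - z)^-1) (x0 +i* y0)%C (x1 +i* y1)%C.
  by apply: cts_has_cint => //; apply: cont_cts => w /neq wz; exact: cauchy_kernel_cont.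
have i2 : has_cint (fun w => f w * (w - z)^-1) (x0 +i* y0)%C (x1 +i* y1)%C.
  apply: cts_has_cint => //; apply: cont_cts => w hw; apply: cont_atM.
    by apply: dif_cont; case: (H _ hw).
  by apply: cauchy_kernel_cont; exact: neq.
rewrite /I addrC -mulNr -cint_lin //.
apply: (cint_ext (@rect_midconvex R x0 x1 y0 y1)).
- by split => /=; lra.
- by split => /=; lra.
- by move=> w /neq wz; rewrite /slope (negbTE wz); ring.
- by exists ((- f z) * I (fun w => (w - z)^-1) + I (fun w => f w * (w - z)^-1));
    apply: is_cint_lin; exact: cintP.
Qed.

Lemma cell_square j : t j.+1 - t j = dl.
Proof. by rewrite nodeS; ring. Qed.

(** The point [z] may lie on a grid line: the quotient is integrated over cells, where it is
    harmless at [z], and is split only on the edges of the chain, which avoid K. The factor [outer]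
    takes the place of 2 pi i. *)
Lemma grid_cauchy z : K z -> dif f z ->
  f z * outer (fun w => (w - z)^-1) = bdchain chi (fun w => f w * (w - z)^-1).
Proof.
move=> Kz [l hl].
have tl j : t j <= t j.+1 by exact: node_le.
have slope0 : bdchain chi (slope f l z) = 0.
  rewrite -bdchainE big1 // => j _; rewrite big1 // => k _.
  rewrite /chi; case: asboolP => [sjk|_]; last by rewrite mul0r.
  rewrite mul1r /cell (goursat (z0 := z)) ?cell_square //.
    by move=> _; exact: slope_cont.
  by move=> w hw /eqP wz; apply: slope_dif => //; exact: f_dif sjk _ hw.
have slopeE : bdchain chi (slope f l z) = bdchain chi (fun w => f w * (w - z)^-1)
    - f z * bdchain chi (fun w => (w - z)^-1).
  rewrite /bdchain mulrDr opprD addrACA; congr (_ + _).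
    rewrite mulr_sumr -sumrB; apply: eq_bigr => j _.
    rewrite mulr_sumr -sumrB; apply: eq_bigr => k _.
    have [->|hd] := eqVneq (dh chi j k) 0; first by rewrite !mul0r mulr0 subr0.
    rewrite /hI (edge_slope l (tl j) (lexx (t k)) Kz) ?mulrBr; first by ring.
    exact: dh_edge (ltn_ord j) (ltn_ord k) hd.
  rewrite mulr_sumr -sumrB; apply: eq_bigr => k _.
  rewrite mulr_sumr -sumrB; apply: eq_bigr => j _.
  have [->|hd] := eqVneq (dv chi j k) 0; first by rewrite !mul0r mulr0 subr0.
  rewrite /vI (edge_slope l (lexx (t j)) (tl k) Kz) ?mulrBr; first by ring.
  exact: dv_edge (ltn_ord j) (ltn_ord k) hd.
(* A cell that is not selected does not contain [z], so the kernel has integral zero over its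
   boundary and the cell may be added back. *)
have kerE : bdchain chi (fun w => (w - z)^-1) = outer (fun w => (w - z)^-1).
  rewrite -bdchainE -sum_cell; apply: eq_bigr => j _; apply: eq_bigr => k _.
  rewrite /chi; case: asboolP => [_|nsel]; first by rewrite mul1r.
  have neq w : rect (t j) (t j.+1) (t k) (t k.+1) w -> w != z.
    by move=> hw; apply/eqP => wz; apply: nsel; exists z => //; exists w => //; rewrite wz subrr nm0.
  rewrite mul0r /cell (goursat (z0 := z)) ?cell_square //.
    by move=> /neq; rewrite eqxx.
  by move=> w /neq wz _; exact: cauchy_kernel_dif.
by move: slope0; rewrite slopeE kerE => /subr0_eq.
Qed.

End GridCauchy.

(** * Pole pushing *)

Section PolePushing.
Variable R : realType.
Local Notation C := R[i].
Local Notation nm := (@ComplexField.Normc.normc R).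
Implicit Types (N D Q : {poly C}) (z u : C).

Lemma poly_cont (p : {poly C}) z : cont_at (fun w => p.[w]) z.
Proof.
elim/poly_ind: p => [|p c IH].
  by under eq_fun do rewrite horner0; exact: cont_cst.
under eq_fun do rewrite hornerMXaddC.
apply: cont_atD; last exact: cont_cst.
apply: cont_atM => // e e0; exists e => // w; exact: ltW.
Qed.

Variables K P : C -> Prop.

Definition pole_ok D : Prop := D != 0 /\ forall z, root D z -> P z /\ ~ K z.

Lemma pole_ok1 : pole_ok 1.
Proof. by split; [exact: oner_neq0 | move=> z; rewrite /root hornerC oner_eq0]. Qed.

Lemma pole_okM D1 D2 : pole_ok D1 -> pole_ok D2 -> pole_ok (D1 * D2).
Proof.
move=> [n1 h1] [n2 h2]; split; first by rewrite mulf_neq0.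
by move=> z; rewrite rootM => /orP[/h1|/h2].
Qed.

Lemma pole_okX D n : pole_ok D -> pole_ok (D ^+ n).
Proof.
move=> hD; elim: n => [|n IH]; first by rewrite expr0; exact: pole_ok1.
by rewrite exprS; exact: pole_okM.
Qed.

Lemma pole_ok_neq0 D u : pole_ok D -> K u -> D.[u] != 0.
Proof. by move=> [_ h] Ku; apply/negP => /h[]. Qed.

(* Some rational function with poles in [P] is larger at [z] than on [K]; a pole
   at [z] itself counts as an infinite value. *)
Definition pushable z : Prop :=
  exists N D s, [/\ pole_ok D, 0 < s,
    forall u, K u -> nm N.[u] <= s * nm D.[u] & s * nm D.[z] < nm N.[z]].

(* With h = N / D, the function (1 - (h u / h z) ^ n) / (u - z) of u has no pole
   at z. *)
Lemma geometric_approx N D z s t : 0 <= s -> s < t -> N.[z] != 0 ->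
  t * nm D.[z] <= nm N.[z] ->
  forall n, exists2 Q : {poly C}, (size Q <= (n * (size N + size D)).+1)%N &
    forall u, u != z -> D.[u] != 0 -> nm N.[u] <= s * nm D.[u] ->
      nm ((u - z)^-1 - Q.[u] / (D ^+ n).[u]) <= (s / t) ^+ n / nm (u - z).
Proof.
move=> s0 st Nz ht n.
(* It vanishes at [z] even if [D] does, so that ['X - z%:P] can be divided out. *)
pose p := N.[z] ^+ n *: D ^+ n - D.[z] ^+ n *: N ^+ n.
have : root p z.
  by rewrite /root !hornerE [X in X - _]mulrC subrr.
move=> /factor_theorem[q pq].
exists ((N.[z] ^+ n)^-1 *: q).
  apply: leq_trans (size_scale_leq _ _) _.
  have sE (a : {poly C}) : (size (a ^+ n) <= (n * size a).+1)%N.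
    apply: leq_trans (size_poly_exp_leq _ _) _.
    by rewrite ltnS mulnC leq_mul2l leq_pred orbT.
  have sp : (size p <= (n * (size N + size D)).+1)%N.
    apply: leq_trans (size_polyD _ _) _; rewrite geq_max size_polyN.
    apply/andP; split; apply: leq_trans (size_scale_leq _ _) _;
      apply: leq_trans (sE _) _; by rewrite ltnS leq_mul2l ?leq_addl ?leq_addr orbT.
  have [->|q0] := eqVneq q 0; first by rewrite size_poly0.
  by move: sp; rewrite pq size_Mmonic ?monicXsubC // size_XsubC addn2 /= => /ltnW.
move=> u uz Du hu.
have uz0 : u - z != 0 by rewrite subr_eq0.
have : p.[u] = q.[u] * (u - z) by rewrite pq !hornerE.
rewrite /p !hornerE => E.
have Nn : N.[z] ^+ n != 0 by rewrite expf_neq0.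
have Dn : D.[u] ^+ n != 0 by rewrite expf_neq0.
have -> : q.[u] = (N.[z] ^+ n * D.[u] ^+ n - D.[z] ^+ n * N.[u] ^+ n) / (u - z).
  by rewrite E mulfK.
have -> : (u - z)^-1 - (N.[z] ^+ n)^-1 * ((N.[z] ^+ n * D.[u] ^+ n - D.[z] ^+ n * N.[u] ^+ n) / (u - z)) / D.[u] ^+ n
   = ((D.[z] / N.[z]) * (N.[u] / D.[u])) ^+ n / (u - z).
  rewrite !exprMn !exprVn; field.
  by rewrite uz0 Nn Dn.
rewrite nmM nmV nmX; apply: ler_wpM2r; first by rewrite invr_ge0 nm_ge0.
have t0 : 0 < t by exact: le_lt_trans st.
have N0 : 0 < nm N.[z] by rewrite nm_gt0.
have D0 : 0 < nm D.[u] by rewrite nm_gt0.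
apply: lerXn2r; rewrite ?nnegrE ?nm_ge0 ?divr_ge0 ?(ltW t0) //.
rewrite !nmM !nmV mulrC; apply: ler_pM; rewrite ?mulr_ge0 ?invr_ge0 ?nm_ge0 //.
  by rewrite ler_pdivrMr.
by rewrite ler_pdivrMr // mulrC ler_pdivlMr // mulrC.
Qed.

(** The strict inequality leaves room for a factor t > s that works on a whole neighbourhood of [z];
    s / t is then a rate of approximation common to that neighbourhood. *)
Lemma pushable_near N D s z : 0 < s -> s * nm D.[z] < nm N.[z] ->
  exists2 t, s < t & exists2 r, 0 < r & forall w, nm (w - z) < r ->
    N.[w] != 0 /\ t * nm D.[w] <= nm N.[w].
Proof.
move=> s0 h; pose g := nm N.[z] - s * nm D.[z].
have g0 : 0 < g by rewrite subr_gt0.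
have D0 : 0 < nm D.[z] + 1 by rewrite ltr_wpDl ?nm_ge0.
(* Raising s to s + e uses at most half of the gap [g] at [z]; moving from [z] to [w] costs g / 8 on
   each side of the inequality. *)
pose e := g / (2 * (nm D.[z] + 1)).
have e0 : 0 < e by rewrite divr_gt0 // mulr_gt0.
have te : e * nm D.[z] <= g / 2.
  have -> : g / 2 = e * (nm D.[z] + 1) by rewrite /e; field; rewrite lt0r_neq0.
  by apply: ler_wpM2l; [exact: ltW | lra].
exists (s + e); first lra.
have t0 : 0 < s + e by lra.
have g8 : 0 < g / 8 by rewrite divr_gt0.
have [a a0 ha] := poly_cont N z g8.
have [b b0 hb] := poly_cont D z (divr_gt0 g8 t0).
exists (Num.min a b); first by rewrite lt_min a0 b0.
move=> w; rewrite lt_min => /andP[/ha h1 /hb h2].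
have h3 := nm_lower N.[z] (N.[z] - N.[w]).
have h4 := nm_lower D.[w] D.[z].
have h5 : (s + e) * nm D.[w] <= (s + e) * nm D.[z] + g / 8.
  have -> : g / 8 = (s + e) * (g / 8 / (s + e)) by field; rewrite lt0r_neq0.
  by rewrite -mulrDr; apply: ler_wpM2l; [exact: ltW | lra].
move: h3; rewrite opprB addrCA subrr addr0 nm_sub => h3.
have gE : nm N.[z] = g + s * nm D.[z] by rewrite /g; ring.
have sD : 0 <= s * nm D.[z] by rewrite mulr_ge0 ?nm_ge0 // ltW.
split; first by rewrite -nm_gt0; lra.
by move: h5; rewrite !mulrDl; lra.
Qed.

Lemma pushable_open z : pushable z ->
  exists2 r, 0 < r & forall w, nm (w - z) < r -> pushable w.
Proof.
move=> [N [D [s [Dok s0 hK hz]]]].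
have [t st [r r0 hr]] := pushable_near s0 hz.
exists r => // w /hr[Nw hw]; exists N, D, s; split=> //.
have [->|Dw] := eqVneq D.[w] 0; first by rewrite nm0 mulr0 nm_gt0.
by apply: lt_le_trans hw; rewrite ltr_pM2r // nm_gt0.
Qed.

(** The function 1 / (x - z) is bounded by 1 / d on K and has its pole at [z]. *)
Lemma pushable_pole z d : P z -> 0 < d -> (forall u, K u -> d <= nm (u - z)) ->
  pushable z.
Proof.
move=> Pz d0 hd; exists 1, ('X - z%:P), d^-1; split.
- split; first by rewrite polyXsubC_eq0.
  move=> w; rewrite root_XsubC => /eqP->; split => // /hd.
  by rewrite subrr nm0 leNgt d0.
- by rewrite invr_gt0.
- by move=> u /hd h; rewrite !hornerE nm1 mulrC ler_pdivlMr // mul1r.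
- by rewrite !hornerE subrr nm0 mulr0 nm1.
Qed.

(** The function x is larger at [z] than on K. It is polynomial, and a pole at the point at infinity
    of the coordinate is always allowed. *)
Lemma pushable_infty z L : 0 < L -> (forall u, K u -> nm u <= L) -> L < nm z ->
  pushable z.
Proof.
move=> L0 hL Lz; exists 'X, 1, L; split=> //; first exact: pole_ok1.
- by move=> u /hL; rewrite !hornerE nm1 mulr1.
- by rewrite !hornerE nm1 mulr1.
Qed.

Lemma exp_small (q e : R) : 0 <= q -> q < 1 -> 0 < e -> exists n : nat, q ^+ n <= e.
Proof.
move=> q0 q1 e0.
have /cvgrPdist_le /(_ e e0) [n _ /(_ n (leqnn n))] : (fun n => q ^+ n) @ \oo --> (0 : R).
  by apply: cvg_expr; rewrite ger0_norm.
by rewrite /= sub0r normrN ger0_norm ?exprn_ge0 // => h; exists n.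
Qed.

(** As |z - w| < d / 3, every point of K has distance at least 2 a from [w], where a = |z - w|.
    Hence 1 / (x - w) is at least twice as large at [z] as on K. Since [w] is pushable, this
    function can be approximated with poles in P; a relative error of 1/4 leaves at most (5/4) / (2
    a) on K and at least (3/4) / a at [z]. *)
Lemma pushable_closed z w d : 0 < d -> (forall u, K u -> d <= nm (u - z)) ->
  pushable w -> nm (z - w) < d / 3 -> pushable z.
Proof.
move=> d0 hd [N [D [s [Dok s0 hK hw]]]] zw.
have [->|zw0] := eqVneq z w; first by exists N, D, s.
have [Dz|Dz] := eqVneq D.[z] 0.
  by apply: (pushable_pole _ d0 hd); apply: (Dok.2 z _).1; rewrite /root Dz.
(* Unless N / D already separates [z] from K, it is bounded by [s] at [z] as well, so
   [geometric_approx] applies at [z] as it does on K. *)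
have [?|Nz] := ltP (s * nm D.[z]) (nm N.[z]); first by exists N, D, s.
have [t st [r r0 hr]] := pushable_near s0 hw.
have [|Nw tw] := hr w; first by rewrite subrr nm0.
have t0 : 0 < t by exact: lt_trans st.
have e4 : 0 < (4 : R)^-1 by [].
have q0 : 0 <= s / t by rewrite divr_ge0 // ltW.
have q1 : s / t < 1 by rewrite ltr_pdivrMr // mul1r.
have [n hn] := exp_small q0 q1 e4.
have [Q _ hQ] := geometric_approx (ltW s0) st Nw tw n.
set a := nm (z - w) in zw *.
have a0 : 0 < a by rewrite nm_gt0 subr_eq0.
have a0' : a != 0 by rewrite lt0r_neq0.
exists Q, (D ^+ n), (5 / 8 / a); split.
- exact: pole_okX.
- by rewrite !divr_gt0.
- move=> u Ku.
  have Du : D.[u] != 0 by exact: pole_ok_neq0 Ku.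
  have Dnu : 0 < nm (D ^+ n).[u] by rewrite horner_exp nm_gt0 expf_neq0.
  have uw : 2 * a <= nm (u - w).
    have := hd _ Ku; have := nm_dist w u z; rewrite (nm_sub w z) -/a; lra.
  have uw0 : 0 < nm (u - w) by lra.
  have := hQ u _ Du (hK _ Ku); rewrite -subr_eq0 -nm_gt0 => /(_ uw0) h.
  have E : nm (Q.[u] / (D ^+ n).[u]) = nm Q.[u] / nm (D ^+ n).[u] by rewrite nmM nmV.
  rewrite -ler_pdivrMr // -E.
  have i1 : (nm (u - w))^-1 <= (2 * a)^-1 by rewrite lef_pV2 ?posrE ?mulr_gt0.
  have i0 : 0 <= (nm (u - w))^-1 by rewrite invr_ge0 nm_ge0.
  have i2 := ler_wpM2r i0 hn.
  have := nm_lower (Q.[u] / (D ^+ n).[u]) (u - w)^-1.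
  rewrite nm_sub nmV => i3.
  have i4 : (2 * a)^-1 = 4 / 8 / a by field.
  by move: i1; rewrite i4; lra.
- have := hQ z zw0 Dz Nz; rewrite -/a => h.
  have Dnz : 0 < nm (D ^+ n).[z] by rewrite horner_exp nm_gt0 expf_neq0.
  have E : nm (Q.[z] / (D ^+ n).[z]) = nm Q.[z] / nm (D ^+ n).[z] by rewrite nmM nmV.
  rewrite -ltr_pdivlMr // -E.
  have i0 : 0 < a^-1 by rewrite invr_gt0.
  have i2 := ler_wpM2r (ltW i0) hn.
  have := nm_lower (z - w)^-1 ((z - w)^-1 - Q.[z] / (D ^+ n).[z]).
  rewrite opprB addrCA subrr addr0 nmV -/a; lra.
Qed.

End PolePushing.

(** * Approximation of the Cauchy kernels over a common denominator *)

Section PlaneRunge.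
Variable R : realType.
Local Notation C := R[i].
Local Notation nm := (@ComplexField.Normc.normc R).
Implicit Types (z w u : C).

Lemma cts_bounded (g : C -> C) (X0 X1 Y0 Y1 : R) : X0 <= X1 -> Y0 <= Y1 ->
  cts (rect X0 X1 Y0 Y1) g ->
  exists2 M, 0 <= M & forall z, rect X0 X1 Y0 Y1 z -> nm (g z) <= M.
Proof.
move=> hX hY cg.
pose Pr x0 x1 y0 y1 := exists2 M, 0 <= M &
  forall z, rect X0 X1 Y0 Y1 z -> rect x0 x1 y0 y1 z -> nm (g z) <= M.
suff [M M0 HM] : Pr X0 X1 Y0 Y1 by exists M => // z hz; exact: HM.
apply: cousin => //.
  move=> x0 x1 y0 y1 hx hy /= [a a0 ha] [b b0 hb] [c c0 hc] [d d0 hd].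
  exists (a + b + c + d); first lra.
  move=> z Xz [/andP[h1 h2] /andP[h3 h4]].
  have [k1|k1] := leP (complex.Re z) ((x0 + x1) / 2);
    have [k2|k2] := leP (complex.Im z) ((y0 + y1) / 2).
  - by have := ha z Xz ltac:(split; lra); lra.
  - by have := hc z Xz ltac:(split; lra); lra.
  - by have := hb z Xz ltac:(split; lra); lra.
  - by have := hd z Xz ltac:(split; lra); lra.
move=> x y hx hy; have [d d0 hd] := cg (x +i* y)%C (conj hx hy) _ ltr01.
exists (d / 2); first lra.
move=> x0 x1 y0 y1 hx' hy' _ _ _ _ l1 l2.
exists (nm (g (x +i* y)%C) + 1); first by rewrite addr_ge0 ?nm_ge0.
move=> z Xz hz; have := hd z Xz.
have := rect_dist hz (conj hx' hy' : rect _ _ _ _ (x +i* y)%C).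
have := nm_lower (g z) (g (x +i* y)%C).
move=> h1 h2 /(_ ltac:(lra)); lra.
Qed.

Variables K P : C -> Prop.

(** [D] is chosen before [z]: only the numerator depends on the point, so sums of kernels over any
    number of points of [X] keep the same degree bound. *)
Definition kernel_approx (X : C -> Prop) : Prop :=
  exists (A B : R) (c : nat), [/\ 0 < A, 1 < B & forall n, exists D : {poly C},
    [/\ pole_ok K P D, (size D <= (c * n).+1)%N &
      forall z, X z -> exists2 Q : {poly C}, (size Q <= (c * n).+1)%N &
        forall u, K u -> nm ((z - u)^-1 - Q.[u] / D.[u]) <= A / B ^+ n]].

Lemma rate_mono (A A' B B' : R) n : 0 <= A -> A <= A' -> 0 < B' -> B' <= B ->
  A / B ^+ n <= A' / B' ^+ n.
Proof.
move=> A0 AA B0 BB; apply: ler_pM => //.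
  by rewrite invr_ge0 exprn_ge0 // (le_trans (ltW B0)).
rewrite lef_pV2 ?posrE ?exprn_gt0 ?(lt_le_trans B0) //.
by apply: lerXn2r; rewrite ?nnegrE ?(ltW B0) // (le_trans (ltW B0)).
Qed.

Lemma size_mul_le (Q D : {poly C}) a b n : (size Q <= (a * n).+1)%N ->
  (size D <= (b * n).+1)%N -> (size (Q * D)%R <= ((a + b) * n).+1)%N.
Proof.
move=> h1 h2; apply: leq_trans (size_polyMleq _ _) _.
by rewrite mulnDl; lia.
Qed.

(** The denominators are multiplied, so the degree factors add, and the worse rate is kept. *)
Lemma kernel_approxU X Y : kernel_approx X -> kernel_approx Y ->
  kernel_approx (fun z => X z \/ Y z).
Proof.
move=> [A [B [c [A0 B1 H]]]] [A' [B' [c' [A0' B1' H']]]].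
exists (Num.max A A'), (Num.min B B'), (c + c')%N; split.
- by rewrite lt_max A0.
- by rewrite lt_min B1.
move=> n; have [D [Dok sD HD]] := H n; have [D' [Dok' sD' HD']] := H' n.
exists (D * D'); split; [exact: pole_okM | exact: size_mul_le | ].
have Bp : 0 < Num.min B B' by rewrite lt_min !(lt_trans ltr01).
have r1 : A / B ^+ n <= Num.max A A' / Num.min B B' ^+ n.
  by apply: rate_mono => //; rewrite ?(ltW A0) ?le_max ?ge_min ?lexx.
have r2 : A' / B' ^+ n <= Num.max A A' / Num.min B B' ^+ n.
  by apply: rate_mono => //; rewrite ?(ltW A0') ?le_max ?ge_min ?lexx ?orbT.
move=> z [/HD[Q sQ HQ]|/HD'[Q sQ HQ]].
- exists (Q * D'); first exact: size_mul_le.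
  move=> u Ku; apply: le_trans r1; apply: le_trans (HQ u Ku).
  by rewrite !hornerM -mulf_div divff ?mulr1 //; exact: (pole_ok_neq0 Dok' Ku).
- exists (Q * D); first by have := size_mul_le sQ sD; rewrite addnC.
  move=> u Ku; apply: le_trans r2; apply: le_trans (HQ u Ku).
  by rewrite !hornerM [D.[u] * _]mulrC -mulf_div divff ?mulr1 //; exact: (pole_ok_neq0 Dok Ku).
Qed.

Lemma kernel_approxS X Y : (forall z, Y z -> X z) -> kernel_approx X ->
  kernel_approx Y.
Proof.
move=> YX [A [B [c [A0 B1 H]]]]; exists A, B, c; split=> // n.
by have [D [h1 h2 h3]] := H n; exists D; split=> // z /YX /h3.
Qed.

Lemma kernel_approx0 X : (forall z, ~ X z) -> kernel_approx X.
Proof.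
move=> X0; exists 1, 2, 0%N; split => //; first by rewrite ltr1n.
move=> n; exists 1; split; [exact: pole_ok1 | by rewrite size_poly1 | by move=> z /X0].
Qed.

(** One function N / D serves a neighbourhood of [z]: the denominator is [D ^+ n], the rate t / s,
    and 1 / e bounds the kernels on K. *)
Lemma kernel_approx_local z e : 0 < e -> pushable K P z ->
  exists2 r, 0 < r & kernel_approx (fun w => nm (w - z) < r /\
    forall u, K u -> e <= nm (u - w)).
Proof.
move=> e0 [N [D [s [Dok s0 hK hz]]]].
have [t st [r r0 hr]] := pushable_near s0 hz; exists r => //.
have t0 : 0 < t by exact: lt_trans st.
exists e^-1, (t / s), (size N + size D)%N; split; first by rewrite invr_gt0.
  by rewrite ltr_pdivlMr // mul1r.
move=> n; exists (D ^+ n); split; first exact: pole_okX.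
  apply: leq_trans (size_poly_exp_leq _ _) _; rewrite ltnS leq_mul2r.
  by apply/orP; right; rewrite (leq_trans (leq_pred _)) ?leq_addl.
move=> w [/hr[Nw tw] far].
have [Q sQ HQ] := geometric_approx (ltW s0) st Nw tw n.
exists (- Q); first by rewrite size_polyN mulnC.
move=> u Ku; have uw := far _ Ku.
have uw0 : 0 < nm (u - w) by exact: lt_le_trans uw.
have uw1 : u != w by rewrite -subr_eq0 -nm_gt0.
have := HQ u uw1 (pole_ok_neq0 Dok Ku) (hK _ Ku).
rewrite -nmN hornerN mulNr opprB opprK addrC -[w - u]opprB invrN => /le_trans; apply.
rewrite mulrC; apply: ler_pM; rewrite ?invr_ge0 ?exprn_ge0 ?divr_ge0 ?(ltW s0) ?(ltW t0) ?nm_ge0 //.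
  by rewrite lef_pV2 ?posrE.
by rewrite -exprVn invf_div.
Qed.

Lemma kernel_approx_rect (e : R) (X0 X1 Y0 Y1 : R) : 0 < e -> X0 <= X1 -> Y0 <= Y1 ->
  (forall z, (forall u, K u -> e <= nm (u - z)) -> pushable K P z) ->
  kernel_approx (fun z => rect X0 X1 Y0 Y1 z /\ forall u, K u -> e <= nm (u - z)).
Proof.
move=> e0 hX hY push.
pattern X0, X1, Y0, Y1; apply: cousin => //.
  move=> x0 x1 y0 y1 hx hy /= h1 h2 h3 h4.
  apply: kernel_approxS (kernel_approxU (kernel_approxU h1 h2) (kernel_approxU h3 h4)).
  move=> z [[/andP[k1 k2] /andP[k3 k4]] hz].
  have [k5|k5] := leP (complex.Re z) ((x0 + x1) / 2);
    have [k6|k6] := leP (complex.Im z) ((y0 + y1) / 2).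
  - by left; left; split=> //; split; lra.
  - by right; left; split=> //; split; lra.
  - by left; right; split=> //; split; lra.
  - by right; right; split=> //; split; lra.
move=> x y hx hy.
have [far|/existsNP[u /not_implyP[Ku /negP]]] :=
    pselect (forall u, K u -> e <= nm (u - (x +i* y)%C)).
  have [r r0 hr] := kernel_approx_local e0 (push _ far).
  exists (r / 2); first lra.
  move=> x0 x1 y0 y1 hx' hy' _ _ _ _ l1 l2; apply: kernel_approxS hr.
  move=> z [hz far_z]; split=> //.
  by have := rect_dist hz (conj hx' hy' : rect _ _ _ _ (x +i* y)%C); lra.
(* Around a point closer than [e] to K, small rectangles contain no admissible [z]. *)
rewrite -ltNge => near; exists ((e - nm (u - (x +i* y)%C)) / 2); first lra.
move=> x0 x1 y0 y1 hx' hy' _ _ _ _ l1 l2; apply: kernel_approx0 => z [hz far_z].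
have := rect_dist hz (conj hx' hy' : rect _ _ _ _ (x +i* y)%C).
have := far_z u Ku; have := nm_dist (x +i* y)%C u z.
by rewrite (nm_sub (x +i* y)%C z); lra.
Qed.

End PlaneRunge.

(** * Runge's theorem in the plane *)

Section PlaneRungeTheorem.
Variable R : realType.
Local Notation C := R[i].
Local Notation nm := (@ComplexField.Normc.normc R).
Implicit Types (z w u : C) (F f : C -> C).
Variables K P : C -> Prop.

Section FixedDenominators.
Variables (D : nat -> {poly C}) (c : nat) (A B : R).
Hypotheses (A0 : 0 < A) (B1 : 1 < B).

(** With denominators, degree bound and rate fixed, these functions form a vector space; only the
    factor [E] varies with [F]. The integrals over the edges of the chain, and hence their
    combination, belong to it. *)
Definition approx F : Prop :=
  exists2 E, 0 <= E & forall n, exists2 Q : {poly C}, (size Q <= (c * n).+1)%N &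
    forall u, K u -> nm (F u - Q.[u] / (D n).[u]) <= E * (A / B ^+ n).

Lemma approx0 : approx (fun=> 0).
Proof.
exists 0 => // n; exists 0; first by rewrite size_poly0.
by move=> u _; rewrite horner0 mul0r subrr nm0 mul0r.
Qed.

Lemma approxD F F' : approx F -> approx F' -> approx (fun u => F u + F' u).
Proof.
move=> [E E0 H] [E' E0' H']; exists (E + E'); first exact: addr_ge0.
move=> n; have [Q sQ HQ] := H n; have [Q' sQ' HQ'] := H' n.
exists (Q + Q').
  by apply: leq_trans (size_polyD _ _) _; rewrite geq_max sQ.
move=> u Ku; rewrite hornerD mulrDl opprD addrACA mulrDl.
by apply: le_trans (nmD _ _) _; apply: lerD; [exact: HQ | exact: HQ'].
Qed.

Lemma approxZ k F : approx F -> approx (fun u => k * F u).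
Proof.
move=> [E E0 H]; exists (nm k * E); first by rewrite mulr_ge0 ?nm_ge0.
move=> n; have [Q sQ HQ] := H n; exists (k *: Q).
  exact: leq_trans (size_scale_leq _ _) _.
move=> u Ku; rewrite hornerZ -mulrA -mulrBr nmM -mulrA.
by apply: ler_wpM2l; [exact: nm_ge0 | exact: HQ].
Qed.

Lemma approx_sum N (F : nat -> C -> C) :
  (forall i, (i < N)%N -> approx (F i)) -> approx (fun u => \sum_(i < N) F i u).
Proof.
elim: N => [|N IH] H.
  by under eq_fun do rewrite big_ord0; exact: approx0.
under eq_fun do rewrite big_ord_recr /=.
by apply: approxD; [apply: IH => i iN; apply: H; exact: ltnW | exact: H].
Qed.

Variables (X : C -> Prop) (f : C -> C) (eta : R).
Hypotheses (eta0 : 0 < eta)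
  (X_far : forall z, X z -> forall u, K u -> eta <= nm (u - z))
  (X_approx : forall n z, X z -> exists2 Q : {poly C}, (size Q <= (c * n).+1)%N &
     forall u, K u -> nm ((z - u)^-1 - Q.[u] / (D n).[u]) <= A / B ^+ n).

(** The pieces of the segment have total length |b - a| and share the denominator [D n], so neither
    the degree nor the error depends on the level [k]. *)
Lemma rsum_approx M (Y : C -> Prop) n k a b : midconvex Y ->
  (forall z, Y z -> X z /\ nm (f z) <= M) -> Y a -> Y b ->
  exists2 Q : {poly C}, (size Q <= (c * n).+1)%N &
    forall u, K u -> nm (rsum (fun w => f w * (w - u)^-1) k a b - Q.[u] / (D n).[u])
       <= M * nm (b - a) * (A / B ^+ n).
Proof.
move=> mY H; elim: k a b => [|k IH] a b Ya Yb /=.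
  have [Xa fa] := H _ Ya; have [Q sQ HQ] := X_approx n Xa.
  exists (((b - a) * f a) *: Q); first exact: leq_trans (size_scale_leq _ _) _.
  move=> u /HQ h; rewrite hornerZ (_ : _ - _ =
    (b - a) * f a * ((a - u)^-1 - Q.[u] / (D n).[u])); last by ring.
  rewrite !nmM.
  rewrite [M * _]mulrC; apply: ler_pM; rewrite ?mulr_ge0 ?nm_ge0 //.
  by apply: ler_wpM2l => //; exact: nm_ge0.
have Ym := mY _ _ Ya Yb.
have [Q sQ HQ] := IH _ _ Ya Ym; have [Q' sQ' HQ'] := IH _ _ Ym Yb.
exists (Q + Q'); first by apply: leq_trans (size_polyD _ _) _; rewrite geq_max sQ.
move=> u Ku; rewrite hornerD [X in _ - X]mulrDl opprD addrACA.
have := HQ u Ku; have := HQ' u Ku; rewrite nm_midl nm_midr.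
set x := rsum _ _ _ _ - _; set y := rsum _ _ _ _ - _ => h1 h2.
by have := nmD y x; lra.
Qed.

(** The bound |w - u| >= eta for all u in K makes the modulus of continuity in w independent of
    u. *)
Lemma cauchy_equicts x0 x1 y0 y1 :
  (forall z, rect x0 x1 y0 y1 z -> X z /\ dif f z) ->
  equicts (rect x0 x1 y0 y1) (fun (i : {u | K u}) w => f w * (w - sval i)^-1).
Proof.
move=> H w hw e e0; have [Xw df] := H _ hw.
have k0 : 0 < nm (f w) + 1 by rewrite ltr_wpDl ?nm_ge0.
have e2 : 0 < Num.min 1 (e / 2 * eta) by rewrite lt_min ltr01 mulr_gt0 // divr_gt0.
have [d d0 hd] := dif_cont df e2.
have d2 : 0 < e / 2 / (nm (f w) + 1) * eta ^+ 2.
  by rewrite !mulr_gt0 ?invr_gt0 // exprn_gt0.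
exists (Num.min d (e / 2 / (nm (f w) + 1) * eta ^+ 2)); first by rewrite lt_min d0.
move=> [u Ku] v hv /=; rewrite lt_min => /andP[/hd]; rewrite le_min => /andP[_ h1] h2.
have [Xv _] := H _ hv.
have fu := X_far Xw Ku; have fv := X_far Xv Ku; rewrite nm_sub in fu; rewrite nm_sub in fv.
have nw : 0 < nm (w - u) by exact: lt_le_trans fu.
have nv : 0 < nm (v - u) by exact: lt_le_trans fv.
have wu : w - u != 0 by rewrite -nm_gt0.
have vu : v - u != 0 by rewrite -nm_gt0.
have -> : f v * (v - u)^-1 - f w * (w - u)^-1 =
    (f v - f w) * (v - u)^-1 - f w * (v - w) * ((v - u)^-1 * (w - u)^-1).
  by field; rewrite wu vu.
have iv : nm (v - u)^-1 <= eta^-1 by rewrite nmV lef_pV2 ?posrE.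
have iw : nm (w - u)^-1 <= eta^-1 by rewrite nmV lef_pV2 ?posrE.
apply: le_trans (nmB _ _) _; rewrite !nmM.
have b1 : nm (f v - f w) * nm (v - u)^-1 <= e / 2.
  rewrite -[leRHS](mulfK (lt0r_neq0 eta0)).
  by apply: ler_pM; rewrite ?nm_ge0.
have b2 : nm (f w) * nm (v - w) * (nm (v - u)^-1 * nm (w - u)^-1) <= e / 2.
  have e20 : 0 < eta ^+ 2 by rewrite exprn_gt0.
  rewrite -[leRHS](mulfK (lt0r_neq0 e20)).
  apply: ler_pM; rewrite ?mulr_ge0 ?nm_ge0 //; last first.
    by rewrite expr2 invfM; apply: ler_pM; rewrite ?nm_ge0.
  have h3 : nm (f w) * nm (v - w) <= nm (f w) * (e / 2 / (nm (f w) + 1) * eta ^+ 2).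
    by apply: ler_wpM2l; [exact: nm_ge0 | exact: ltW].
  apply: le_trans h3 _; rewrite mulrA; apply: ler_wpM2r; first exact: ltW.
  rewrite mulrA ler_pdivrMr // mulrC; apply: ler_wpM2l; lra.
lra.
Qed.

Lemma cint_approx x0 x1 y0 y1 : x0 <= x1 -> y0 <= y1 ->
  (forall z, rect x0 x1 y0 y1 z -> X z /\ dif f z) ->
  approx (fun u => cint (fun w => f w * (w - u)^-1) (x0 +i* y0)%C (x1 +i* y1)%C).
Proof.
move=> hx hy H.
have [|M M0 HM] := @cts_bounded R f _ _ _ _ hx hy.
  by apply: cont_cts => z /H[_]; exact: dif_cont.
set a := (x0 +i* y0)%C; set b := (x1 +i* y1)%C.
have Ya : rect x0 x1 y0 y1 a by split => /=; lra.
have Yb : rect x0 x1 y0 y1 b by split => /=; lra.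
(* The summand 1 pays for replacing the integral by a Riemann sum, whose level is chosen for each
   [n] so that its error is at most A / B^n. *)
exists (M * nm (b - a) + 1); first by rewrite addr_ge0 // mulr_ge0 ?nm_ge0.
move=> n; have e0 : 0 < A / B ^+ n by rewrite divr_gt0 // exprn_gt0 // (lt_trans ltr01).
have [k hk] := rsum_cvg_unif hx hy (cauchy_equicts H) e0.
have [|Q sQ HQ] := rsum_approx (M := M) n k (@rect_midconvex R x0 x1 y0 y1) _ Ya Yb.
  by move=> z hz; split; [case: (H z hz) | exact: HM].
exists Q => // u Ku; have := hk (exist _ u Ku); rewrite /= -/a -/b.
have := HQ u Ku.
set I := cint _ a b; set S := rsum _ k a b; set q := _ / _ => h1 h2.
have := nm_dist S I q; rewrite (nm_sub I S) mulrDl mul1r; lra.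
Qed.

End FixedDenominators.

(** Bernoulli's inequality with x = (B - 1) / (c B) gives (1 - x)^c >= 1 - c x = 1 / B, so B' = 1 /
    (1 - x) will do. *)
Lemma rate_root (B : R) (c : nat) : 1 < B -> (0 < c)%N ->
  exists2 B' : R, 1 < B' & B' ^+ c <= B.
Proof.
move=> B1 c0; pose x := (B - 1) / (c%:R * B).
have c1 : 1 <= c%:R :> R by rewrite ler1n.
have B0 : 0 < B by lra.
have cp : 0 < c%:R :> R by rewrite ltr0n.
have x0 : 0 < x by rewrite divr_gt0 ?mulr_gt0 ?subr_gt0.
have xB : c%:R * x = 1 - B^-1 by rewrite /x; field; rewrite !lt0r_neq0.
have Bi : 0 < B^-1 by rewrite invr_gt0.
have x1 : x < 1.
  have : x <= c%:R * x by rewrite ler_peMl // ltW.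
  by rewrite xB; lra.
have bern n : 1 - n%:R * x <= (1 - x) ^+ n.
  elim: n => [|n IH]; first by rewrite expr0 mul0r subr0.
  rewrite exprS -natr1.
  have h : (1 - x) * (1 - n%:R * x) <= (1 - x) * (1 - x) ^+ n.
    by apply: ler_wpM2l => //; lra.
  have x0' := ltW x0.
  have : 0 <= n%:R * x * x by apply: mulr_ge0 => //; apply: mulr_ge0.
  by move: h; set y := (1 - x) * (1 - x) ^+ n; lra.
exists (1 - x)^-1; first by rewrite invf_gt1 //; lra.
rewrite exprVn -[leRHS]invrK lef_pV2 ?posrE ?invr_gt0 ?exprn_gt0 //; last lra.
by have := bern c; rewrite xB; lra.
Qed.

Lemma lebesgue_number f (L : R) : 0 <= L ->
  (forall u, K u -> nm u <= L) ->
  (forall z, ~ K z -> exists2 d, 0 < d & forall u, K u -> d <= nm (u - z)) ->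
  (forall u, K u -> exists2 r, 0 < r & forall w, nm (w - u) < r -> dif f w) ->
  exists2 r, 0 < r & forall u, K u -> forall w, nm (w - u) < r -> dif f w.
Proof.
move=> L0 KL Kc Kf.
pose Pr x0 x1 y0 y1 := exists2 r, 0 < r & forall u, K u -> rect x0 x1 y0 y1 u ->
  forall w, nm (w - u) < r -> dif f w.
suff [r r0 hr] : Pr (- L) L (- L) L.
  exists r => // u Ku; apply: hr => //.
  have := KL u Ku; have := nm_Re u; have := nm_Im u.
  by move=> h1 h2 h3; split; rewrite -ler_norml; lra.
apply: cousin; [lra | lra | | ].
  move=> x0 x1 y0 y1 hx hy /= [a a0 ha] [b b0 hb] [c c0 hc] [d d0 hd].
  exists (Num.min (Num.min a b) (Num.min c d)); first by rewrite !lt_min a0 b0 c0 d0.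
  move=> u Ku [/andP[k1 k2] /andP[k3 k4]] w.
  rewrite !lt_min => /andP[/andP[l1 l2] /andP[l3 l4]].
  have [k5|k5] := leP (complex.Re u) ((x0 + x1) / 2);
    have [k6|k6] := leP (complex.Im u) ((y0 + y1) / 2).
  - by apply: ha l1 => //; split; lra.
  - by apply: hc l3 => //; split; lra.
  - by apply: hb l2 => //; split; lra.
  - by apply: hd l4 => //; split; lra.
move=> x y hx hy; have [/Kf[r r0 hr]|/Kc[d d0 hd]] := pselect (K (x +i* y)%C).
  exists (r / 4); first lra.
  move=> x0 x1 y0 y1 hx' hy' _ _ _ _ l1 l2; exists (r / 2); first lra.
  move=> u Ku hu w wu; apply: hr.
  have := rect_dist hu (conj hx' hy' : rect _ _ _ _ (x +i* y)%C).
  by have := nm_dist u w (x +i* y)%C; lra.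
exists (d / 2); first lra.
move=> x0 x1 y0 y1 hx' hy' _ _ _ _ l1 l2; exists 1 => // u Ku hu.
have := rect_dist hu (conj hx' hy' : rect _ _ _ _ (x +i* y)%C).
by have := hd u Ku; lra.
Qed.

Theorem plane_runge f (L : R) :
  (forall u, K u -> nm u <= L) ->
  (forall z, ~ K z -> exists2 d, 0 < d & forall u, K u -> d <= nm (u - z)) ->
  (forall u, K u -> exists2 r, 0 < r & forall w, nm (w - u) < r -> dif f w) ->
  (forall z, ~ K z -> pushable K P z) ->
  exists A B : R, [/\ 1 < A, 1 < B & forall n, exists Q D : {poly C},
    [/\ pole_ok K P D, (size Q <= n.+1)%N, (size D <= n.+1)%N &
      forall u, K u -> nm (f u - Q.[u] / D.[u]) <= A / B ^+ n]].
Proof.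
move=> KL0 Kc Kf push.
have [L1 L10 KL] : exists2 L1, 0 < L1 & forall u, K u -> nm u <= L1.
  exists (`|L| + 1); first by rewrite ltr_wpDl.
  by move=> u /KL0; have := ler_norm L; lra.
have [r r0 hr] := lebesgue_number (ltW L10) KL Kc Kf.
(* K lies in the disc of radius s / 2, as the kernel estimates require. A selected cell comes within
   eta <= r / 2 of K and, by the choice of [m], has diameter below r / 4, so it stays where [f] is
   differentiable. *)
pose s := 2 * L1; pose eta := Num.min (r / 2) L1.
have s0 : 0 < s by rewrite mulr_gt0.
have eta0 : 0 < eta by rewrite lt_min L10 divr_gt0.
have r8 : 0 < r / 8 by rewrite divr_gt0.
have [m hm] := half_pow_lt (2 * s) r8.
pose N := (2 ^ m)%N; pose dl := 2 * s / 2 ^+ m.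
have dl0 : 0 < dl by rewrite divr_gt0 ?mulr_gt0 // exprn_gt0.
have dN : dl * N%:R = 2 * s.
  by rewrite /N natrX /dl mulfVK // expf_neq0 // pnatr_eq0.
have eta_s : eta <= s / 2 by rewrite ge_min /s; apply/orP; right; lra.
have K_s u : K u -> nm u <= s / 2 by move=> /KL; rewrite /s; lra.
pose t := node s dl.
have f_dif j k : selected s dl K eta j k ->
    forall w, rect (t j) (t j.+1) (t k) (t k.+1) w -> dif f w.
  move=> [u Ku [v hv uv]] w hw; apply: (hr _ Ku).
  have := rect_dist hw hv; rewrite /t !cell_square => h.
  have : eta <= r / 2 by rewrite ge_min lexx.
  have := nm_dist v w u; rewrite (nm_sub v u); move: hm; rewrite -/dl; lra.
(* Every edge with nonzero coefficient in the chain lies in this set. *)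
pose X w := rect (- s) s (- s) s w /\ forall u, K u -> eta <= nm (u - w).
have far_push z : (forall u, K u -> eta <= nm (u - z)) -> pushable K P z.
  move=> far; apply: push => Kz.
  by have := far _ Kz; rewrite subrr nm0; lra.
have ss : - s <= s by lra.
have [A [B [c [A0 B1 HD]]]] := kernel_approx_rect eta0 ss ss far_push.
have {HD} [D HD] := choice HD.
have X_far z : X z -> forall u, K u -> eta <= nm (u - z) by case.
have X_approx n z : X z -> exists2 Q : {poly C}, (size Q <= (c * n).+1)%N &
    forall u, K u -> nm ((z - u)^-1 - Q.[u] / (D n).[u]) <= A / B ^+ n.
  by have [_ _ H] := HD n; exact: H.
have tl j : t j <= t j.+1 by exact: node_le.
have tin j : (j <= N)%N -> - s <= t j <= s by exact: node_in.
have chain : approx D c A B (fun u => bdchain s dl N (chi s dl K eta)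
    (fun w => f w * (w - u)^-1)).
  rewrite /bdchain; apply: approxD.
    apply: (@approx_sum D c A B N (fun j u => \sum_(k < N.+1) dh N (chi s dl K eta) j k *
      hI (fun w => f w * (w - u)^-1) (t j) (t j.+1) (t k))) => j jN.
    apply: (@approx_sum D c A B N.+1 (fun k u => dh N (chi s dl K eta) j k *
      hI (fun w => f w * (w - u)^-1) (t j) (t j.+1) (t k))) => k kN.
    have [->|hd] := eqVneq (dh N (chi s dl K eta) j k) 0.
      by under eq_fun do rewrite mul0r; exact: approx0.
    apply: approxZ; rewrite /hI; apply: (cint_approx A0 B1 eta0 X_far X_approx) => //.
    move=> z hz; have [far dz] := dh_edge s0 dl0 dN eta_s K_s f_dif jN kN hd hz.
    split=> //; split=> //; have := tin _ (ltnW jN); have := tin _ jN; have := tin k kN => k1 k2 k3.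
    by case: hz => /andP[? ?] /andP[? ?]; split; lra.
  apply: (@approx_sum D c A B N (fun k u => \sum_(j < N.+1) dv N (chi s dl K eta) j k *
    vI (fun w => f w * (w - u)^-1) (t j) (t k) (t k.+1))) => k kN.
  apply: (@approx_sum D c A B N.+1 (fun j u => dv N (chi s dl K eta) j k *
    vI (fun w => f w * (w - u)^-1) (t j) (t k) (t k.+1))) => j jN.
  have [->|hd] := eqVneq (dv N (chi s dl K eta) j k) 0.
    by under eq_fun do rewrite mul0r; exact: approx0.
  apply: approxZ; rewrite /vI; apply: (cint_approx A0 B1 eta0 X_far X_approx) => //.
  move=> z hz; have [far dz] := dv_edge s0 dl0 dN eta_s K_s f_dif jN kN hd hz.
  split=> //; split=> //; have := tin _ (ltnW kN); have := tin _ kN; have := tin j jN => k1 k2 k3.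
  by case: hz => /andP[? ?] /andP[? ?]; split; lra.
pose W := outer s dl N (fun w => (w - 0)^-1).
have W0 : W != 0.
  rewrite -nm_gt0 /W; apply: (lt_le_trans _ (nm_outer_kernel_ge s0 dl0 dN _)) => //.
  by rewrite nm0 divr_ge0 // ltW.
have [E E0 HE] := approxZ W^-1 chain.
have fE u : K u -> W^-1 * bdchain s dl N (chi s dl K eta)
    (fun w => f w * (w - u)^-1) = f u.
  move=> Ku; have fu : dif f u by apply: (hr _ Ku); rewrite subrr nm0.
  rewrite -(grid_cauchy s0 dl0 dN eta0 eta_s K_s f_dif Ku fu).
  by rewrite (outer_kernel_const s0 dl0 dN (K_s _ Ku)) -/W mulrC mulfK.
have [B' B'1 hB'] := rate_root B1 (ltn0Sn c).
have B0 : 0 < B by exact: lt_trans B1.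
have B'0 : 0 < B' by exact: lt_trans B'1.
(* The approximant of index k = n / (c + 1) is used, with degree at most c k <= n; c + 1 replaces c
   because c may be 0. From n <= (c + 1) (k + 1) follows B'^n <= B^k B, which accounts for the
   factor B, and the 2 makes the constant exceed 1. *)
exists (E * A * B + 2), B'; split=> //.
  by rewrite ltr_wpDl ?ltr1n // !mulr_ge0 ?(ltW A0) ?(ltW B0).
move=> n; pose k := (n %/ c.+1)%N.
have ck : (c * k <= n)%N.
  by apply: leq_trans (leq_trunc_div n c.+1); rewrite mulnC leq_mul2l leqnSn orbT.
have [Dok sD _] := HD k; have [Q sQ HQ] := HE k.
exists Q, (D k); split; [exact: Dok | exact: leq_trans sQ _ | exact: leq_trans sD _ | ].
move=> u Ku; have := HQ u Ku; rewrite fE // => /le_trans; apply.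
have nk : (n <= c.+1 * k.+1)%N.
  by rewrite mulnS addnC mulnC [leqLHS](divn_eq n c.+1) leq_add2l ltnW // ltn_pmod.
have h1 : B' ^+ n <= B ^+ k * B.
  rewrite -exprSr; apply: le_trans (_ : _ <= B' ^+ (c.+1 * k.+1)) _.
    by rewrite ler_weXn2l // ltW.
  by rewrite exprM; apply: lerXn2r; rewrite ?nnegrE ?exprn_ge0 ?(ltW B'0) ?(ltW B0).
have Bk : 0 < B ^+ k by rewrite exprn_gt0.
have B'n : 0 < B' ^+ n by rewrite exprn_gt0.
rewrite mulrA ler_pdivlMr // mulrAC ler_pdivrMr //.
apply: le_trans (_ : _ <= E * A * (B ^+ k * B)) _.
  by apply: ler_wpM2l => //; rewrite mulr_ge0 // ltW.
rewrite mulrDl [B ^+ k * B]mulrC mulrA lerDl.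
by rewrite mulr_ge0 // ltW.
Qed.

End PlaneRungeTheorem.

(** * Rational maps and their degree *)

Section RationalMaps.
Variable R : realType.
Local Notation C := R[i].
Local Notation nm := (@ComplexField.Normc.normc R).
Implicit Types (p q g : {poly C}) (z v : C).

Lemma card_seq (T : pointedType) (rs : seq T) : uniq rs ->
  ([set x | x \in rs] #= `I_(size rs))%card.
Proof.
case: rs => [|x0 rs] ur.
  by rewrite (_ : [set x | _] = set0) ?II0 ?card_eqxx //; apply/seteqP; split.
apply/card_esym/card_set_bijP; exists (nth x0 (x0 :: rs)); split.
- by move=> i /= hi; exact: mem_nth.
- by move=> i j /=; rewrite !inE => hi hj /eqP; rewrite nth_uniq // => /eqP.
- move=> y hy; exists (index y (x0 :: rs)); last exact: nth_index.
  by have := index_mem y (x0 :: rs); rewrite hy => h; exact: h.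
Qed.

Lemma uniq_simple_roots (rs : seq C) :
  (forall x, x \in rs -> ~~ root (\prod_(z <- rs) ('X - z%:P))^`() x) -> uniq rs.
Proof.
elim: rs => [//|x rs IH] H /=.
have dE y : ((\prod_(z <- x :: rs) ('X - z%:P))^`()).[y] =
    (\prod_(z <- rs) ('X - z%:P)).[y] + (y - x) * ((\prod_(z <- rs) ('X - z%:P))^`()).[y].
  by rewrite big_cons derivM derivXsubC mul1r !hornerE.
apply/andP; split.
  apply/negP => xrs; have := H x (mem_head _ _); rewrite /root dE subrr mul0r addr0.
  by rewrite -/(root _ x) root_prod_XsubC xrs.
apply: IH => y yrs; apply/negP => dy.
have := H y; rewrite inE yrs orbT => /(_ isT); rewrite /root dE.
move: dy => /eqP ->; rewrite mulr0 addr0.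
by rewrite -/(root _ y) root_prod_XsubC yrs.
Qed.

Lemma fraction_preimage p q v : q != 0 -> coprimep p q ->
  fraction_map p q None <> Some v ->
  fraction_map p q @^-1` [set Some v] =
    [set x | exists2 z, x = Some z & root (p - v *: q) z].
Proof.
move=> q0 cpq nv; apply/seteqP; split => [[z|]|_ [z -> pz]] /=.
- case: eqP => // /eqP qz [<-]; exists z => //.
  by rewrite /root !hornerE divfK // subrr.
- by move=> /nv.
- case: eqP => [qz|/eqP qz].
    move: pz; rewrite /root !hornerE qz mulr0 subr0 => /eqP pz.
    by have := coprimep_root cpq; move/(_ z); rewrite /root pz qz eqxx => /(_ isT).
  congr Some; move: pz; rewrite /root !hornerE subr_eq0 => /eqP ->.
  by rewrite mulfK.
Qed.

(** This is the numerator of the derivative of p / q. If it were zero, coprimality would give q |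
    q', hence q' = 0 by degree, then p' = 0, and in characteristic zero both would be constant. *)
Lemma wronskian_neq0 p q : q != 0 -> coprimep p q ->
  (1 < maxn (size p) (size q))%N -> p^`() * q - p * q^`() != 0.
Proof.
move=> q0 cpq sz; apply/negP; rewrite subr_eq0 => /eqP E.
have small (f : {poly C}) : f^`() = 0 -> (size f <= 1)%N.
  move=> f0; rewrite leqNgt; apply/negP => sf.
  have := congr1 (fun h : {poly C} => h`_(size f).-2) f0.
  rewrite coef_deriv coef0 => /eqP; rewrite mulrn_eq0 /=.
  have -> : (size f).-2.+1 = (size f).-1 by move: sf; case: (size f) => [|[]].
  by rewrite -lead_coefE lead_coef_eq0 -size_poly_eq0; case: (size f) sf.
have dq : q %| q^`().
  have cqp : coprimep q p by rewrite coprimep_sym.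
  by rewrite -(Gauss_dvdpr _ cqp) -E dvdp_mull.
have q'0 : q^`() = 0.
  apply/eqP/negPn/negP => n0; have := dvdp_leq n0 dq.
  by rewrite leqNgt lt_size_deriv.
have p'0 : p^`() = 0.
  by move: E; rewrite q'0 mulr0 => /eqP; rewrite mulf_eq0 (negbTE q0) orbF => /eqP.
by move: sz; rewrite ltnNge geq_max !small.
Qed.

(** In the nonconstant case, infinity, the value at infinity and the critical values are excluded.
    For any other v the fibre is the set of roots of p - v q, a polynomial of full degree because v
    is not the value at infinity, with simple roots because p' q - p q' vanishes at a multiple
    one. *)
Lemma fraction_degree p q : q != 0 -> coprimep p q ->
  topological_degree (fraction_map p q) (maxn (size p) (size q)).-1.
Proof.
move=> q0 cpq.
have [small|large] := leqP (maxn (size p) (size q)) 1.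
  have -> : (maxn (size p) (size q)).-1 = 0%N by case: maxn small => [|[]].
  move: small; rewrite geq_max => /andP[sp sq].
  have [a pa] : exists a, p = a%:P by exists p`_0; exact: size1_polyC.
  have [b qb] : exists b, q = b%:P by exists q`_0; exact: size1_polyC.
  have b0 : b != 0 by move: q0; rewrite qb polyC_eq0.
  exists [set Some (a / b)]; split; first exact: finite_set1.
  move=> w nw; rewrite (_ : _ @^-1` _ = set0) ?II0 ?card_eqxx //.
  apply/seteqP; split => // x /= xw; apply: nw; rewrite /= -xw {xw}.
  case: x => [z|] /=; rewrite pa qb ?hornerC ?(negbTE b0) //.
  rewrite !size_polyC b0 lead_coefC coefC /=.
  by case: (a != 0).
pose n := maxn (size p) (size q).
pose W := p^`() * q - p * q^`().
have W0 : W != 0 by exact: wronskian_neq0.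
exists ([set fraction_map p q None; None] `|`
   (fun z => fraction_map p q (Some z)) @` [set z | root W z]); split.
  rewrite finite_setU; split; first by rewrite finite_setU; split; exact: finite_set1.
  apply: finite_image; have [rs Wrs] := closed_field_poly_normal W.
  apply: (sub_finite_set _ (finite_seq rs)) => z /=.
  by rewrite Wrs rootZ ?lead_coef_eq0 // root_prod_XsubC.
move=> w nE; have w1 : fraction_map p q None <> w by move=> e; apply: nE; left; left.
have w2 : w <> None by move=> e; apply: nE; left; right.
have w3 z : root W z -> fraction_map p q (Some z) <> w.
  by move=> Wz e; apply: nE; right; exists z.
case: w w1 w2 w3 {nE} => [v|//] w1 _ w3.
rewrite (fraction_preimage q0 cpq w1).
pose h := p - v *: q.
have sh : size h = n.
  have szv := size_scale_leq v q.
  have hp : (size h <= n)%N.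
    apply: leq_trans (size_polyD _ _) _; rewrite size_polyN /n geq_max leq_maxl /=.
    exact: leq_trans szv (leq_maxr _ _).
  (* If the degree dropped, the coefficients of p and v q at the top index n - 1 would agree: either
     p would lose its leading coefficient or v would be the value at infinity. *)
  apply/eqP; rewrite eqn_leq hp leqNgt; apply/negP => lt_hn; apply: w1 => /=.
  have n1 : n.-1.+1 = n by rewrite prednK // (ltn_trans _ large).
  have : h`_n.-1 = 0 by rewrite nth_default // -ltnS n1.
  rewrite coefB coefZ => /eqP; rewrite subr_eq0 => /eqP E.
  case: ltnP => [qp|pq].
    have nE : n = size p by apply/maxn_idPl/ltnW.
    move: E; rewrite [q`__]nth_default ?mulr0 => [|]; last by rewrite -ltnS n1 nE.
    rewrite nE -lead_coefE => /eqP; rewrite lead_coef_eq0 -size_poly_eq0.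
    by case: (size p) qp.
  have nE : n = size q by apply/maxn_idPr.
  move: E; rewrite nE -lead_coefE => ->.
  by rewrite mulfK // lead_coef_eq0.
have [rs hrs] := closed_field_poly_normal h.
have h0 : h != 0 by rewrite -size_poly_eq0 sh -lt0n (ltn_trans _ large).
have lh0 : lead_coef h != 0 by rewrite lead_coef_eq0.
have srs : size rs = n.-1.
  by move: sh; rewrite hrs size_scale // size_prod_XsubC => <-.
have rootsE z : root h z = (z \in rs) by rewrite hrs rootZ // root_prod_XsubC.
have urs : uniq rs.
  apply: uniq_simple_roots => z zrs; apply/negP => dz.
  have hz : h.[z] = 0 by apply/eqP; rewrite -/(root h z) rootsE.
  have h'z : h^`().[z] = 0.
    by rewrite hrs derivZ hornerZ (eqP dz) mulr0.
  move: hz h'z; rewrite /h derivB derivZ !hornerE => /eqP + /eqP.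
  rewrite !subr_eq0 => /eqP pz /eqP p'z.
  have qz : q.[z] != 0.
    apply/negP => /eqP qz; have := coprimep_root cpq.
    by move/(_ z); rewrite /root pz qz mulr0 eqxx => /(_ isT).
  apply: (w3 z) => /=; first by rewrite /root /W !hornerE pz p'z; apply/eqP; ring.
  by rewrite (negbTE qz) pz mulfK.
have := @card_seq (sphere R) [seq Some z | z <- rs].
rewrite map_inj_uniq; last by move=> a b [].
rewrite size_map srs => /(_ urs); congr (_ #= _)%card.
apply/seteqP; split => [_ /mapP[z zrs ->]|_ [z -> hz]] /=.
  by exists z => //; rewrite rootsE.
by apply: map_f; rewrite -rootsE.
Qed.

End RationalMaps.

(** * Topology and charts of the sphere *)

Section SphereTopology.
Variable R : realType.
Local Notation C := R[i].
Local Notation nm := (@ComplexField.Normc.normc R).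
Implicit Types (z w u : C) (A : set (sphere R)).

Lemma nbhs_cplxP (z : cplx R) (A : set (cplx R)) :
  nbhs z A <-> exists2 r : R, 0 < r & forall w : C, nm (w - z) < r -> A w.
Proof.
split=> [/nbhs_ballP[e /= e0 H]|[r r0 H]].
  (* The radius is an element of R[i]; being positive means that it is real and positive. *)
  move: e0; rewrite ltcE /= => /andP[/eqP ei er].
  exists (complex.Re e) => // w wz; apply: H; rewrite -ball_normE /ball_ /=.
  by rewrite distrC nm_normC ltcE /= ei eqxx.
apply/nbhs_ballP; exists r%:C%C; first by rewrite /= ltcE /= eqxx.
move=> w; rewrite -ball_normE /ball_ /= distrC nm_normC ltcR; exact: H.
Qed.

Lemma nbhs_SomeP (z : C) A :
  nbhs (Some z : sphere R) A <->
  exists2 r : R, 0 < r & forall w, nm (w - z) < r -> A (Some w).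
Proof. exact: (nbhs_cplxP z (fun w => A (Some w))). Qed.

Definition rect_set (L : R) : set (cplx R) := [set z | rect (- L) L (- L) L z].

Lemma rect_closed L : closed (rect_set L).
Proof.
rewrite -[X in closed X]setCK; apply: open_closedC.
rewrite openE => z nz; apply/nbhs_cplxP.
have [h1|h1] := ltP L `|complex.Re z|.
  exists (`|complex.Re z| - L); first by rewrite subr_gt0.
  move=> w wz [hw _]; have := nm_Re (w - z); rewrite ReB.
  have := lerB_dist (complex.Re z) (complex.Re w); rewrite (distrC (complex.Re z)).
  have : `|complex.Re w| <= L by rewrite ler_norml.
  lra.
have [h2|h2] := ltP L `|complex.Im z|.
  exists (`|complex.Im z| - L); first by rewrite subr_gt0.
  move=> w wz [_ hw]; have := nm_Im (w - z); rewrite ImB.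
  have := lerB_dist (complex.Im z) (complex.Im w); rewrite (distrC (complex.Im z)).
  have : `|complex.Im w| <= L by rewrite ler_norml.
  lra.
by exfalso; apply: nz; split; rewrite -ler_norml.
Qed.

(** If [F] had no cluster point, it would contain the complement of every small rectangle, and
    intersecting four complements passes from the quadrants to the rectangle. *)
Lemma rect_compact L : 0 <= L -> compact (rect_set L).
Proof.
move=> L0 F PF FL; apply: contrapT => nocl.
suff H : F (~` rect_set L).
  have : F set0 by rewrite -(setICr (rect_set L)); exact: filterI.
  exact: filter_not_empty.
pose Pr x0 x1 y0 y1 := F [set z : cplx R | ~ rect x0 x1 y0 y1 z].
suff : Pr (- L) L (- L) L by [].
apply: cousin; [lra | lra | | ].
  move=> x0 x1 y0 y1 hx hy /= h1 h2 h3 h4.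
  apply: filterS (filterI (filterI h1 h2) (filterI h3 h4)) => z.
  move=> [[k1 k2] [k3 k4]] [/andP[l1 l2] /andP[l3 l4]].
  have [k5|k5] := leP (complex.Re z) ((x0 + x1) / 2);
    have [k6|k6] := leP (complex.Im z) ((y0 + y1) / 2).
  - by apply: k1; split; lra.
  - by apply: k3; split; lra.
  - by apply: k2; split; lra.
  - by apply: k4; split; lra.
move=> x y hx hy.
have : ~ cluster F ((x +i* y)%C : cplx R).
  by move=> cz; apply: nocl; exists (x +i* y)%C.
rewrite /cluster /= => /existsNP[A /existsNP[B /not_implyP[FA /not_implyP[/nbhs_cplxP[r r0 hr] AB]]]].
exists (r / 2); first lra.
move=> x0 x1 y0 y1 hx' hy' _ _ _ _ l1 l2.
apply: filterS FA => z Az hz; apply: AB; exists z; split => //; apply: hr.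
by have := rect_dist hz (conj hx' hy' : rect _ _ _ _ (x +i* y)%C); lra.
Qed.

Lemma compact_nm_bounded (U : set (cplx R)) : compact U ->
  exists L : R, forall z, U z -> nm z <= L.
Proof.
move=> cU; apply: contrapT => nb.
pose B (n : nat) : set (cplx R) := [set z | U z /\ n%:R < nm z].
have B0 n : B n !=set0.
  apply: contrapT => nB; apply: nb; exists n%:R => z Uz.
  by rewrite leNgt; apply/negP => h; apply: nB; exists z.
have PF : ProperFilter (filter_from setT B).
  apply: filter_from_proper => //; apply: filter_from_filter; first by exists 0%N.
  move=> i j _ _; exists (maxn i j) => // z [Uz hz].
  by split; split=> //; apply: le_lt_trans hz; rewrite ler_nat ?leq_maxl ?leq_maxr.
have [|z [Uz cz]] := cU _ PF; first by exists 0%N => // z [].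
pose n := Num.bound (nm z + 1).
have hn : nm z + 1 < n%:R by apply: archi_boundP; rewrite addr_ge0 ?nm_ge0.
have [w [[_ hw] wz]] : (B n `&` [set w | nm (w - z) < 1]) !=set0.
  apply: cz; first by exists n.
  by apply/nbhs_cplxP; exists 1.
by move: wz => /=; have := nm_lower w z; lra.
Qed.

Lemma nbhs_NoneP A :
  nbhs (None : sphere R) A <->
  A None /\ exists L : R, forall w, L < nm w -> A (Some w).
Proof.
split=> [[U [cU _] UA]|[A0 [L HL]]].
  split; first by apply: UA; right.
  have [L HL] := compact_nm_bounded cU; exists L => w Lw; apply: UA; left.
  by exists w => // /HL; rewrite leNgt Lw.
exists (rect_set `|L|).
  by split; [exact: rect_compact | exact: rect_closed].
move=> _ [[w nw <-]|-> //]; apply: HL; apply: contrapT => /negP; rewrite -leNgt => h.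
apply: nw; have := ler_norm L; have := nm_Re w; have := nm_Im w => h1 h2 h3.
by split; rewrite -ler_norml; lra.
Qed.

Lemma derivable_dif (f : cplx R -> cplx R) z : derivable f z 1 -> dif f z.
Proof.
move=> /cvg_ex[/= l /cvgrPdist_le H]; exists l => e e0.
have e0' : 0 < e%:C%C :> C by rewrite ltcE /= eqxx.
have /nbhs_ballP[d /= d0 hd] : nbhs (0 : cplx R) (fun h => h != 0 ->
  `|l - h^-1 *: (f (h *: (1 : cplx R) + z) - f z)| <= e%:C%C) by exact: H e0'.
move: d0; rewrite ltcE /= => /andP[/eqP di dr].
exists (complex.Re d) => // w wz.
have [->|wz0] := eqVneq w z; first by rewrite !subrr mulr0 subrr nm0 mulr0.
have wz1 : w - z != 0 by rewrite subr_eq0.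
have := hd (w - z); rewrite -ball_normE /ball_ /= sub0r normrN nm_normC ltcE /= di eqxx.
move=> /(_ wz wz1); rewrite /shift /= nm_normC lecR.
have -> : (w - z)%:A + z = w :> C by rewrite /GRing.scale /= mulr1 subrK.
move=> h; rewrite (_ : f w - f z - l * (w - z) = - ((w - z) * (l - (w - z)^-1 * (f w - f z)))).
  by rewrite nmN nmM mulrC; apply: ler_wpM2r; [exact: nm_ge0 | exact: h].
by field.
Qed.

Lemma dif_comp (f h : C -> C) z : dif h z -> dif f (h z) -> dif (fun w => f (h w)) z.
Proof.
move=> dh [l hl]; have ch := dif_cont dh; move: dh => [m hm].
exists (l * m) => e e0.
have k0 : 0 < nm l + nm m + 2 by have := nm_ge0 l; have := nm_ge0 m; lra.
have d0 : 0 < Num.min 1 (e / (nm l + nm m + 2)) by rewrite lt_min ltr01 divr_gt0.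
have [a a0 ha] := hl _ d0; have [b b0 hb] := hm _ d0.
have a2 : 0 < a / 2 by rewrite divr_gt0.
have [c c0 hc] := ch _ a2.
exists (Num.min b c); first by rewrite lt_min b0.
move=> w; rewrite lt_min => /andP[/hb h1 /hc h2].
have /ha : nm (h w - h z) < a by lra.
move: d0 h1; set d := Num.min _ _ => d0 h1 h3.
have d1 : d <= 1 by rewrite ge_min lexx.
have d2 : d * (nm l + nm m + 2) <= e by rewrite -ler_pdivlMr // ge_min lexx orbT.
set p := h w - h z in h1 h2 h3 *; set x := w - z in h1 *.
have -> : f (h w) - f (h z) - l * m * x = (f (h w) - f (h z) - l * p) + l * (p - m * x) by ring.
apply: le_trans (nmD _ _) _; rewrite nmM.
have np : nm p <= (nm m + 1) * nm x.
  have := nmD (p - m * x) (m * x); rewrite subrK nmM => h4.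
  have := ler_wpM2r (nm_ge0 x) d1; lra.
have k1 := ler_wpM2l (nm_ge0 l) h1.
have k2 := ler_wpM2l (ltW d0) np.
have k3 := ler_wpM2r (nm_ge0 x) d2.
have k4 : 0 <= d * nm x by rewrite mulr_ge0 ?nm_ge0 // ltW.
lra.
Qed.

Lemma dif_near (f h : C -> C) z r : 0 < r -> (forall w, nm (w - z) < r -> f w = h w) ->
  dif f z -> dif h z.
Proof.
move=> r0 H [l hl]; exists l => e /hl[d d0 hd]; exists (Num.min d r).
  by rewrite lt_min d0.
move=> w; rewrite lt_min => /andP[/hd + /H <-].
by rewrite -(H z) // subrr nm0.
Qed.

(** This is what makes the compact set K closed. *)
Lemma sphere_hausdorff : hausdorff_space (sphere R).
Proof.
have far (z : C) : exists A B, [/\ nbhs (Some z : sphere R) A,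
    nbhs (None : sphere R) B & ~ (A `&` B !=set0)].
  exists [set x | if x is Some w then nm (w - z) < 1 else False].
  exists [set x | if x is Some w then nm z + 1 < nm w else True]; split.
  - by apply/nbhs_SomeP; exists 1.
  - by apply/nbhs_NoneP; split => //; exists (nm z + 1).
  - by move=> [[w|] [] //=]; have := nm_lower w z; lra.
move=> [z|] [w|] // cl.
- have [->//|zw] := eqVneq z w.
  have zw0 : 0 < nm (w - z) by rewrite nm_gt0 subr_eq0 eq_sym.
  have zw2 : 0 < nm (w - z) / 2 by rewrite divr_gt0.
  have [||[v|] []] := cl [set x | if x is Some v then nm (v - z) < nm (w - z) / 2 else False]
    [set x | if x is Some v then nm (v - w) < nm (w - z) / 2 else False].
  + by apply/nbhs_SomeP; exists (nm (w - z) / 2).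
  + by apply/nbhs_SomeP; exists (nm (w - z) / 2).
  + by move=> /= h1 h2; exfalso; have := nm_dist v w z; rewrite (nm_sub w v); lra.
  + by [].
- by have [A [B [hA hB AB]]] := far z; case: AB; exact: cl.
- by have [A [B [hA hB AB]]] := far w; case: AB; rewrite setIC; exact: cl.
Qed.

End SphereTopology.

(** * Rational maps from arbitrary fractions, and reversal of polynomials *)

Section Realization.
Variable R : realType.
Local Notation C := R[i].
Local Notation nm := (@ComplexField.Normc.normc R).
Implicit Types (N D : {poly C}) (z u c : C).

(** N and D are read as forms of degree n, so the coefficients of index n describe the point at
    infinity. Cancelling the gcd may remove poles but creates none. *)
Lemma fraction_realize N D n : D != 0 -> (size N <= n.+1)%N -> (size D <= n.+1)%N ->
  exists r : sphere R -> sphere R,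
    [/\ rational_map r, (exists2 d, topological_degree r d & (d <= n)%N),
      (forall z, r (Some z) = None -> D.[z] = 0) /\ (r None = None -> D`_n = 0),
      (forall z, D.[z] != 0 -> r (Some z) = Some (N.[z] / D.[z] : cplx R)) &
      (D`_n != 0 -> r None = Some (N`_n / D`_n : cplx R))].
Proof.
move=> D0 sN sD.
pose g := gcdp N D; pose p := N %/ g; pose q := D %/ g.
have g0 : g != 0 by rewrite gcdp_eq0 (negbTE D0) andbF.
have NE : N = p * g by rewrite divpK // dvdp_gcdl.
have DE : D = q * g by rewrite divpK // dvdp_gcdr.
have q0 : q != 0 by apply: contraNneq D0 => q0; rewrite DE q0 mul0r.
have cpq : coprimep p q by apply: coprimep_div_gcd; rewrite D0 orbT.
have sg : (0 < size g)%N by rewrite lt0n size_poly_eq0.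
have sq : (0 < size q)%N by rewrite lt0n size_poly_eq0.
have sDE : size D = (size q + size g).-1 by rewrite DE size_mul.
have spn : (size p <= n.+1)%N.
  have [->|p0] := eqVneq p 0; first by rewrite size_poly0.
  by apply: leq_trans sN; rewrite NE size_mul //; move: sg; case: (size g) => // k _; rewrite addnS leq_addr.
have sqn : (size q <= n.+1)%N.
  by apply: leq_trans sD; rewrite sDE; move: sg; case: (size g) => // k _; rewrite addnS leq_addr.
have top : D`_n != 0 -> size D = n.+1.
  move=> Dn; apply/eqP; rewrite eqn_leq sD ltnNge; apply/negP => h.
  by move: Dn; rewrite nth_default ?eqxx.
exists (fraction_map p q); split.
- by exists p, q.
- exists (maxn (size p) (size q)).-1; first exact: fraction_degree.
  by rewrite -ltnS prednK ?geq_max ?spn // leq_max sq orbT.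
- split=> [z|] /=.
    by case: eqP => // qz _; rewrite DE hornerM qz mul0r.
  case: ltnP => // qp _; apply/eqP/negPn/negP => /top sDn.
  have p0 : p != 0 by rewrite -size_poly_gt0 (leq_ltn_trans _ qp).
  move: sN; rewrite NE size_mul // -sDn sDE leqNgt => /negP; apply.
  by move: sg; case: (size g) => // k _; rewrite !addnS /= ltn_add2r.
- move=> z; rewrite DE NE !hornerM mulf_eq0 negb_or => /andP[qz gz] /=.
  by rewrite (negbTE qz) -mulf_div divff // mulr1.
- move=> Dn; have sDn := top Dn.
  (* N - v D has degree below n, so after division by the gcd p - v q has smaller degree than q: v
     is the value of p / q at infinity. *)
  pose v := N`_n / D`_n; pose h := p - v *: q.
  have hg : h * g = N - v *: D by rewrite NE DE mulrBl scalerAl.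
  have hgn : (size (h * g)%R <= n)%N.
    have le : (size (h * g)%R <= n.+1)%N.
      rewrite hg; apply: leq_trans (size_polyD _ _) _.
      by rewrite size_polyN geq_max sN (leq_trans (size_scale_leq _ _)).
    move: le; rewrite leq_eqVlt => /orP[/eqP sE|//].
    have : lead_coef (h * g) = 0 by rewrite lead_coefE sE hg /= !coefE /v divfK // subrr.
    by move=> /eqP; rewrite lead_coef_eq0 -size_poly_eq0 sE.
  have hq : (size h < size q)%N.
    have [->|h0] := eqVneq h 0; first by rewrite size_poly0.
    move: hgn; rewrite -ltnS -sDn sDE size_mul //.
    by move: sg; case: (size g) => // k _; rewrite !addnS /= ltn_add2r.
  have hcoef k : ((size q).-1 <= k)%N -> p`_k = v * q`_k.
    move=> hk; have : h`_k = 0.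
      by rewrite nth_default // (leq_trans _ hk) // -ltnS prednK.
    by rewrite coefB coefZ => /eqP; rewrite subr_eq0 => /eqP.
  have pq : (size p <= size q)%N.
    apply/leq_sizeP => k hk; rewrite hcoef ?(leq_trans (leq_pred _)) //.
    by rewrite nth_default ?mulr0.
  rewrite /= ltnNge pq /= hcoef // -lead_coefE mulfK // lead_coef_eq0 //.
Qed.

(* The polynomial (z - c) ^ n N (1 / (z - c)) of z. *)
Definition reverse_at c n N : {poly C} :=
  (\poly_(i < n.+1) N`_(n - i)) \Po ('X - c%:P).

Lemma size_reverse_at c n N : (size (reverse_at c n N) <= n.+1)%N.
Proof. by rewrite /reverse_at size_comp_poly2 ?size_XsubC ?size_poly. Qed.

Lemma horner_reverse_at c n N z : (size N <= n.+1)%N -> z != c ->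
  (reverse_at c n N).[z] = (z - c) ^+ n * N.[(z - c)^-1].
Proof.
move=> sN zc; have x0 : z - c != 0 by rewrite subr_eq0.
rewrite /reverse_at horner_comp !hornerE horner_poly (horner_coef_wide _ sN).
rewrite mulr_sumr (reindex_inj rev_ord_inj) /=; apply: eq_bigr => i _.
have iE : (n - (n.+1 - i.+1) = i)%N by rewrite subSS subKn // -ltnS.
rewrite iE subSS mulrCA; congr (_ * _); rewrite exprVn.
have -> : (z - c) ^+ n = (z - c) ^+ (n - i) * (z - c) ^+ i.
  by rewrite -exprD subnK // -ltnS.
by rewrite mulfK // expf_neq0.
Qed.

Lemma reverse_at_neq0 c n N : (size N <= n.+1)%N -> N != 0 -> reverse_at c n N != 0.
Proof.
move=> sN N0; rewrite comp_poly2_eq0 ?size_XsubC //.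
apply: contraNneq N0 => H; apply/eqP/polyP => i; rewrite coef0.
have [ni|iN] := leqP n.+1 i; first by rewrite nth_default // (leq_trans sN).
have := congr1 (fun p : {poly C} => p`_(n - i)) H.
by rewrite coef_poly coef0 ltnS leq_subr subKn.
Qed.

(** The point z = infinity corresponds to 1 / (z - c) = 0, so the top coefficient has to be the
    value of N at 0. *)
Lemma coef_reverse_at c n N : (reverse_at c n N)`_n = N`_0.
Proof.
rewrite /reverse_at; set p := \poly_(i < n.+1) _.
have pE : p = p`_n *: 'X^n + \poly_(i < n) p`_i.
  apply/polyP => i; rewrite coefD coefZ coefXn !coef_poly.
  have [->|ni] := eqVneq i n; first by rewrite ltnn ltnSn mulr1 addr0.
  by rewrite mulr0 add0r ltnS leq_eqVlt (negbTE ni) /=; case: ltnP.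
rewrite pE comp_polyD comp_polyZ coefD coefZ comp_Xn_poly.
have -> : (('X - c%:P) ^+ n)`_n = 1.
  have := monicP (monic_exp n (monicXsubC c)).
  by rewrite lead_coefE size_exp_XsubC.
rewrite mulr1 [X in _ + X]nth_default ?addr0; last first.
  by rewrite size_comp_poly2 ?size_XsubC ?size_poly.
by rewrite coef_poly ltnSn subnn.
Qed.

End Realization.

(** * Coordinates that send a given point to infinity *)

Section Charts.
Variable R : realType.
Local Notation C := R[i].
Local Notation nm := (@ComplexField.Normc.normc R).
Implicit Types (z u w c : C) (A : set (sphere R)) (f : sphere R -> cplx R).

(* A coordinate [phi] on the sphere minus [p0], in which [p0] plays the part of
   the point at infinity. *)
Record chart_at (p0 : sphere R) (phi : C -> sphere R) : Prop := ChartAt {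
  chart_inj : injective phi;
  chart_neq : forall u, phi u <> p0;
  chart_onto : forall x, x <> p0 -> exists u, x = phi u;
  chart_nbhs : forall u A, nbhs (phi u) A <->
    exists2 r : R, 0 < r & forall w, nm (w - u) < r -> A (phi w);
  chart_nbhs_infty : forall A, nbhs p0 A <->
    A p0 /\ exists L : R, forall w, L < nm w -> A (phi w);
  chart_dif : forall f u, complex_differentiable_at f (phi u) ->
    dif (fun w => f (phi w)) u;
  chart_realize : forall (N D : {poly C}) n,
    D != 0 -> (size N <= n.+1)%N -> (size D <= n.+1)%N ->
    exists r : sphere R -> sphere R,
      [/\ rational_map r, (exists2 d, topological_degree r d & (d <= n)%N),
        forall u, r (phi u) = None -> D.[u] = 0 &
        forall u, D.[u] != 0 -> r (phi u) = Some (N.[u] / D.[u] : cplx R)] }.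

Lemma chart_at_None : chart_at None (fun u => Some (u : cplx R)).
Proof.
split.
- by move=> u v [].
- by [].
- by case=> [z _|//]; exists z.
- exact: nbhs_SomeP.
- exact: nbhs_NoneP.
- by move=> f u; exact: derivable_dif.
- move=> N D n D0 sN sD; have [r [r1 r2 [r3 _] r4 _]] := fraction_realize D0 sN sD.
  by exists r.
Qed.

(** The inverse of z |-> 1 / (z - c): the coordinate 0 belongs to the point at infinity, and c has
    none. *)
Definition inversion c u : sphere R :=
  if u == 0 then None else Some (c + u^-1 : cplx R).

Lemma inv_close z (e : R) : z != 0 -> 0 < e ->
  exists2 d, 0 < d & forall w, nm (w - z) < d -> w != 0 /\ nm (w^-1 - z^-1) < e.
Proof.
move=> z0 e0; have e2 : 0 < e / 2 by rewrite divr_gt0.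
have [d d0 hd] := cauchy_kernel_cont z0 e2.
exists (Num.min d (nm z)); first by rewrite lt_min d0 nm_gt0.
move=> w; rewrite lt_min => /andP[/hd + wz]; rewrite !subr0 => h.
split; last lra.
by apply: contraTneq wz => ->; rewrite sub0r nmN ltxx.
Qed.

Lemma inversion_neq0 c u : u != 0 -> inversion c u = Some (c + u^-1 : cplx R).
Proof. by rewrite /inversion => /negbTE ->. Qed.

Lemma inversion_inv c z : z != c -> inversion c (z - c)^-1 = Some (z : cplx R).
Proof.
move=> zc; rewrite inversion_neq0 ?invr_neq0 ?subr_eq0 //.
by rewrite invrK addrC subrK.
Qed.

Lemma dif_affine (a b : C) z : dif (fun w => a * w + b) z.
Proof.
exists a => e e0; exists 1 => // w _.
have -> : a * w + b - (a * z + b) - a * (w - z) = 0 by ring.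
by rewrite nm0 mulr_ge0 ?nm_ge0 // ltW.
Qed.

Lemma dif_inv z : z != 0 -> dif (fun w => w^-1) z.
Proof.
move=> z0; apply: (@dif_near _ (fun w => (w - 0)^-1) _ _ 1) => //.
  by move=> w _; rewrite subr0.
exact: cauchy_kernel_dif.
Qed.

(** At u = 0 differentiability is stated in the chart 1 / w at infinity. Since c + 1 / w = 1 / k w
    with k w = w / (c w + 1), the map k is the change of chart; c w + 1 is nonzero for |w| < 1 /
    (|c| + 1). *)
Lemma inversion_dif c f u : complex_differentiable_at f (inversion c u) ->
  dif (fun w => f (inversion c w)) u.
Proof.
have [->|u0] := eqVneq u 0.
  rewrite /inversion eqxx => /derivable_dif df.
  pose k w := w * (c * w + 1)^-1.
  have k0 : k 0 = 0 by rewrite /k mul0r.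
  have dk : dif k 0.
    apply: difM.
      apply: (@dif_near _ (fun w => 1 * w + 0) _ _ 1) => //; last exact: dif_affine.
      by move=> w _; rewrite mul1r addr0.
    apply: (@dif_comp _ (fun w => w^-1) (fun w => c * w + 1)); first exact: dif_affine.
    by apply: dif_inv; rewrite mulr0 add0r oner_eq0.
  have := @dif_comp _ (fun w => f (chart_infty w)) k 0 dk; rewrite k0 => /(_ df).
  have c1 : 0 < nm c + 1 by rewrite ltr_wpDl ?nm_ge0.
  apply: (@dif_near _ _ _ _ (nm c + 1)^-1); first by rewrite invr_gt0.
  move=> w; rewrite subr0 -div1r ltr_pdivlMr // => hw.
  have cw : c * w + 1 != 0.
    rewrite -nm_gt0; have := nm_lower 1 (- (c * w)).
    rewrite opprK nm1 nmN nmM [1 + c * w]addrC; have := nm_ge0 w; lra.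
  rewrite /chart_infty; have [->|w0] := eqVneq w 0; first by rewrite k0 eqxx.
  rewrite /k mulf_eq0 invr_eq0 (negbTE w0) (negbTE cw) /=.
  by congr (f (Some _)); field; rewrite w0 cw.
rewrite inversion_neq0 // => /derivable_dif df.
have dh : dif (fun w => c + w^-1) u.
  have [l hl] := dif_inv u0; exists l => e /hl[d d0 hd]; exists d => // w /hd.
  by rewrite (_ : c + w^-1 - (c + u^-1) = w^-1 - u^-1) //; ring.
apply: (@dif_near _ _ _ _ (nm u) _ _ (dif_comp dh df)) => [|w]; first by rewrite nm_gt0.
move=> wu; rewrite inversion_neq0 //.
by apply: contraTneq wu => ->; rewrite sub0r nmN ltxx.
Qed.

Lemma inversion_nbhs c u A : nbhs (inversion c u) A <->
  exists2 r : R, 0 < r & forall w, nm (w - u) < r -> A (inversion c w).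
Proof.
have [->|u0] := eqVneq u 0.
  rewrite {1}/inversion eqxx; split.
    move=> /nbhs_NoneP[A0 [L HL]].
    have c1 : 0 < `|L| + nm c + 1 by rewrite ltr_wpDl // addr_ge0 ?nm_ge0.
    exists (`|L| + nm c + 1)^-1; first by rewrite invr_gt0.
    move=> w; rewrite subr0 /inversion; have [//|w0] := eqVneq w 0.
    have nw : 0 < nm w by rewrite nm_gt0.
    rewrite -[X in X < _]invrK ltf_pV2 ?posrE ?invr_gt0 // -nmV => h.
    apply: HL; have := ler_norm L; have := nm_lower w^-1 (- c).
    by rewrite opprK nmN [w^-1 + c]addrC; lra.
  move=> [r r0 hr]; apply/nbhs_NoneP; split.
    by have := hr 0; rewrite subrr nm0 /inversion eqxx; exact.
  exists (nm c + r^-1) => z hz.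
  have hx : r^-1 < nm (z - c) by have := nm_lower z c; lra.
  have ri : 0 < r^-1 by rewrite invr_gt0.
  have xn : 0 < nm (z - c) by lra.
  have zc : z != c by rewrite -subr_eq0 -nm_gt0.
  rewrite -(inversion_inv zc); apply: hr; rewrite subr0 nmV.
  by rewrite -[ltRHS]invrK ltf_pV2 ?posrE.
rewrite {1}inversion_neq0 //; split.
  move=> /nbhs_SomeP[r r0 hr]; have [d d0 hd] := inv_close u0 r0.
  exists d => // w /hd[w0 hw]; rewrite inversion_neq0 //; apply: hr.
  by rewrite (_ : c + w^-1 - _ = w^-1 - u^-1) //; ring.
move=> [r r0 hr]; apply/nbhs_SomeP.
have v0 : u^-1 != 0 by rewrite invr_neq0.
have [d d0 hd] := inv_close v0 r0; exists d => // z hz.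
have [|x0 hx] := hd (z - c); first by rewrite (_ : z - c - _ = z - (c + u^-1)) //; ring.
have zc : z != c by rewrite -subr_eq0.
by rewrite -(inversion_inv zc); apply: hr; rewrite invrK in hx.
Qed.

Lemma inversion_nbhs_infty c A : nbhs (Some (c : cplx R) : sphere R) A <->
  A (Some (c : cplx R)) /\ exists L : R, forall w, L < nm w -> A (inversion c w).
Proof.
split.
  move=> /nbhs_SomeP[r r0 hr]; split; first by apply: hr; rewrite subrr nm0.
  have ri : 0 < r^-1 by rewrite invr_gt0.
  exists r^-1 => w hw; have nw : 0 < nm w by lra.
  rewrite inversion_neq0 -?nm_gt0 //; apply: hr.
  by rewrite addrAC subrr add0r nmV -[ltRHS]invrK ltf_pV2 ?posrE.
move=> [A0 [L HL]]; apply/nbhs_SomeP.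
have c1 : 0 < `|L| + 1 by rewrite ltr_wpDl.
exists (`|L| + 1)^-1; first by rewrite invr_gt0.
move=> z hz; have [->//|zc] := eqVneq z c.
rewrite -(inversion_inv zc); apply: HL; rewrite nmV.
have n0 : 0 < nm (z - c) by rewrite nm_gt0 subr_eq0.
apply: (@lt_trans _ _ (`|L| + 1)); first by have := ler_norm L; lra.
by rewrite -[ltLHS]invrK ltf_pV2 ?posrE // invr_gt0.
Qed.

(** Reversal at c multiplies numerator and denominator by the same power of z - c, which cancels at
    z = c + 1 / u. At u = 0 the coefficients of index n take over. *)
Lemma inversion_realize c (N D : {poly C}) n :
  D != 0 -> (size N <= n.+1)%N -> (size D <= n.+1)%N ->
  exists r : sphere R -> sphere R,
    [/\ rational_map r, (exists2 d, topological_degree r d & (d <= n)%N),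
      forall u, r (inversion c u) = None -> D.[u] = 0 &
      forall u, D.[u] != 0 -> r (inversion c u) = Some (N.[u] / D.[u] : cplx R)].
Proof.
move=> D0 sN sD.
have [r [r1 r2 [r3 r4] r5 r6]] := fraction_realize (reverse_at_neq0 c sD D0)
  (size_reverse_at c n N) (size_reverse_at c n D).
have neq u : u != 0 -> c + u^-1 != c by move=> u0; rewrite -subr_eq0 addrAC subrr add0r invr_neq0.
have val u (M : {poly C}) : (size M <= n.+1)%N -> u != 0 ->
    (reverse_at c n M).[c + u^-1] = u^-1 ^+ n * M.[u].
  move=> sM u0; rewrite horner_reverse_at ?neq // addrAC subrr add0r invrK //.
have un u : u != 0 -> u^-1 ^+ n != 0 by move=> u0; rewrite expf_neq0 // invr_neq0.
exists r; split=> // u.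
  rewrite /inversion; have [->|u0] := eqVneq u 0.
    by move=> /r4; rewrite coef_reverse_at -horner_coef0.
  by move=> /r3; rewrite val // => /eqP; rewrite mulf_eq0 (negbTE (un _ u0)) => /eqP.
move=> Du; rewrite /inversion; have [e|u0] := eqVneq u 0.
  by move: Du; rewrite e !horner_coef0 -(coef_reverse_at c n N) -(coef_reverse_at c n D) => /r6.
rewrite r5 !val ?mulf_neq0 ?un // -mulf_div divff ?mul1r // un //.
Qed.

Lemma chart_at_Some c : chart_at (Some (c : cplx R)) (inversion c).
Proof.
split.
- move=> u v; rewrite /inversion; have [->|u0] := eqVneq u 0.
    by have [->|] := eqVneq v 0.
  have [//|v0] := eqVneq v 0.
  by move=> [] /addrI /invr_inj.
- move=> u; rewrite /inversion; have [//|u0] := eqVneq u 0.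
  move=> [] /eqP; rewrite -subr_eq0 addrAC subrr add0r invr_eq0.
  by rewrite (negbTE u0).
- case=> [z zc|_]; last by exists 0; rewrite /inversion eqxx.
  exists (z - c)^-1; rewrite inversion_inv //.
  by apply/eqP => e; apply: zc; rewrite e.
- exact: inversion_nbhs.
- exact: inversion_nbhs_infty.
- by move=> f u; exact: inversion_dif.
- exact: inversion_realize.
Qed.

Lemma exists_chart p0 : exists phi, chart_at p0 phi.
Proof.
case: p0 => [c|]; first by exists (inversion c); exact: chart_at_Some.
by exists (fun u => Some (u : cplx R)); exact: chart_at_None.
Qed.

End Charts.

(** * Runge's theorem on the sphere *)

Section Liouville.
Variable R : realType.
Local Notation C := R[i].
Local Notation nm := (@ComplexField.Normc.normc R).
Implicit Types (z u w : C).

(** Cauchy's formula on a grid with a single cell, taken at z and at 0: the difference of the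
    integrands is F w z / ((w - z) w), at most 2 M |z| / s^2 on a contour of length 8 s. Division by
    |W| >= 4 leaves 4 M |z| / s. *)
Lemma liouville (F : C -> C) (M : R) : (forall z, dif F z) ->
  (forall z, nm (F z) <= M) -> forall z, F z = F 0.
Proof.
move=> dF FM z; apply/subr0_eq/small_eq0 => e e0.
have M0 : 0 <= M := le_trans (nm_ge0 _) (FM 0).
have z0 := nm_ge0 z.
(* The first term puts [z] in the disc of radius s / 2, the second brings 4 M |z| / s below [e], and
   the 1 keeps [s] positive. *)
pose s := 2 * nm z + 4 * M * nm z / e + 1.
have Me : 0 <= 4 * M * nm z / e by rewrite divr_ge0 ?mulr_ge0 // ltW.
have s0 : 0 < s by rewrite /s; lra.
have d0 : 0 < 2 * s by rewrite mulr_gt0.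
have dN : 2 * s * 1%:R = 2 * s by rewrite mulr1.
pose K u := u = z \/ u = 0.
have K_s u : K u -> nm u <= s / 2.
  by case=> ->; rewrite ?nm0 ?divr_ge0 // ?(ltW s0) // /s; lra.
have eta0 : 0 < s / 2 by rewrite divr_gt0.
have Kz : K z by left. have K0 : K 0 by right.
have sel : selected s (2 * s) K (s / 2) 0 0.
  exists z => //; exists z; last by rewrite subrr nm0.
  have := node0 s (2 * s); have := nodeN dN => -> ->.
  have := K_s z Kz; have := nm_Re z; have := nm_Im z => h1 h2 h3.
  by split; rewrite -ler_norml; lra.
have chainE g : bdchain s (2 * s) 1 (chi s (2 * s) K (s / 2)) g = outer s (2 * s) 1 g.
  rewrite -bdchainE -sum_cell !big_ord1.
  by rewrite /chi; case: asboolP => // _; rewrite mul1r.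
have key u : K u -> F u * outer s (2 * s) 1 (fun w => (w - 0)^-1) =
    outer s (2 * s) 1 (fun w => F w * (w - u)^-1).
  move=> Ku; rewrite -[RHS]chainE -(grid_cauchy s0 d0 dN eta0 (lexx _) K_s) //.
  by rewrite (outer_kernel_const s0 d0 dN (K_s _ Ku)).
set W := outer s (2 * s) 1 (fun w => (w - 0)^-1) in key.
have W4 : 4 <= nm W.
  by apply: (nm_outer_kernel_ge s0 d0 dN); rewrite nm0 ltW.
have ck u w : K u -> frame s w -> cont_at (fun w => F w * (w - u)^-1) w.
  move=> Ku hw; apply: cont_atM; first exact: dif_cont.
  by apply: cauchy_kernel_cont; exact: frame_neq (K_s _ Ku) hw.
have E : (F z - F 0) * W = outer s (2 * s) 1
    (fun w => (-1) * (F w * (w - 0)^-1) + F w * (w - z)^-1).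
  rewrite (outer_lin s0 d0 dN) -?key //; first by ring.
  - by move=> w; exact: ck.
  - by move=> w; exact: ck.
have B : nm ((F z - F 0) * W) <= M * nm z * (2 / s ^+ 2) * (8 * s).
  rewrite E; apply: (outer_bound s0 d0 dN) => w hw.
    apply: cont_atD; last exact: ck.
    by apply: cont_atM; [exact: cont_cst | exact: ck].
  have wz := frame_neq s0 (K_s _ Kz) hw; have w0 := frame_neq s0 (K_s _ K0) hw.
  have wz1 : w - z != 0 by rewrite subr_eq0.
  have -> : -1 * (F w * (w - 0)^-1) + F w * (w - z)^-1 = F w * z * (w - z)^-1 * w^-1.
    by rewrite subr0; field; rewrite wz1 w0.
  have fz := frame_far (K_s _ Kz) hw; have fw := frame_nm hw.
  rewrite !nmM !nmV -mulrA; apply: ler_pM; rewrite ?mulr_ge0 ?invr_ge0 ?nm_ge0 //.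
    by apply: ler_wpM2r.
  have -> : 2 / s ^+ 2 = (s / 2)^-1 * s^-1 by field; rewrite lt0r_neq0.
  apply: ler_pM; rewrite ?invr_ge0 ?nm_ge0 // lef_pV2 ?posrE //.
    exact: lt_le_trans fz.
  exact: lt_le_trans fw.
have s1 : s != 0 by rewrite lt0r_neq0.
have eE : M * nm z * (2 / s ^+ 2) * (8 * s) = 4 * (4 * M * nm z) / s by field.
move: B; rewrite nmM eE => B.
have h : nm (F z - F 0) * 4 <= nm (F z - F 0) * nm W by apply: ler_wpM2l => //; exact: nm_ge0.
have : 4 * M * nm z / s <= e.
  rewrite ler_pdivrMr // [e * s]mulrC -ler_pdivrMr // /s; lra.
lra.
Qed.

(** Continuity at infinity bounds [f] outside a disc, and continuity in the plane bounds it on a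
    square that contains the disc, so [liouville] applies; continuity gives the value at
    infinity. *)
Lemma holomorphic_sphere_const (f : sphere R -> cplx R) :
  (forall x, complex_differentiable_at f x) -> exists k : cplx R, forall x, f x = k.
Proof.
move=> df; pose F (z : C) : C := f (Some (z : cplx R)).
have dF z : dif F z by exact: derivable_dif (df (Some _)).
pose g (w : C) : C := f (chart_infty w).
have cg : cont_at g 0 by apply: dif_cont; exact: derivable_dif (df None).
have g0 : g 0 = f None by rewrite /g /chart_infty eqxx.
have gF w : w != 0 -> g w = F w^-1 by rewrite /g /chart_infty => /negbTE ->.
have [d d0 hd] := cg 1 ltr01.
have di : 0 < d^-1 by rewrite invr_gt0.
have Lneg : - d^-1 <= d^-1 by lra.
have [|M M0 HM] := @cts_bounded R F _ _ _ _ Lneg Lneg.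
  by apply: cont_cts => z _; exact: dif_cont.
have Fb z : nm (F z) <= M + (nm (f None) + 1).
  have f0 := nm_ge0 (f None).
  have [h|h] := leP (nm z) d^-1.
    apply: le_trans (HM z _) _; last by lra.
    by have := nm_Re z; have := nm_Im z => h1 h2; split; rewrite -ler_norml; lra.
  have z0 : z != 0 by rewrite -nm_gt0; lra.
  have := hd z^-1; rewrite subr0 nmV -[X in _ < X]invrK ltf_pV2 ?posrE ?nm_gt0 //.
  move=> /(_ h); rewrite gF ?invr_neq0 // invrK g0.
  by have := nm_lower (F z) (f None); lra.
have Fc := liouville dF Fb.
exists (F 0) => -[z|]; first exact: Fc.
apply/subr0_eq/small_eq0 => e e0; have [r r0 hr] := cg _ e0.
pose w : C := (r / 2)%:C%C.
have r2 : 0 < r / 2 by rewrite divr_gt0.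
have nw : nm w = r / 2 by rewrite nm_real gtr0_norm.
have w0 : w != 0 by rewrite -nm_gt0 nw.
have := hr w; rewrite subr0 nw gF // Fc g0 nm_sub; apply; lra.
Qed.

End Liouville.

(** * Transfer from the plane to the sphere *)

Section SphereRunge.
Variable R : realType.
Local Notation C := R[i].
Local Notation nm := (@ComplexField.Normc.normc R).
Variables (K P U : set (sphere R)) (f : sphere R -> cplx R).
Hypotheses (K_compact : compact K) (P_points : one_point_per_component (~` K) P)
  (U_open : open U) (K_sub_U : K `<=` U) (f_holo : holomorphic_on U f).
Variables (p0 : sphere R) (phi : C -> sphere R).
Hypotheses (Pp0 : P p0) (Kp0 : ~ K p0) (phi_chart : chart_at p0 phi).

Let Kp (u : C) := K (phi u).
Let Pp (u : C) := P (phi u).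

Lemma nbhs_compl x : ~ K x -> nbhs x (~` K).
Proof.
move=> nKx; apply: open_nbhs_nbhs; split => //.
exact/closed_openC/(compact_closed (@sphere_hausdorff R)).
Qed.

Lemma chart_bounded : exists2 L : R, 0 < L & forall u, Kp u -> nm u <= L.
Proof.
have /(chart_nbhs_infty phi_chart)[_ [L HL]] := nbhs_compl Kp0.
exists (`|L| + 1); first by rewrite ltr_wpDl.
move=> u Ku; rewrite leNgt; apply/negP => h; have := HL u; apply => //.
by have := ler_norm L; lra.
Qed.

Lemma chart_closed u : ~ Kp u ->
  exists2 d, 0 < d & forall v, Kp v -> d <= nm (v - u).
Proof.
move=> /nbhs_compl/(chart_nbhs phi_chart)[d d0 hd]; exists d => // v Kv.
by rewrite leNgt; apply/negP => /hd.
Qed.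

Lemma chart_pushable u : ~ Kp u -> pushable Kp Pp u.
Proof.
(* [p0] has no coordinate, so it belongs to [V] vacuously; this lets a component that contains [p0]
   be treated like the others. *)
move=> nKu; pose V : set (sphere R) := [set y | forall v, y = phi v -> pushable Kp Pp v].
suff : V (phi u) by apply.
have VE v : V (phi v) <-> pushable Kp Pp v.
  by split => [|h w /(chart_inj phi_chart) <-//]; apply.
have V0 : V p0 by move=> v e; case: (chart_neq phi_chart (u := v)).
have Vopen : open V.
  rewrite openE => y Vy; rewrite /interior.
  have [->|yp] := pselect (y = p0).
    apply/(chart_nbhs_infty phi_chart); split => //.
    have [L L0 HL] := chart_bounded; exists L => w Lw.
    by apply/VE; exact: pushable_infty HL Lw.
  have [v yE] := chart_onto phi_chart yp; rewrite yE in Vy *.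
  have /VE/pushable_open[r r0 hr] := Vy.
  by apply/(chart_nbhs phi_chart); exists r => // w /hr /VE.
have [q [[Pq [Cc [Cu CK conC] Cq]] _]] := P_points (nKu : (~` K) (phi u)).
have Vq : V q.
  have [->//|qp] := pselect (q = p0).
  have [v qE] := chart_onto phi_chart qp; rewrite qE in Pq Cq *; apply/VE.
  have [d d0 hd] := chart_closed (CK _ Cq).
  exact: pushable_pole Pq d0 hd.
suff CV : Cc `&` V = Cc by rewrite -CV in Cu; case: Cu.
apply: conC; first by exists q.
  by exists V.
(* [V] is closed relative to the component: at a point of [closure V] off K, with distance d to K in
   the coordinate, some pushable point lies within d / 3, as [pushable_closed] requires. *)
exists (closure V); first exact: closed_closure.
apply/seteqP; split => y [Cy]; first by move=> Vy; split => //; exact: subset_closure.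
move=> clV; split => //; apply: contrapT => nVy.
have yp : y <> p0 by move=> e; apply: nVy; rewrite e.
have [v yE] := chart_onto phi_chart yp; rewrite yE in Cy clV nVy.
have [d d0 hd] := chart_closed (CK _ Cy).
have [x [Vx nVx]] : (V `&` ~` V) !=set0; last by [].
apply: clV; apply/(chart_nbhs phi_chart); exists (d / 3); first by rewrite divr_gt0.
move=> w wv /VE pw; apply: nVy; apply/VE.
by apply: pushable_closed d0 hd pw _; rewrite nm_sub.
Qed.

Lemma sphere_runge_chart :
  exists (A B : R) (r : nat -> sphere R -> sphere R),
    [/\ 1 < A, 1 < B &
      forall n : nat,
        [/\ rational_map (r n),
            exists2 d : nat, topological_degree (r n) d & (d <= n)%N,
            r n @^-1` [set None] `<=` P &
            (ereal_sup [set sphere_dist (f z) (r n z) | z in K]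
               <= (A / B ^+ n)%:E)%E]].
Proof.
have [L _ HL] := chart_bounded.
have Kdif u : Kp u -> exists2 r, 0 < r & forall w, nm (w - u) < r ->
    dif (fun w => f (phi w)) w.
  move=> /K_sub_U Uu; have : nbhs (phi u) U by exact: open_nbhs_nbhs.
  move=> /(chart_nbhs phi_chart)[r r0 hr]; exists r => // w /hr Uw.
  exact/(chart_dif phi_chart)/f_holo.
have [A [B [A1 B1 H]]] := plane_runge HL chart_closed Kdif chart_pushable.
have {H} H n : exists r : sphere R -> sphere R, [/\ rational_map r,
    exists2 d : nat, topological_degree r d & (d <= n)%N,
    r @^-1` [set None] `<=` P &
    (ereal_sup [set sphere_dist (f z) (r z) | z in K] <= (A / B ^+ n)%:E)%E].
  have [Q [D [Dok sQ sD HQ]]] := H n.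
  have [r [r1 r2 r3 r4]] := chart_realize phi_chart Dok.1 sQ sD.
  exists r; split=> //.
    (* A pole at [p0], that is at infinity in the coordinate, is allowed since [p0] is in P; the
       other poles are roots of [D]. *)
    move=> x rx; have [->//|xp] := pselect (x = p0).
    have [u xE] := chart_onto phi_chart xp; rewrite xE in rx *.
    by apply: (Dok.2 u _).1; apply/eqP; exact: r3.
  apply: ge_ereal_sup => _ [z Kz <-].
  have zp : z <> p0 by move=> e; rewrite e in Kz.
  have [u zE] := chart_onto phi_chart zp; rewrite zE in Kz *.
  rewrite r4; last exact: pole_ok_neq0 Dok Kz.
  by rewrite /sphere_dist lee_fin; exact: HQ.
have {H} [r Hr] := choice H.
by exists A, B, r.
Qed.

End SphereRunge.

(** This serves when K is the whole sphere, where no point of P outside K is available to start a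
    chart. One constant map is used for every n. *)
Lemma constant_map_approx (R : realType) (K P : set (sphere R))
    (f : sphere R -> cplx R) (k : cplx R) : (forall x, f x = k) ->
  exists (A B : R) (r : nat -> sphere R -> sphere R),
    [/\ 1 < A, 1 < B &
      forall n : nat,
        [/\ rational_map (r n),
            exists2 d : nat, topological_degree (r n) d & (d <= n)%N,
            r n @^-1` [set None] `<=` P &
            (ereal_sup [set sphere_dist (f z) (r n z) | z in K]
               <= (A / B ^+ n)%:E)%E]].
Proof.
move=> fk; have n1 : (1 : {poly R[i]}) != 0 by rewrite oner_neq0.
have [|//|r [r1 r2 [r3 r4] r5 r6]] := @fraction_realize R (k : R[i])%:P 1 0 n1.
- by rewrite size_polyC; case: (_ != 0).
- by rewrite size_poly1.
have rk x : r x = Some k.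
  case: x => [z|]; first by rewrite r5 !hornerC ?oner_neq0 // divr1.
  by rewrite r6 !coefC ?oner_neq0 //= divr1.
exists 2, 2, (fun=> r); split; rewrite ?ltr1n // => n; split=> //.
- by have [d hd d0] := r2; exists d => //; exact: leq_trans d0 _.
- by move=> x /=; rewrite rk.
- apply: ge_ereal_sup => _ [z Kz <-]; rewrite fk rk /= subrr nm0 lee_fin.
  by rewrite divr_ge0 ?exprn_ge0.
Qed.

Unset Implicit Arguments.

Theorem theorem2 (R : realType) (K P U : set (sphere R))
    (f : sphere R -> cplx R)
    (K_compact : compact K)
    (P_points : one_point_per_component (~` K) P)
    (U_open : open U) (K_sub_U : K `<=` U)
    (f_holo : holomorphic_on U f) :
  exists (A B : R) (r : nat -> sphere R -> sphere R),
    [/\ 1 < A, 1 < B &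
      forall n : nat, (0 < n)%N ->
        [/\ rational_map (r n),
            exists2 d : nat, topological_degree (r n) d & (d <= n)%N,
            r n @^-1` [set None] `<=` P &
            (ereal_sup [set sphere_dist (f z) (r n z) | z in K]
               <= (A / B ^+ n)%:E)%E]].
Proof.
have [[x nKx]|full] := pselect (exists x, ~ K x).
  have [p [[Pp [Cc [_ CK _] Cp]] _]] := P_points x nKx.
  have [phi phi_chart] := exists_chart p.
  have [A [B [r [A1 B1 H]]]] :=
    sphere_runge_chart K_compact P_points U_open K_sub_U f_holo Pp (CK _ Cp) phi_chart.
  by exists A, B, r; split.
have [k fk] : exists k, forall x, f x = k.
  apply: holomorphic_sphere_const => x; apply: f_holo; apply: K_sub_U.
  by apply: contrapT => nKx; apply: full; exists x.
have [A [B [r [A1 B1 H]]]] := constant_map_approx K P fk.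
by exists A, B, r; split.
Qed.
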